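(* Assume condition (S) below. Then $$n^{1/2}(\hat p_n-p)\xrightarrow{\mathcal D}\mathcal N(0,\sigma^2),$$ with $$\sigma^2=\sum_{k=-\infty}^{\infty}\mathbb{E}\Big[\big(\mathbf 1_{\{\tilde\Pi(Y_1^{(1)},\ldots,Y_h^{(1)})=\tilde\Pi(Y_1^{(2)},\ldots,Y_h^{(2)})\}}-p\big)\big(\mathbf 1_{\{\tilde\Pi(Y_{1+k}^{(1)},\ldots,Y_{h+k}^{(1)})=\tilde\Pi(Y_{1+k}^{(2)},\ldots,Y_{h+k}^{(2)})\}}-p\big)\Big].$$
   Context: Setting: $(X_j^{(1)},X_j^{(2)})_{j}$ is a bivariate time series whose increments $Y_j^{(p)}=X_j^{(p)}-X_{j-1}^{(p)}$ form a bivariate stationary centered Gaussian process $(Y_j)_{j\in\mathbb{Z}}$ with $Y_j^{(p)}\sim\mathcal N(0,1)$ and cross-correlations $r^{(p,q)}(k)=\mathbb{E}(Y_j^{(p)}Y_{j+k}^{(q)})$ with $|r^{(p,q)}(k)|<1$ for $k\ge1$, $p,q=1,2$. Condition (S): $d_1,d_2\in(-\infty,0)\cup(0,\frac14)$ and for $p,q=1,2$, $r^{(p,q)}(k)=k^{d_p+d_q-1}L_{p,q}(k)$ with $L_{p,q}(k)\to L_{p,q}\in\mathbb{R}$ as $k\to\infty$. Ordinal patterns: for $x\in\mathbb{R}^{h+1}$, $\Pi(x)$ is the unique permutation $(\pi_0,\ldots,\pi_h)$ of $\{0,\ldots,h\}$ with $x_{\pi_0}\ge\cdots\ge x_{\pi_h}$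 and $\pi_{i-1}<\pi_i$ when $x_{\pi_{i-1}}=x_{\pi_i}$; $\tilde\Pi(y_1,\ldots,y_h)=\Pi(0,y_1,y_1+y_2,\ldots,y_1+\cdots+y_h)$. $p=\mathbb{P}(\tilde\Pi(Y_1^{(1)},\ldots,Y_h^{(1)})=\tilde\Pi(Y_1^{(2)},\ldots,Y_h^{(2)}))$; $\hat p_n=\frac{1}{n-h}\sum_{j=1}^{n-h}\mathbf 1_{\{\tilde\Pi(Y_j^{(1)},\ldots,Y_{j+h-1}^{(1)})=\tilde\Pi(Y_j^{(2)},\ldots,Y_{j+h-1}^{(2)})\}}$. *)

(* Defs.v *)
From HB Require Import structures.
From mathcomp Require Import all_boot all_order all_algebra.
From mathcomp Require Import all_classical all_reals all_analysis.
Set Implicit Arguments. Unset Strict Implicit. Unset Printing Implicit Defensive.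
Import Order.TTheory GRing.Theory Num.Theory.
Import numFieldNormedType.Exports.
Local Open Scope classical_set_scope.
Local Open Scope ring_scope.

Section defs.
Context {R : realType}.

Definition gauss_law (v : R) : set R -> \bar R :=
  if v == 0 then (fun A => \d_(0:R) A) else normal_prob 0 (Num.sqrt v).

(** Ordinal pattern Pi(x_0,...,x_h): the permutation (pi_0,...,pi_h) of
    {0,...,h} with x_{pi_0} >= ... >= x_{pi_h}, ties broken by increasing
    index; obtained by sorting 0..h w.r.t. this total order. *)
Definition ord_pattern (h : nat) (x : nat -> R) : seq nat :=
  sort (fun i j => (x j < x i) || ((x i == x j) && (i <= j)%N)) (iota 0 h.+1).

Definition tilde_pattern (h : nat) (y : nat -> R) : seq nat :=
  ord_pattern h (fun i => \sum_(1 <= l < i.+1) y l).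

Context {d : measure_display} {T : measurableType d}.

(** Indicator of the event that the patterns of (Y_j^(1),...,Y_{j+h-1}^(1))
    and (Y_j^(2),...,Y_{j+h-1}^(2)) coincide. Component 1 is [ord0],
    component 2 is [ord_max] (= 1) in 'I_2. *)
Definition same_pattern (h : nat) (Y : 'I_2 -> int -> T -> R) (j : int) (x : T)
  : bool :=
  tilde_pattern h (fun l => Y ord0 (j + l%:Z - 1) x)
  == tilde_pattern h (fun l => Y ord_max (j + l%:Z - 1) x).

Definition ind_pattern h Y j x : R := if same_pattern h Y j x then 1 else 0.

Definition p_pattern (P : probability T R) h Y : R :=
  fine (P [set x | same_pattern h Y 1 x]).

Definition phat (h : nat) Y (n : nat) (x : T) : R :=
  ((n - h)%:R)^-1 * \sum_(1 <= j < (n - h).+1) ind_pattern h Y j%:Z x.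

Definition cvg_in_law (P : probability T R) (Z : nat -> T -> R)
  (mu : set R -> \bar R) : Prop :=
  forall t : R, {for t, continuous (fun u : R => fine (mu [set y | y <= u]))} ->
    (fun n => fine (P [set x | Z n x <= t])) @ \oo --> fine (mu [set y | y <= t]).

Definition centered_gaussian_process (P : probability T R)
  (Y : 'I_2 -> int -> T -> R) : Prop :=
  forall s : seq ('I_2 * int * R), exists v : R, 0 <= v /\
    forall B : set R, measurable B ->
      P ((fun x => \sum_(c <- s) c.2 * Y c.1.1 c.1.2 x) @^-1` B) = gauss_law v B.

End defs.

(* Main.v *)
(* The coincidence of patterns is almost surely, since ties have probability 0, the product over
   i < k of (1 + sgn(X^(1)_k - X^(1)_i) sgn(X^(2)_k - X^(2)_i)) / 2. Iterating
   q(y) = (3 y - y^3) / 2 on sin(x / (m + 1)) approximates sgn boundedly and pointwise, so this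
   indicator is a bounded limit of cosine sums [\sum c cos(lambda . X_j)] with the same
   coefficients for every j. Being even, a centered cosine sum has covariance at lag k at most
   const * gam(k)^2 times its variance, where gam(k) bounds the cross-correlations at lag k; here
   the constant does not depend on the sum. Condition (S) makes gam^2 summable, so
   the approximation holds in L^2 uniformly in n after division by sqrt n. For a fixed cosine sum
   the characteristic function phi(t) of the normalized partial sum satisfies
   phi'(t) = - s2 t phi(t) + o(1): multiplying by cos g amounts to a complex (Cameron-Martin)
   shift of the Gaussian vector. Convergence of characteristic functions is turned into
   convergence in law by smoothed steps that are again finite trigonometric sums. *)
Require Import Defs.
From HB Require Import structures.
From mathcomp Require Import all_boot all_order all_algebra.
From mathcomp Require Import all_classical all_reals all_analysis measurable_realfun.
From mathcomp Require Import ring lra.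
Set Implicit Arguments. Unset Strict Implicit. Unset Printing Implicit Defensive.
Import Order.TTheory GRing.Theory Num.Theory.
Import numFieldNormedType.Exports.
Local Open Scope classical_set_scope.
Local Open Scope ring_scope.

(** * Calculus and Gaussian integrals *)

(** The obstacle is the range 0 < d < 1/4, where correlations are square summable but need not be
    summable. Over n lags their absolute values add up only to o(sqrt n), so sup bounds on the
    imaginary part of the shift are too weak and second moments are needed ([EB2_le]). Cosines
    replace Hermite polynomials because their covariances are explicit: Cov(cos f, cos g) is a
    multiple of cosh Q(f, g) - 1, whose power series has nonnegative coefficients and starts in
    degree two. Degree two produces gam^2; nonnegativity lets a Schur test run degree by degree,
    with a constant that does not see the sum. Hence an L^2 approximation of the indicator at a
    single time controls the normalized sums for every n. Only single correlations are bounded, and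
    none across components at lag 0: the two components may coincide. So the covariance matrix of a
    window can be singular and sigma^2 can vanish, which explains the generalized inverse and the
    Dirac case. *)

Section derive_rules.
Context {R : realType}.
Implicit Types (f g : R -> R) (x : R).

Lemma drv_eq f x a b : is_derive x 1 f a -> a = b -> is_derive x 1 f b.
Proof. by move=> h <-. Qed.

Lemma drv_id x : is_derive x 1 (fun y : R => y) (1 : R).
Proof. exact: is_derive_id. Qed.

Lemma drv_cst x c : is_derive x 1 (fun _ : R => c : R) (0 : R).
Proof. exact: is_derive_cst. Qed.

Lemma drv_add f g x a b : is_derive x 1 f a -> is_derive x 1 g b ->
  is_derive x 1 (fun y => f y + g y) (a + b).
Proof. by move=> hf hg; exact: is_deriveD. Qed.

Lemma drv_opp f x a : is_derive x 1 f a -> is_derive x 1 (fun y => - f y) (- a).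
Proof. by move=> hf; exact: is_deriveN. Qed.

Lemma drv_sub f g x a b : is_derive x 1 f a -> is_derive x 1 g b ->
  is_derive x 1 (fun y => f y - g y) (a - b).
Proof. by move=> hf hg; exact: is_deriveB. Qed.

Lemma drv_mul f g x a b : is_derive x 1 f a -> is_derive x 1 g b ->
  is_derive x 1 (fun y => f y * g y) (f x * b + g x * a).
Proof. by move=> hf hg; exact: is_deriveM. Qed.

Lemma drv_mull f x a c : is_derive x 1 f a -> is_derive x 1 (fun y => c * f y) (c * a).
Proof.
by move=> hf; apply: (drv_eq (drv_mul (drv_cst x c) hf)); rewrite mulr0 addr0.
Qed.

Lemma drv_pow n x : is_derive x 1 (fun y : R => y ^+ n.+1) (n.+1%:R * x ^+ n).
Proof.
elim: n => [|n ih]; first by apply: (drv_eq (drv_id x)); rewrite mulr1.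
rewrite (_ : (fun y => _) = (fun y : R => y * y ^+ n.+1)); last first.
  by apply/funext => y; rewrite exprS.
apply: (drv_eq (drv_mul (drv_id x) ih)).
by rewrite mulr1 mulrCA -exprS -[in RHS]natr1 mulrDl mul1r.
Qed.

Lemma drv_comp f g x a b : is_derive (g x) 1 f a -> is_derive x 1 g b ->
  is_derive x 1 (fun y => f (g y)) (a * b).
Proof. by move=> hf hg; apply: (drv_eq (is_derive1_comp hf hg)); rewrite /GRing.scale/= mulrC. Qed.

Lemma drv_cos g x b : is_derive x 1 g b ->
  is_derive x 1 (fun y => cos (g y)) (- sin (g x) * b).
Proof. by apply: drv_comp; exact: is_derive_cos. Qed.

Lemma drv_sin g x b : is_derive x 1 g b ->
  is_derive x 1 (fun y => sin (g y)) (cos (g x) * b).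
Proof. by apply: drv_comp; exact: is_derive_sin. Qed.

Lemma drv_exp g x b : is_derive x 1 g b ->
  is_derive x 1 (fun y => expR (g y)) (expR (g x) * b).
Proof. by apply: drv_comp; exact: is_derive_expR. Qed.

Lemma drv_sum (I : Type) (r : seq I) (f : I -> R -> R) (a : I -> R) x :
  (forall i, is_derive x 1 (f i) (a i)) ->
  is_derive x 1 (fun y => \sum_(i <- r) f i y) (\sum_(i <- r) a i).
Proof.
move=> h; elim: r => [|i r ih].
  rewrite (_ : (fun y => _) = (fun _ => 0)); first by rewrite big_nil; exact: drv_cst.
  by apply/funext => y; rewrite big_nil.
rewrite (_ : (fun y => _) = (fun y => f i y + \sum_(i <- r) f i y)).
  by rewrite big_cons; exact: drv_add.
by apply/funext => y; rewrite big_cons.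
Qed.

Lemma drv_continuous f (a : R -> R) : (forall x, is_derive x 1 f (a x)) -> continuous f.
Proof.
move=> h x; apply: differentiable_continuous; apply/derivable1_diffP.
by apply: ex_derive; exact: h.
Qed.

Lemma drv_ge0_le f (f' : R -> R) a b : (forall x, is_derive x 1 f (f' x)) ->
  (forall x, a <= x <= b -> 0 <= f' x) -> a <= b -> f a <= f b.
Proof.
move=> df f0 ab; apply: (@ger0_derive1_ndecr _ f a b) => //.
- by move=> x; rewrite in_itv/= => /andP[/ltW ax /ltW xb]; rewrite derive1E derive_val f0// ax.
- by apply: continuous_subspaceT; exact: drv_continuous df.
Qed.

Lemma continuous_cos_affine t th : continuous (fun x : R => cos (t * x + th)).
Proof.
exact: (drv_continuous (fun x => drv_cos (drv_add (drv_mull t (drv_id x)) (drv_cst x th)))).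
Qed.

Lemma continuous_sin_affine t th : continuous (fun x : R => sin (t * x + th)).
Proof.
exact: (drv_continuous (fun x => drv_sin (drv_add (drv_mull t (drv_id x)) (drv_cst x th)))).
Qed.

End derive_rules.

Section real_integrable.
Context d (T : measurableType d) (R : realType) (mu : {measure set T -> \bar R}).
Local Notation itg f := (mu.-integrable setT (EFin \o f)).
Implicit Types f g : T -> R.

Lemma itgD f g : itg f -> itg g -> itg (fun x => f x + g x).
Proof.
move=> hf hg; have := @integrableD _ _ _ mu _ measurableT _ _ hf hg.
by apply: eq_integrable => // x _; rewrite /= EFinD.
Qed.

Lemma itgB f g : itg f -> itg g -> itg (fun x => f x - g x).
Proof.
move=> hf hg; have := @integrableB _ _ _ mu _ measurableT _ _ hf hg.
by apply: eq_integrable => // x _; rewrite /= EFinB.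
Qed.

Lemma itgZ k f : itg f -> itg (fun x => k * f x).
Proof.
move=> hf; have := @integrableZl _ _ _ mu _ measurableT k _ hf.
by apply: eq_integrable => // x _; rewrite /= EFinM.
Qed.

Lemma itg_le f g : measurable_fun setT f -> itg g -> (forall x, `|f x| <= g x) -> itg f.
Proof.
move=> mf hg fg; apply: (le_integrable _ _ _ hg) => //; first exact/measurable_EFinP.
by move=> x _; rewrite /= lee_fin (le_trans (fg x))// ler_norm.
Qed.

End real_integrable.

Local Notation leb := (@lebesgue_measure _).

Lemma integral_normal_prob (R : realType) (m s : R) (f : R -> \bar R) :
  (normal_prob m s).-integrable setT f ->
  (\int[normal_prob m s]_x f x = \int[leb]_x (f x * (normal_pdf m s x)%:E))%E.
Proof.
move=> fi; have mf := measurable_int _ fi.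
rewrite -(Radon_Nikodym_change_of_variables (normal_prob_dominates m s))//=.
apply: ae_eq_integral => //.
- apply: emeasurable_funM => //; apply: (measurable_int leb).
  exact/Radon_Nikodym_integrable/normal_prob_dominates.
- apply: emeasurable_funM => //=; apply/measurable_EFinP.
  exact: measurable_normal_pdf.
- apply: ae_eqe_mul2l => /=.
  rewrite Radon_NikodymE//=; first exact: normal_prob_dominates.
  move=> nmu; case: cid => /= h [h1 h2 h3].
  apply: integral_ae_eq => //=.
  + by apply/measurable_EFinP; exact: measurable_normal_pdf.
  + by move=> E ET mE; rewrite -h3.
Qed.

(** Serves as integration by parts over the whole line. The integral over [[-n, n]] is
    [F n - F (- n)], which the decay hypothesis bounds by [2 K / n]; dominated convergence
    identifies its limit. *)
Lemma Rintegral_derive_eq0 (R : realType) (F f : R -> R) (K : R) :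
  (forall x : R, is_derive x 1 F (f x)) -> continuous f ->
  leb.-integrable setT (EFin \o f) ->
  (forall x, `|x| * `|F x| <= K) ->
  \int[leb]_x f x = 0.
Proof.
move=> dF cf fi FK.
have dFx (x : R) : derivable F x 1 by apply: ex_derive; exact: dF.
have cF : continuous F.
  by move=> x; apply: differentiable_continuous; exact/derivable1_diffP.
have mf : measurable_fun setT f by apply: continuous_measurable_fun.
pose fn (n : nat) (x : R) : \bar R := ((f \_ `[- n%:R, n%:R]) x)%:E.
have fnE n : (\int[leb]_x fn n x)%E = (\int[leb]_(x in `[(- n%:R)%R, n%:R%R]) (f x)%:E)%E.
  by rewrite [RHS]integral_mkcond/=; apply: eq_integral => x _; rewrite /fn restrict_EFin.
have h : (fun n => (\int[leb]_x fn n x)%E) @ \oo --> (\int[leb]_x (EFin \o f) x)%E.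
  have mfn n : measurable_fun setT (fn n).
    by apply/measurable_EFinP/(measurable_restrictT _ _).1 => //; exact: measurable_funTS.
  have cfn : {ae leb, forall x, setT x -> fn ^~ x @ \oo --> (EFin \o f) x}.
    apply: aeW => x _; apply: cvg_EFin; first exact: nearW.
    apply: cvg_near_cst; near=> n; rewrite /= patchE mem_set//=.
    rewrite in_itv/= -ler_norml; near: n; exact: nbhs_infty_ger.
  have fnf : {ae leb, forall x n, setT x -> (`|fn n x| <= (abse \o (EFin \o f)) x)%E}.
    apply: aeW => x n _; rewrite /fn lee_fin patchE; case: ifPn => // _.
    by rewrite normr0.
  have [] // := @dominated_convergence _ _ _ leb setT measurableT fn (EFin \o f)
    (abse \o (EFin \o f)) mfn _ cfn _ fnf; first exact/measurable_EFinP.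
  exact: integrable_abse.
have h0 : (fun n => (\int[leb]_x fn n x)%E) @ \oo --> 0%E.
  rewrite -(cvg_shiftS _)/=.
  have -> : (fun n => (\int[leb]_x fn n.+1 x)%E) = (fun n => (F n.+1%:R - F (- n.+1%:R))%:E).
    apply/funext => n; rewrite fnE (@continuous_FTC2 _ f F)//.
    - by rewrite (@lt_trans _ _ (0:R)) ?oppr_lt0 ?ltr0n.
    - exact: continuous_subspaceT.
    - split=> [x _||]; first exact: dFx.
      + by apply: cvg_at_right_filter; exact: cF.
      + by apply: cvg_at_left_filter; exact: cF.
    - by move=> x _; rewrite derive1E; apply: derive_val.
  apply: cvg_EFin; first exact: nearW.
  rewrite [X in X @ _ --> _](_ : _ = (fun n => F n.+1%:R - F (- n.+1%:R)))//.
  apply: (@squeeze_cvgr _ _ _ _ (fun n => - (K *+ 2 * n.+1%:R^-1)) (fun n => K *+ 2 * n.+1%:R^-1)).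
  - apply: nearW => n /=; rewrite -ler_norml (le_trans (ler_normB _ _))//.
    have K1 := FK n.+1%:R; have K2 := FK (- n.+1%:R).
    rewrite normrN in K2.
    rewrite ger0_norm// in K1 K2.
    by rewrite ler_pdivlMr ?ltr0n// mulrC mulr2n mulrDr lerD.
  - rewrite -oppr0; apply: cvgN; rewrite -[X in _ --> X](mulr0 (K *+ 2)).
    by apply: cvgMl_tmp; exact: cvg_harmonic.
  - rewrite -[X in _ --> X](mulr0 (K *+ 2)).
    by apply: cvgMl_tmp; exact: cvg_harmonic.
by rewrite /Rintegral (cvg_unique _ h h0).
Unshelve. all: end_near. Qed.

Section normal_pdf_integrals.
Context {R : realType} (s : R) (s0 : 0 < s).
Let w := normal_pdf 0 s.

Let wE x : w x = normal_peak s * expR (- (x ^+ 2 / (s ^+ 2 *+ 2))).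
Proof. by rewrite /w normal_pdfE ?gt_eqF//= /normal_fun subr0 mulNr. Qed.

Let w_ge0 (x : R) : 0 <= w x. Proof. exact: normal_pdf_ge0. Qed.

Let s2 : 0 < s ^+ 2 *+ 2. Proof. by rewrite pmulrn_lgt0// exprn_gt0. Qed.

Lemma is_derive_normal_pdf (x : R) : is_derive x 1 w (- (x / s ^+ 2) * w x).
Proof.
have -> : w = (fun x => normal_peak s * expR (- (x ^+ 2 / (s ^+ 2 *+ 2)))).
  by apply/funext => y; rewrite wE.
have h : is_derive x 1 (fun y => - (y ^+ 2 / (s ^+ 2 *+ 2))) (- (x / s ^+ 2)).
  apply: (drv_eq (drv_opp (drv_mul (drv_pow 1 x) (drv_cst x _)))).
  by rewrite expr1 -[_ *+ 2]mulr_natr; field; rewrite gt_eqF.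
apply: (drv_eq (drv_mull _ (drv_exp h))); ring.
Qed.

(** With [u = x^2 / (4 s^2)] this is [u exp(-2u) <= exp(-u)]: half of the exponent pays for the
    factor [x^2], which leaves a Gaussian profile of standard deviation [s sqrt 2]. *)
Lemma sqr_normal_pdf_le x : x ^+ 2 * w x <=
  s ^+ 2 *+ 4 * normal_peak s * normal_fun 0 (s * Num.sqrt 2) x.
Proof.
suff h : x ^+ 2 * expR (- (x ^+ 2 / (s ^+ 2 *+ 2))) <= s ^+ 2 *+ 4 * normal_fun 0 (s * Num.sqrt 2) x.
  by have := ler_wpM2l (normal_peak_ge0 s) h; rewrite wE; lra.
rewrite /normal_fun subr0.
set u := x ^+ 2 / (s ^+ 2 *+ 4).
have s40 : 0 < s ^+ 2 *+ 4 by rewrite pmulrn_lgt0// exprn_gt0.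
have -> : x ^+ 2 = u * (s ^+ 2 *+ 4) by rewrite /u divfK// gt_eqF.
have -> : u * (s ^+ 2 *+ 4) / (s ^+ 2 *+ 2) = u + u.
  by rewrite -[s ^+ 2 *+ 4]mulr_natr -[s ^+ 2 *+ 2]mulr_natr; field; rewrite gt_eqF.
have -> : - (u * (s ^+ 2 *+ 4)) / ((s * Num.sqrt 2) ^+ 2 *+ 2) = - u.
  rewrite exprMn sqr_sqrtr// -[s ^+ 2 *+ 4]mulr_natr -[_ *+ 2]mulr_natr.
  by field; rewrite gt_eqF.
rewrite [u * _]mulrC -mulrA ler_pM2l//.
rewrite opprD expRD mulrA -[leRHS]mul1r ler_pM2r ?expR_gt0//.
rewrite expRN ler_pdivrMr ?expR_gt0// mul1r.
by rewrite (le_trans _ (expR_ge1Dx _))// lerDr.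
Qed.

Lemma integrable_sqr_normal_pdf : leb.-integrable setT (fun x => (x ^+ 2 * w x)%:E).
Proof.
have s'0 : s * Num.sqrt 2 != 0 by rewrite gt_eqF// mulr_gt0// sqrtr_gt0.
apply: (@le_integrable _ _ _ leb _ measurableT _
  (fun x => ((s ^+ 2 *+ 4 * normal_peak s / normal_peak (s * Num.sqrt 2))%:E *
     (normal_pdf 0 (s * Num.sqrt 2) x)%:E)%E)).
- apply/measurable_EFinP/measurable_funM; first exact: measurable_funX.
  exact: measurable_normal_pdf.
- move=> x _; rewrite -EFinM lee_fin [leLHS]ger0_norm; last first.
    by rewrite mulr_ge0 ?sqr_ge0// normal_pdf_ge0.
  rewrite (le_trans (sqr_normal_pdf_le x))// normal_pdfE//=.
  rewrite (le_trans _ (ler_norm _))// -!mulrA mulKf//.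
  by rewrite gt_eqF// normal_peak_gt0.
- by apply: integrableZl => //; exact: integrable_normal_pdf.
Qed.

Lemma integrable_bnd_normal_pdf (f : R -> R) (K : R) : measurable_fun setT f ->
  (forall x, `|f x| <= K * (1 + x ^+ 2)) ->
  leb.-integrable setT (fun x => (f x * w x)%:E).
Proof.
move=> mf fK.
apply: (@le_integrable _ _ _ leb _ measurableT _
  (fun x => (K%:E * ((w x)%:E + (x ^+ 2 * w x)%:E))%E)).
- apply/measurable_EFinP/measurable_funM => //; exact: measurable_normal_pdf.
- move=> x _; rewrite -EFinD -EFinM lee_fin.
  apply: (@le_trans _ _ (`|f x| * w x)); first by rewrite normrM ler_wpM2l// ger0_norm.
  apply: le_trans (ler_norm _).
  by rewrite -{2}[w x]mul1r -mulrDl mulrA ler_wpM2r.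
- apply: integrableZl => //; apply: integrableD => //.
  + exact: integrable_normal_pdf.
  + exact: integrable_sqr_normal_pdf.
Qed.

Lemma sqr_normal_pdf_bounded x : x ^+ 2 * w x <= s ^+ 2 *+ 4 * normal_peak s.
Proof.
rewrite (le_trans (sqr_normal_pdf_le x))// -[leRHS]mulr1 ler_wpM2l//.
  by rewrite mulr_ge0 ?normal_peak_ge0// pmulrn_lge0// exprn_ge0// ltW.
rewrite /normal_fun -expR0 ler_expR mulNr oppr_le0 mulr_ge0 ?sqr_ge0// invr_ge0.
by rewrite pmulrn_lge0// exprn_even_ge0.
Qed.

(** The derivative of [x * w x] is [w x - x ^+ 2 * w x / s ^+ 2], and it integrates to zero. *)
Lemma Rintegral_sqr_normal_pdf : \int[leb]_x (x ^+ 2 * w x) = s ^+ 2.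
Proof.
have wint : leb.-integrable setT (EFin \o w) by exact: integrable_normal_pdf.
have xint := integrable_sqr_normal_pdf.
have h : \int[leb]_x (w x - (s ^+ 2)^-1 * (x ^+ 2 * w x)) = 0.
  apply: (@Rintegral_derive_eq0 _ (fun x => x * w x) _ (s ^+ 2 *+ 4 * normal_peak s)).
  - move=> x; have := is_derive_normal_pdf x => dw.
    by apply: (drv_eq (drv_mul (drv_id x) dw)); field; rewrite gt_eqF.
  - have cw : continuous w by apply: continuous_normal_pdf; rewrite gt_eqF.
    move=> x; apply: cvgB; first exact: cw.
    apply: cvgM; first exact: cvg_cst.
    by apply: cvgM; [exact: exprn_continuous|exact: cw].
  - exact/itgB/itgZ.
  - move=> x; rewrite normrM (ger0_norm (w_ge0 x)) mulrA -expr2 real_normK ?num_real//.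
    exact: sqr_normal_pdf_bounded.
move: h; rewrite RintegralB//; last exact: itgZ.
rewrite RintegralZl// {1}/Rintegral integral_normal_pdf/= => /eqP.
by rewrite subr_eq0 => /eqP h; rewrite -[LHS](mulVKf (lt0r_neq0 (exprn_gt0 2 s0))) -h mulr1.
Qed.

Let phi th t := \int[leb]_x (cos (t * x + th) * w x).

Let measurable_cosaff t th : measurable_fun setT (fun x : R => cos (t * x + th)).
Proof. apply: continuous_measurable_fun; exact: continuous_cos_affine. Qed.

Let cosint th t : leb.-integrable setT (fun x => (cos (t * x + th) * w x)%:E).
Proof.
apply: (@integrable_bnd_normal_pdf _ 1); first exact: measurable_cosaff.
by move=> x; rewrite mul1r (le_trans (cos_max _))// lerDl sqr_ge0.
Qed.

Let absle (x : R) : `|x| <= 1 + x ^+ 2.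
Proof.
rewrite -[x ^+ 2]real_normK ?num_real//.
have := sqr_ge0 (`|x| - 1); nra.
Qed.

(** Differentiation under the integral gives minus the integral of [x sin(t x + th) w x]. Since
    [w' = - x / s^2 * w], an integration by parts turns this into [- s^2 t] times the original
    integral. *)
Lemma is_derive_normal_char th t :
  is_derive (t : R) 1 (phi th) (- (s ^+ 2 * t) * phi th t).
Proof.
have msin : measurable_fun setT (fun x : R => sin (t * x + th)).
  apply: continuous_measurable_fun; exact: continuous_sin_affine.
have xsint : leb.-integrable setT (fun x => (x * sin (t * x + th) * w x)%:E).
  apply: (@integrable_bnd_normal_pdf _ 1); first exact: measurable_funM.
  move=> x; rewrite mul1r normrM (le_trans _ (absle x))//.
  by rewrite -[leRHS]mulr1 ler_wpM2l// sin_max.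
have ibp : \int[leb]_x (t * (cos (t * x + th) * w x) -
     (s ^+ 2)^-1 * (x * sin (t * x + th) * w x)) = 0.
  apply: (@Rintegral_derive_eq0 _ (fun x => sin (t * x + th) * w x) _
     (normal_peak s + s ^+ 2 *+ 4 * normal_peak s)).
  - move=> x; have dw := is_derive_normal_pdf x.
    have ds := drv_sin (drv_add (drv_mull t (drv_id x)) (drv_cst x th)).
    by apply: (drv_eq (drv_mul ds dw)); field; rewrite gt_eqF.
  - have cw : continuous w by apply: continuous_normal_pdf; rewrite gt_eqF.
    move=> x; apply: cvgB.
    + apply: cvgM; first exact: cvg_cst.
      apply: cvgM; last exact: cw.
      exact: continuous_cos_affine.
    + apply: cvgM; first exact: cvg_cst.
      apply: cvgM; last exact: cw.
      apply: cvgM; first exact: cvg_id.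
      exact: continuous_sin_affine.
  - apply: (itgB (itgZ t (cosint th t)) (itgZ _ xsint)).
  - move=> x; rewrite normrM (ger0_norm (w_ge0 x)).
    rewrite (@le_trans _ _ ((1 + x ^+ 2) * w x))//.
      rewrite mulrA ler_wpM2r ?normal_pdf_ge0// (le_trans _ (absle x))//.
      by rewrite -[leRHS]mulr1 ler_wpM2l// sin_max.
    rewrite mulrDl mul1r lerD ?sqr_normal_pdf_bounded// normal_pdf_ub// gt_eqF//.
rewrite (RintegralB measurableT (itgZ t (cosint th t)) (itgZ _ xsint)) in ibp.
rewrite (RintegralZl t measurableT (cosint th t)) (RintegralZl _ measurableT xsint) in ibp.
have -> : - (s ^+ 2 * t) * phi th t = \int[leb]_x (- (x * sin (t * x + th)) * w x).
  rewrite (_ : \int[leb]_x _ = - \int[leb]_x (x * sin (t * x + th) * w x)); last first.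
    rewrite -[RHS]mulN1r -RintegralZl//; apply: eq_Rintegral => x _.
    by rewrite mulN1r mulNr.
  rewrite -/(phi th t) in ibp.
  move/eqP : ibp; rewrite subr_eq0 => /eqP.
  move=> /(congr1 (fun z => - (s ^+ 2 * z))).
  by rewrite mulVKf ?gt_eqF ?exprn_gt0// => <-; rewrite mulNr mulrA.
have d1 x y : partial1of2 (fun t x => cos (t * x + th) * w x) x y =
    - (y * sin (x * y + th)) * w y.
  rewrite partial1of2E; have dc := drv_cos (drv_add (drv_mul (drv_id x) (drv_cst x y)) (drv_cst x th)).
  have [_ ->] := drv_mul dc (drv_cst x (w y)); ring.
have dint (x y : R) : derivable (fun t : R => cos (t * y + th) * w y) x 1.
  have dc := drv_cos (drv_add (drv_mul (drv_id x) (drv_cst x y)) (drv_cst x th)).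
  by have [] := drv_mul dc (drv_cst x (w y)).
have It : `]t - 1, t + 1[%classic t by rewrite /= in_itv/= ltrBlDr ltrDl ltr01.
(* Dominating function for the partial derivative in [t], since [|y| <= 1 + y ^+ 2]. *)
have Gint : leb.-integrable setT (EFin \o (fun x => (1 + x ^+ 2) * w x)).
  apply: (@integrable_bnd_normal_pdf _ 1).
    by apply: measurable_funD => //; exact: measurable_funX.
  by move=> x; rewrite mul1r ger0_norm// addr_ge0// sqr_ge0.
have G0 (x : R) : 0 <= (1 + x ^+ 2) * w x by rewrite mulr_ge0// addr_ge0// sqr_ge0.
have Gub x y : `]t - 1, t + 1[%classic x -> setT y ->
    `|partial1of2 (fun t x => cos (t * x + th) * w x) x y| <= (1 + y ^+ 2) * w y.
  move=> _ _; rewrite d1 normrM (ger0_norm (w_ge0 y)) ler_wpM2r// normrN normrM.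
  by rewrite (le_trans _ (absle y))// -[leRHS]mulr1 ler_wpM2l// sin_max.
apply: DeriveDef.
- exact: (@derivable_under_integral _ _ _ leb _ _ measurableT t _ _ It
    (fun x _ => cosint th x) (fun x y _ _ => dint x y) _ G0 Gint Gub).
- rewrite -derive1E (@differentiation_under_integral _ _ _ leb _ _ measurableT t _ _ It
    (fun x _ => cosint th x) (fun x y _ _ => dint x y) _ G0 Gint Gub).
  by apply: eq_Rintegral => x _; rewrite d1.
Qed.

Lemma normal_char th t : \int[leb]_x (cos (t * x + th) * w x) =
  cos th * expR (- (s ^+ 2 * t ^+ 2 / 2)).
Proof.
(* Multiplied by the inverse of the expected exponential, [phi] has derivative zero, so its value at
   [t = 0] decides. *)
pose g (t : R) := phi th t * expR (s ^+ 2 * t ^+ 2 / 2).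
have dg (x : R) : is_derive x 1 g 0.
  have de := drv_exp (drv_mul (drv_mull (s ^+ 2) (drv_pow 1 x)) (drv_cst x 2^-1)).
  by apply: (drv_eq (drv_mul (is_derive_normal_char th x) de)); rewrite expr1; field.
have gE : g t = cos th.
  have -> : cos th = g 0.
    rewrite /g /phi expr0n/= mulr0 mul0r expR0 mulr1.
    transitivity (\int[leb]_x (cos th * w x)).
      by rewrite RintegralZl ?integrable_normal_pdf// /Rintegral integral_normal_pdf/= mulr1.
    by apply: eq_Rintegral => x _; rewrite mul0r add0r.
  exact: is_derive_0_is_cst.
by rewrite expRN -gE /g mulfK ?gt_eqF ?expR_gt0.
Qed.
End normal_pdf_integrals.

Section gauss_law_expectation.
Context d (T : measurableType d) (R : realType) (P : probability T R).
Variables (g : T -> R) (v : R).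
Hypotheses (mg : measurable_fun setT g) (v0 : 0 <= v).
Hypothesis gv : forall B, measurable B -> P (g @^-1` B) = gauss_law v B.

Lemma gauss_law_Rintegral (F : R -> R) : 0 < v -> measurable_fun setT F ->
  P.-integrable setT (EFin \o (F \o g)) ->
  \int[P]_x F (g x) = \int[leb]_x (F x * normal_pdf 0 (Num.sqrt v) x).
Proof.
move=> vp mF Fg; have mF' : measurable_fun setT (EFin \o F) by exact/measurable_EFinP.
(* [g] with its codomain retyped as the measurable space that carries [normal_prob]. *)
pose g' : T -> measurableTypeR R := g.
have mg' : measurable_fun setT g' by [].
have pE f : (\int[normal_prob 0 (Num.sqrt v)]_x f x = \int[pushforward P g']_x f x)%E.
  apply: eq_measure_integral => A mA _.
  by rewrite /= /pushforward gv// /gauss_law gt_eqF.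
have Fn : (normal_prob 0 (Num.sqrt v)).-integrable setT (EFin \o F).
  apply/integrableP; split => //.
  rewrite pE.
  rewrite (ge0_integral_pushforward mg')//=; last by apply/measurable_EFinP; exact: measurableT_comp.
  by rewrite preimage_setT; case/integrableP : Fg.
rewrite /Rintegral; congr fine.
transitivity (\int[normal_prob 0 (Num.sqrt v)]_x (F x)%:E)%E; last first.
  by rewrite integral_normal_prob//; apply: eq_integral => x _; rewrite EFinM.
rewrite pE.
by rewrite (integral_pushforward mg' mF') ?preimage_setT.
Qed.

Lemma gauss_law_Rintegral0 (F : R -> R) : v = 0 -> measurable_fun setT F ->
  P.-integrable setT (EFin \o (F \o g)) -> \int[P]_x F (g x) = F 0.
Proof.
move=> vE mF Fg; have mF' : measurable_fun setT (EFin \o F) by exact/measurable_EFinP.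
pose g' : T -> measurableTypeR R := g.
have mg' : measurable_fun setT g' by [].
have pE f : (\int[pushforward P g']_x f x = \int[dirac ((0 : R)%R : measurableTypeR R)]_x f x)%E.
  apply: eq_measure_integral => A mA _.
  by rewrite /= /pushforward gv// /gauss_law vE eqxx.
rewrite /Rintegral.
transitivity (fine (\int[pushforward P g']_x (F x)%:E)%E).
  by rewrite (integral_pushforward mg' mF') ?preimage_setT.
by rewrite pE integral_dirac// diracT mul1e.
Qed.

(** The phase [th] packs the real and imaginary parts of the characteristic function into one real
    identity. *)
Lemma gauss_law_cos th : \int[P]_x cos (g x + th) = cos th * expR (- (v / 2)).
Proof.
have mF : measurable_fun setT (fun x : R => cos (x + th)).
  rewrite (_ : (fun x => _) = (fun x => cos (1 * x + th))); last first.
    by apply/funext => x; rewrite mul1r.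
  by apply: continuous_measurable_fun; exact: continuous_cos_affine.
have Fg : P.-integrable setT (EFin \o ((fun x : R => cos (x + th)) \o g)).
  apply: (@itg_le _ _ _ _ _ (cst 1)); first exact: measurableT_comp.
    exact: finite_measure_integrable_cst.
  by move=> x; rewrite cos_max.
have [v00|vp] := eqVneq v 0.
  by rewrite (gauss_law_Rintegral0 v00 mF Fg) v00 add0r mul0r oppr0 expR0 mulr1.
have {}vp : 0 < v by rewrite lt_neqAle eq_sym vp.
rewrite (gauss_law_Rintegral vp mF Fg).
have := normal_char (s:=Num.sqrt v) _ th 1.
rewrite sqrtr_gt0 expr1n mulr1 sqr_sqrtr// => <-//.
by apply: eq_Rintegral => x _; rewrite mul1r.
Qed.

Lemma gauss_law_sqr : P.-integrable setT (EFin \o (fun x => g x ^+ 2)) ->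
  \int[P]_x (g x ^+ 2) = v.
Proof.
move=> Fg; have mF : measurable_fun setT (fun x : R => x ^+ 2) by exact: measurable_funX.
have [v00|vp] := eqVneq v 0.
  by rewrite (gauss_law_Rintegral0 v00 mF Fg) v00 expr0n.
have {}vp : 0 < v by rewrite lt_neqAle eq_sym vp.
by rewrite (gauss_law_Rintegral vp mF Fg) Rintegral_sqr_normal_pdf ?sqr_sqrtr ?sqrtr_gt0.
Qed.

Lemma gauss_law_eq0 : 0 < v -> P [set x | g x = 0] = 0%E.
Proof.
move=> vp; rewrite (_ : [set x | g x = 0] = g @^-1` [set 0])//.
rewrite gv// /gauss_law gt_eqF//.
have /null_content_dominatesP := normal_prob_dominates (R:=R) 0 (Num.sqrt v).
by move=> /(_ _ (measurable_set1 (0 : R)) (lebesgue_measure_set1 (0 : R))).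
Qed.

End gauss_law_expectation.

(** * Expectations of bounded functions *)

Lemma lim_le (R : realType) (u : nat -> R) (l K : R) :
  u @ \oo --> l -> (forall n, u n <= K) -> l <= K.
Proof.
move=> ul uK; rewrite -(cvg_lim _ ul)//; apply: limr_le; first by apply/cvg_ex; exists l.
exact: nearW.
Qed.

Section bounded_expectation.
Context d (T : measurableType d) (R : realType) (P : probability T R).
Implicit Types f g : T -> R.

Definition Ex f : R := \int[P]_x f x.

(** Bounded measurable functions: integrable for a probability and stable under all operations used
    below, so integrability side conditions stay routine. *)
Definition bmf f := measurable_fun setT f /\ exists K, forall x, `|f x| <= K.

Local Notation itg f := (P.-integrable setT (EFin \o f)).

Lemma bmf_bound f (K : R) : measurable_fun setT f -> (forall x, `|f x| <= K) -> bmf f.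
Proof. by move=> mf h; split => //; exists K. Qed.

Lemma bmf_itg f : bmf f -> itg f.
Proof.
move=> [mf [K h]]; apply: (@itg_le _ _ _ _ _ (cst K)) => //.
exact: finite_measure_integrable_cst.
Qed.

Lemma bmf_cst k : bmf (fun=> k).
Proof. by split => //; exists `|k|. Qed.

Lemma bmfD f g : bmf f -> bmf g -> bmf (fun x => f x + g x).
Proof.
move=> [mf [K h]] [mg [L l]]; split; first exact: measurable_funD.
by exists (K + L) => x; rewrite (le_trans (ler_normD _ _))// lerD.
Qed.

Lemma bmfM f g : bmf f -> bmf g -> bmf (fun x => f x * g x).
Proof.
move=> [mf [K h]] [mg [L l]]; split; first exact: measurable_funM.
by exists (K * L) => x; rewrite normrM ler_pM.
Qed.

Lemma bmfZ k f : bmf f -> bmf (fun x => k * f x).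
Proof. exact/bmfM/bmf_cst. Qed.

Lemma bmfN f : bmf f -> bmf (fun x => - f x).
Proof. by move=> /(bmfZ (-1)); under eq_fun do rewrite mulN1r. Qed.

Lemma bmfB f g : bmf f -> bmf g -> bmf (fun x => f x - g x).
Proof. by move=> hf hg; exact/bmfD/bmfN. Qed.

Lemma bmfX f n : bmf f -> bmf (fun x => f x ^+ n).
Proof.
move=> hf; elim: n => [|n ih]; first exact: bmf_cst.
by under eq_fun do rewrite exprS; exact: bmfM.
Qed.

Lemma bmf_abs f : bmf f -> bmf (fun x => `|f x|).
Proof.
move=> [mf [K h]]; split; first exact: measurableT_comp.
by exists K => x; rewrite normr_id.
Qed.

Lemma bmf_sum (I : Type) (r : seq I) (p : pred I) (f : I -> T -> R) :
  (forall i, bmf (f i)) -> bmf (fun x => \sum_(i <- r | p i) f i x).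
Proof.
move=> h; elim: r => [|i r ih].
  by under eq_fun do rewrite big_nil; exact: bmf_cst.
under eq_fun do rewrite big_cons; case: (p i) => //.
exact: bmfD.
Qed.

Lemma bmf_cos f : measurable_fun setT f -> bmf (fun x => cos (f x)).
Proof.
move=> mf; apply: (@bmf_bound _ 1); last by move=> x; exact: cos_max.
apply: measurableT_comp mf; apply: continuous_measurable_fun; exact: continuous_cos.
Qed.

Lemma bmf_sin f : measurable_fun setT f -> bmf (fun x => sin (f x)).
Proof.
move=> mf; apply: (@bmf_bound _ 1); last by move=> x; exact: sin_max.
apply: measurableT_comp mf; apply: continuous_measurable_fun; exact: continuous_sin.
Qed.

Lemma bmf_exp f : bmf f -> bmf (fun x => expR (f x)).
Proof.
move=> [mf [K h]]; apply: (@bmf_bound _ (expR K)); first exact: measurableT_comp.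
by move=> x; rewrite ger0_norm ?expR_ge0// ler_expR (le_trans _ (h x))// ler_norm.
Qed.

Lemma Ex_ext f g : f =1 g -> Ex f = Ex g.
Proof. by move=> fg; congr Ex; exact/funext. Qed.

Lemma Ex_cst k : Ex (fun=> k) = k.
Proof. by rewrite /Ex Rintegral_cst// (_ : _ setT = 1%E) ?mulr1//; exact: probability_setT. Qed.

Lemma ExDi f g : itg f -> itg g -> Ex (fun x => f x + g x) = Ex f + Ex g.
Proof. by move=> hf hg; rewrite /Ex RintegralD. Qed.

Lemma ExBi f g : itg f -> itg g -> Ex (fun x => f x - g x) = Ex f - Ex g.
Proof. by move=> hf hg; rewrite /Ex RintegralB. Qed.

Lemma ExZi k f : itg f -> Ex (fun x => k * f x) = k * Ex f.
Proof. by move=> hf; rewrite /Ex RintegralZl. Qed.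

Lemma ExD f g : bmf f -> bmf g -> Ex (fun x => f x + g x) = Ex f + Ex g.
Proof. by move=> /bmf_itg hf /bmf_itg hg; exact: ExDi. Qed.

Lemma ExB f g : bmf f -> bmf g -> Ex (fun x => f x - g x) = Ex f - Ex g.
Proof. by move=> /bmf_itg hf /bmf_itg hg; exact: ExBi. Qed.

Lemma ExZ k f : bmf f -> Ex (fun x => k * f x) = k * Ex f.
Proof. by move=> /bmf_itg hf; exact: ExZi. Qed.

Lemma ExN f : bmf f -> Ex (fun x => - f x) = - Ex f.
Proof. by move=> hf; rewrite -mulN1r -ExZ//; apply: Ex_ext => x; rewrite mulN1r. Qed.

Lemma Ex_sum (I : Type) (r : seq I) (f : I -> T -> R) :
  (forall i, bmf (f i)) -> Ex (fun x => \sum_(i <- r) f i x) = \sum_(i <- r) Ex (f i).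
Proof.
move=> h; elim: r => [|i r ih].
  by rewrite big_nil -[RHS](Ex_cst 0); apply: Ex_ext => x; rewrite big_nil.
rewrite big_cons -ih -ExD//; last exact: bmf_sum.
by apply: Ex_ext => x; rewrite big_cons.
Qed.

Lemma Ex_ge0 f : (forall x, 0 <= f x) -> 0 <= Ex f.
Proof. by move=> h; exact: Rintegral_ge0. Qed.

Lemma Ex_le f g : bmf f -> bmf g -> (forall x, f x <= g x) -> Ex f <= Ex g.
Proof.
move=> /bmf_itg hf /bmf_itg hg fg; apply: le_Rintegral => // x _; exact: fg.
Qed.

Lemma Ex_norm f : bmf f -> `|Ex f| <= Ex (fun x => `|f x|).
Proof. by move=> /bmf_itg hf; exact: le_normr_Rintegral. Qed.

Lemma Ex_norm_le f (K : R) : bmf f -> (forall x, `|f x| <= K) -> `|Ex f| <= K.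
Proof.
move=> hf h; rewrite (le_trans (Ex_norm hf))// -[leRHS]Ex_cst Ex_le//.
  exact: bmf_abs.
exact: bmf_cst.
Qed.

Lemma itg_mul f g : measurable_fun setT f -> measurable_fun setT g ->
  itg (fun x => f x ^+ 2) -> itg (fun x => g x ^+ 2) -> itg (fun x => f x * g x).
Proof.
move=> mf mg hf hg; apply: (@itg_le _ _ _ _ _ (fun x => f x ^+ 2 + g x ^+ 2)).
- exact: measurable_funM.
- exact: itgD.
- move=> x; rewrite normrM -[f x ^+ 2]real_normK ?num_real// -[g x ^+ 2]real_normK ?num_real//.
  have := sqr_ge0 (`|f x| - `|g x|); have := normr_ge0 (f x); have := normr_ge0 (g x).
  nra.
Qed.

Lemma Ex_CS f g : measurable_fun setT f -> measurable_fun setT g ->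
  itg (fun x => f x ^+ 2) -> itg (fun x => g x ^+ 2) ->
  Ex (fun x => f x * g x) ^+ 2 <= Ex (fun x => f x ^+ 2) * Ex (fun x => g x ^+ 2).
Proof.
move=> mf mg hf hg; have hfg := itg_mul mf mg hf hg.
set a := Ex (fun x => f x ^+ 2); set b := Ex (fun x => g x ^+ 2).
set c := Ex (fun x => f x * g x).
have key s t : 0 <= s ^+ 2 * a + 2 * s * t * c + t ^+ 2 * b.
  have -> : s ^+ 2 * a + 2 * s * t * c + t ^+ 2 * b = Ex (fun x => (s * f x + t * g x) ^+ 2).
    rewrite -!ExZi// -!ExDi//; first last.
    + exact: itgZ.
    + exact: itgZ.
    + exact: itgZ.
    + by apply: itgD; exact: itgZ.
    by apply: Ex_ext => x; ring.
  by apply: Ex_ge0 => x; exact: sqr_ge0.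
have a0 : 0 <= a by apply: Ex_ge0 => x; exact: sqr_ge0.
have b0 : 0 <= b by apply: Ex_ge0 => x; exact: sqr_ge0.
have [b00|bp] := eqVneq b 0.
  have [->|c0] := eqVneq c 0; first by rewrite expr0n mulr_ge0.
  (* If [b = 0] and [c] is nonzero, this argument gives the nonnegative form the value -1. *)
  have := key 1 (- (a + 1) / (2 * c)).
  rewrite b00 (_ : _ + _ = -1); first by rewrite lerNr oppr0 ler10.
  by field.
have {}bp : 0 < b by rewrite lt_neqAle eq_sym bp.
have := key b (- c).
rewrite (_ : _ + _ = b * (a * b - c ^+ 2)); last by ring.
by rewrite pmulr_rge0// subr_ge0.
Qed.

Lemma Ex_sqr_le f : bmf f -> Ex f ^+ 2 <= Ex (fun x => f x ^+ 2).
Proof.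
move=> hf; have := @Ex_CS f (fun=> 1).
rewrite (@Ex_ext (fun x => f x * 1) f); last by move=> x; rewrite mulr1.
rewrite (@Ex_ext (fun x => 1 ^+ 2) (fun x => 1)); last by move=> x; rewrite expr1n.
rewrite Ex_cst mulr1; apply => //; first by case: hf.
  by apply: bmf_itg; exact: bmfX.
by apply: bmf_itg; under eq_fun do rewrite expr1n; exact: bmf_cst.
Qed.

Lemma Ex_cvg (fn : nat -> T -> R) f (K : R) :
  (forall n, measurable_fun setT (fn n)) -> measurable_fun setT f ->
  (forall n x, `|fn n x| <= K) ->
  (forall x, fn ^~ x @ \oo --> f x) ->
  (fun n => Ex (fn n)) @ \oo --> Ex f.
Proof.
move=> mfn mf fK fnf; rewrite /Ex /Rintegral; apply: fine_cvg.
have hf : itg f.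
  apply: bmf_itg; apply: (@bmf_bound _ K) => // x.
  have : `|fn n x| @[n --> \oo] --> `|f x| by apply: cvg_norm; exact: fnf.
  by move=> h; exact: (lim_le h).
rewrite fineK; last exact: integrable_fin_num.
have [] // := @dominated_convergence _ _ _ P setT measurableT
  (fun n x => (fn n x)%:E) (EFin \o f) (cst K%:E).
- by move=> n; exact/measurable_EFinP.
- exact/measurable_EFinP.
- by apply: aeW => x _; apply: cvg_EFin; [exact: nearW|exact: fnf].
- exact: finite_measure_integrable_cst.
- by apply: aeW => x n _; rewrite lee_fin.
Qed.

Lemma Ex_ae f g : measurable_fun setT f -> measurable_fun setT g ->
  {ae P, forall x, f x = g x} -> Ex f = Ex g.
Proof.
move=> mf mg fg; rewrite /Ex /Rintegral; congr fine; apply: ae_eq_integral => //.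
- exact/measurable_EFinP.
- exact/measurable_EFinP.
- by apply: filterS fg => x -> _.
Qed.

End bounded_expectation.

(** * Cosine of a complex argument and its Taylor remainder *)

Section complex_cosine.
Context {R : realType}.
Implicit Types x y t th : R.

Definition ch x : R := (expR x + expR (- x)) / 2.
Definition sh x : R := (expR x - expR (- x)) / 2.

Lemma is_derive_ch x : is_derive x 1 ch (sh x).
Proof.
have h := drv_mul (drv_add (drv_exp (drv_id x)) (drv_exp (drv_opp (drv_id x)))) (drv_cst x 2^-1).
by apply: (drv_eq h); rewrite /sh; ring.
Qed.

Lemma is_derive_sh x : is_derive x 1 sh (ch x).
Proof.
have h := drv_mul (drv_sub (drv_exp (drv_id x)) (drv_exp (drv_opp (drv_id x)))) (drv_cst x 2^-1).
by apply: (drv_eq h); rewrite /ch; ring.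
Qed.

Lemma ch0 : ch 0 = 1. Proof. by rewrite /ch oppr0 expR0; field. Qed.

Lemma sh0 : sh 0 = 0. Proof. by rewrite /sh oppr0 subrr mul0r. Qed.

Lemma chN x : ch (- x) = ch x. Proof. by rewrite /ch opprK addrC. Qed.

Lemma shN x : sh (- x) = - sh x. Proof. by rewrite /sh opprK -mulNr opprB. Qed.

Lemma ch_le x K : `|x| <= K -> ch x <= expR K.
Proof.
rewrite ler_norml => /andP[h1 h2].
have h3 : expR x <= expR K by rewrite ler_expR.
have h4 : expR (- x) <= expR K by rewrite ler_expR lerNl.
by rewrite /ch; lra.
Qed.

Lemma ch_ge1 x : 1 <= ch x.
Proof.
rewrite /ch expRN; have := expR_gt0 x; move: (expR x) => e e0.
have h : (e - 1) ^+ 2 / e = e + e^-1 - 2 by field; rewrite gt_eqF.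
have : 0 <= (e - 1) ^+ 2 / e by rewrite divr_ge0 ?sqr_ge0// ltW.
by rewrite h; lra.
Qed.

Lemma sh_le x K : `|x| <= K -> `|sh x| <= expR K.
Proof.
rewrite ler_norml => /andP[h1 h2].
have h3 : expR x <= expR K by rewrite ler_expR.
have h4 : expR (- x) <= expR K by rewrite ler_expR lerNl.
have h5 := expR_gt0 x; have h6 := expR_gt0 (- x).
by rewrite /sh ler_norml; apply/andP; split; lra.
Qed.

(** Integrates a bound on the derivative once; iterating it builds up the factorial of a Taylor
    remainder. It follows from the monotonicity of [c / n.+1%:R * z ^+ n.+1 - g z] for [g = f] and
    [g = - f]. *)
Lemma taylor_step (f f' : R -> R) (c : R) (n : nat) (s : R) :
  (forall z : R, is_derive z 1 f (f' z)) -> f 0 = 0 ->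
  (forall z, 0 <= z <= s -> `|f' z| <= c * z ^+ n) -> 0 <= s ->
  `|f s| <= c / n.+1%:R * s ^+ n.+1.
Proof.
move=> df f0 hf s0.
have key (g g' : R -> R) : (forall z : R, is_derive z 1 g (g' z)) -> g 0 = 0 ->
    (forall z, 0 <= z <= s -> g' z <= c * z ^+ n) -> g s <= c / n.+1%:R * s ^+ n.+1.
  move=> dg g0 hg.
  have dG (z : R) : is_derive z 1 (fun z => c / n.+1%:R * z ^+ n.+1 - g z) (c * z ^+ n - g' z).
    apply: (drv_eq (drv_sub (drv_mull (c / n.+1%:R) (drv_pow n z)) (dg z))).
    by field; rewrite lt0r_neq0//.
  have G0 z : 0 <= z <= s -> 0 <= c * z ^+ n - g' z by move=> zs; rewrite subr_ge0 hg.
  by have := drv_ge0_le dG G0 s0; rewrite expr0n mulr0 g0 subrr subr_ge0.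
rewrite ler_norml; apply/andP; split.
- rewrite lerNl; apply: (key _ _ (fun z => drv_opp (df z))); first by rewrite f0 oppr0.
  by move=> z zs; rewrite (le_trans _ (hf z zs))// -normrN ler_norm.
- apply: (key _ _ df f0) => z zs.
  by rewrite (le_trans _ (hf z zs))// ler_norm.
Qed.

(** Real and imaginary parts of [(x + i y)^m]. *)
Fixpoint cpow x y (m : nat) : R * R :=
  if m is m'.+1 then
    (x * (cpow x y m').1 - y * (cpow x y m').2, x * (cpow x y m').2 + y * (cpow x y m').1)
  else (1, 0).

Let coef th (m : nat) : R := cos (th + m%:R * (pi / 2)) / m`!%:R.

(** Real part of the Taylor polynomial of [cos (th + x + i y)] at [th]: the [m]-th derivative of the
    cosine at [th] is [cos (th + m pi / 2)]. *)
Definition cos_series th x y (n : nat) : R := \sum_(0 <= m < n) coef th m * (cpow x y m).1.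

(** [U] and [V] are the real and imaginary parts of the Taylor remainder of
    [cos (th + s (x + i y))], viewed as functions of the real variable [s]. *)
Let U th x y n s := ch (s * y) * cos (th + s * x) -
  \sum_(0 <= m < n) coef th m * (s ^+ m * (cpow x y m).1).
Let V th x y n s := - (sh (s * y) * sin (th + s * x)) -
  \sum_(0 <= m < n) coef th m * (s ^+ m * (cpow x y m).2).

Let fact_neq0 m : m`!%:R != 0 :> R. Proof. by rewrite pnatr_eq0 -lt0n fact_gt0. Qed.

Let S_neq0 m : 1 + m%:R != 0 :> R. Proof. by rewrite addrC natr1 pnatr_eq0. Qed.

Let coefS th m : coef th m.+1 * m.+1%:R = coef (th + pi / 2) m.
Proof.
rewrite /coef (_ : th + m.+1%:R * (pi / 2) = th + pi / 2 + m%:R * (pi / 2)); last by rewrite -natr1; ring.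
rewrite factS natrM; field.
by rewrite fact_neq0 S_neq0.
Qed.

Let der_series th n (X : nat -> R) (s : R) :
  is_derive s 1 (fun s => \sum_(0 <= m < n.+1) coef th m * (s ^+ m * X m))
    (\sum_(0 <= m < n) coef (th + pi / 2) m * (s ^+ m * X m.+1)).
Proof.
rewrite (_ : (fun s => _) = (fun s => coef th 0 * X 0%N +
    \sum_(0 <= m < n) coef th m.+1 * (s ^+ m.+1 * X m.+1))); last first.
  by apply/funext => z; rewrite big_nat_recl// expr0 mul1r.
have h : is_derive s 1 (fun s => \sum_(0 <= m < n) coef th m.+1 * (s ^+ m.+1 * X m.+1))
   (\sum_(0 <= m < n) coef (th + pi / 2) m * (s ^+ m * X m.+1)).
  apply: drv_sum => m.
  apply: (drv_eq (drv_mull _ (drv_mul (drv_pow m s) (drv_cst s (X m.+1))))).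
  by rewrite -coefS; ring.
by apply: (drv_eq (drv_add (drv_cst s _) h)); rewrite add0r.
Qed.

Let dU th x y n (s : R) : is_derive s 1 (U th x y n.+1)
  (x * U (th + pi / 2) x y n s - y * V (th + pi / 2) x y n s).
Proof.
have dy : is_derive s 1 (fun s => s * y) y.
  by apply: (drv_eq (drv_mul (drv_id s) (drv_cst s y))); rewrite mulr0 add0r mulr1.
have dx : is_derive s 1 (fun s => th + s * x) x.
  apply: (drv_eq (drv_add (drv_cst s th) (drv_mul (drv_id s) (drv_cst s x)))).
  by rewrite mulr0 !add0r mulr1.
apply: (drv_eq (drv_sub (drv_mul (drv_comp (is_derive_ch _) dy) (drv_cos dx))
  (der_series th n (fun m => (cpow x y m).1) s))).
have -> : \sum_(0 <= m < n) coef (th + pi / 2) m * (s ^+ m * (cpow x y m.+1).1) =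
    x * (\sum_(0 <= m < n) coef (th + pi / 2) m * (s ^+ m * (cpow x y m).1)) -
    y * (\sum_(0 <= m < n) coef (th + pi / 2) m * (s ^+ m * (cpow x y m).2)).
  by rewrite !mulr_sumr -sumrB; apply: eq_bigr => m _ /=; ring.
rewrite /U /V [th + pi / 2 + _]addrAC cosDpihalf sinDpihalf.
set A := \sum_(_ <= _ < _) _; set B := \sum_(_ <= _ < _) _; ring.
Qed.

Let dV th x y n (s : R) : is_derive s 1 (V th x y n.+1)
  (x * V (th + pi / 2) x y n s + y * U (th + pi / 2) x y n s).
Proof.
have dy : is_derive s 1 (fun s => s * y) y.
  by apply: (drv_eq (drv_mul (drv_id s) (drv_cst s y))); rewrite mulr0 add0r mulr1.
have dx : is_derive s 1 (fun s => th + s * x) x.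
  apply: (drv_eq (drv_add (drv_cst s th) (drv_mul (drv_id s) (drv_cst s x)))).
  by rewrite mulr0 !add0r mulr1.
apply: (drv_eq (drv_sub (drv_opp (drv_mul (drv_comp (is_derive_sh _) dy) (drv_sin dx)))
  (der_series th n (fun m => (cpow x y m).2) s))).
have -> : \sum_(0 <= m < n) coef (th + pi / 2) m * (s ^+ m * (cpow x y m.+1).2) =
    x * (\sum_(0 <= m < n) coef (th + pi / 2) m * (s ^+ m * (cpow x y m).2)) +
    y * (\sum_(0 <= m < n) coef (th + pi / 2) m * (s ^+ m * (cpow x y m).1)).
  by rewrite !mulr_sumr -big_split; apply: eq_bigr => m _ /=; ring.
rewrite /U /V [th + pi / 2 + _]addrAC cosDpihalf sinDpihalf.
set A := \sum_(_ <= _ < _) _; set B := \sum_(_ <= _ < _) _; ring.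
Qed.

Let UV0 th x y n : (U th x y n.+1 0 = 0) * (V th x y n.+1 0 = 0).
Proof.
split; rewrite /U /V !mul0r addr0 ?ch0 ?sh0 ?mul1r ?mul0r.
  rewrite big_nat_recl//= expr0 !mulr1 big1 ?addr0 => [|i _].
    by rewrite /coef mul0r addr0 fact0 divr1 subrr.
  by rewrite exprS !mul0r mulr0.
rewrite big_nat_recl//= expr0 !mulr0 big1 ?addr0 ?oppr0 ?addr0// => i _.
by rewrite exprS !mul0r mulr0.
Qed.

Let UV_le (th x y K : R) n (s : R) : `|x| <= K -> `|y| <= K -> 0 <= s <= 1 ->
  `|U th x y n s| <= expR K * (K *+ 2) ^+ n / n`!%:R * s ^+ n /\
  `|V th x y n s| <= expR K * (K *+ 2) ^+ n / n`!%:R * s ^+ n.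
Proof.
move=> xK yK; have K0 : 0 <= K by rewrite (le_trans _ xK).
elim: n th s => [|n ih] th s /andP[s0 s1].
  have syK : `|s * y| <= K by rewrite normrM (ger0_norm s0) (le_trans _ yK)// ler_piMl.
  have pm (a b : R) : `|a| <= expR K -> `|b| <= 1 -> `|a * b| <= expR K.
    by move=> ha hb; rewrite normrM -[leRHS]mulr1 ler_pM.
  rewrite /U /V !big_nil !expr0 fact0 invr1 !mulr1 !subr0 normrN; split; apply: pm.
  - by rewrite ger0_norm ?ch_le// (le_trans _ (ch_ge1 _)).
  - exact: cos_max.
  - exact: sh_le.
  - exact: sin_max.
have step : expR K * (K *+ 2) ^+ n.+1 / n.+1`!%:R =
    K *+ 2 * (expR K * (K *+ 2) ^+ n / n`!%:R) / n.+1%:R.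
  rewrite factS natrM exprS; field.
  by rewrite fact_neq0 S_neq0.
have bd (a b z : R) : `|a| <= expR K * (K *+ 2) ^+ n / n`!%:R * z ^+ n ->
    `|b| <= expR K * (K *+ 2) ^+ n / n`!%:R * z ^+ n ->
    `|x * a| + `|y * b| <= K *+ 2 * (expR K * (K *+ 2) ^+ n / n`!%:R) * z ^+ n.
  move=> ha hb; rewrite mulrnAl mulrnAl mulr2n -!mulrA !normrM lerD// ler_pM//.
    by rewrite !mulrA.
  by rewrite !mulrA.
rewrite step; set c := K *+ 2 * _; split.
- apply: (@taylor_step _ _ c n s (dU th x y n)) => //; first by rewrite UV0.
  move=> z /andP[z0 zs]; have [|hU hV] := ih (th + pi / 2) z; first by rewrite z0 (le_trans zs).
  by rewrite (le_trans (ler_normB _ _))// bd.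
- apply: (@taylor_step _ _ c n s (dV th x y n)) => //; first by rewrite UV0.
  move=> z /andP[z0 zs]; have [|hU hV] := ih (th + pi / 2) z; first by rewrite z0 (le_trans zs).
  by rewrite (le_trans (ler_normD _ _))// bd.
Qed.

Lemma cos_series_err (th x y K : R) n : `|x| <= K -> `|y| <= K ->
  `|ch y * cos (th + x) - cos_series th x y n| <= expR K * exp_coeff (K *+ 2) n.
Proof.
move=> xK yK; have [] := @UV_le th x y K n 1 xK yK; first by rewrite ler01 lexx.
rewrite /U !mul1r expr1n mulr1 exp_coeffE -mulrA [_^-1 * _]mulrC => + _.
by rewrite /cos_series; under eq_bigr do rewrite expr1n mul1r.
Qed.

Lemma cpow_real x m : cpow x 0 m = (x ^+ m, 0).
Proof. by elim: m => [|m ih] //=; rewrite ih/= !mul0r mulr0 subr0 addr0 exprS. Qed.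

End complex_cosine.

(** * Gaussian spaces *)

Section gaussian_space.
Context d (T : measurableType d) (R : realType) (P : probability T R).
Local Notation itg f := (P.-integrable setT (EFin \o f)).
Local Notation E := (Ex P).

Definition covar (f g : T -> R) : R := E (fun x => f x * g x).
Local Notation Q := covar.

(** An interface for linear spaces of jointly Gaussian centered variables. The central limit theorem
    for cosine sums uses Gaussianity only through [gs_cos]. *)
Record gaussian_space (H : (T -> R) -> Prop) : Prop := {
  gs_zero : H (fun=> 0) ;
  gs_add : forall f g, H f -> H g -> H (fun x => f x + g x) ;
  gs_scale : forall k f, H f -> H (fun x => k * f x) ;
  gs_meas : forall f, H f -> measurable_fun setT f ;
  gs_sqr : forall f, H f -> itg (fun x => f x ^+ 2) ;
  gs_cos : forall f th, H f -> E (fun x => cos (f x + th)) = cos th * expR (- (Q f f / 2)) }.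

Variables (H : (T -> R) -> Prop) (gH : gaussian_space H).

Lemma gs_sub f g : H f -> H g -> H (fun x => f x - g x).
Proof.
move=> hf hg; have := gs_add gH hf (gs_scale gH (-1) hg).
by under eq_fun do rewrite mulN1r.
Qed.

Lemma gs_itg f g : H f -> H g -> itg (fun x => f x * g x).
Proof. by move=> hf hg; apply: itg_mul; [exact: gs_meas hf|exact: gs_meas hg|exact: gs_sqr hf|exact: gs_sqr hg]. Qed.

Lemma covarC f g : Q f g = Q g f.
Proof. by apply: Ex_ext => x; rewrite mulrC. Qed.

Lemma covarDr f g1 g2 : H f -> H g1 -> H g2 ->
  Q f (fun x => g1 x + g2 x) = Q f g1 + Q f g2.
Proof.
by move=> hf h1 h2; rewrite /Q -ExDi; [apply: Ex_ext => x; rewrite mulrDr|exact: gs_itg..].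
Qed.

Lemma covarZr f g k : H f -> H g -> Q f (fun x => k * g x) = k * Q f g.
Proof.
by move=> hf hg; rewrite /Q -ExZi; [apply: Ex_ext => x; rewrite mulrCA|exact: gs_itg].
Qed.

Lemma covarBr f g1 g2 : H f -> H g1 -> H g2 ->
  Q f (fun x => g1 x - g2 x) = Q f g1 - Q f g2.
Proof.
move=> hf h1 h2; rewrite -mulN1r -covarZr// -covarDr//; last exact: gs_scale.
by congr covar; apply/funext => x; rewrite mulN1r.
Qed.

Lemma covarDl f g1 g2 : H f -> H g1 -> H g2 ->
  Q (fun x => g1 x + g2 x) f = Q g1 f + Q g2 f.
Proof. by move=> hf h1 h2; rewrite covarC covarDr// !(covarC f). Qed.

Lemma covarBl f g1 g2 : H f -> H g1 -> H g2 ->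
  Q (fun x => g1 x - g2 x) f = Q g1 f - Q g2 f.
Proof. by move=> hf h1 h2; rewrite covarC covarBr// !(covarC f). Qed.

Lemma covarZl f g k : H f -> H g -> Q (fun x => k * g x) f = k * Q g f.
Proof. by move=> hf hg; rewrite covarC covarZr// !(covarC f). Qed.

Lemma covar_ge0 f : 0 <= Q f f.
Proof. by apply: Ex_ge0 => x; rewrite -expr2 sqr_ge0. Qed.

Lemma covar_CS f g : H f -> H g -> Q f g ^+ 2 <= Q f f * Q g g.
Proof.
move=> hf hg.
exact: (Ex_CS (gs_meas gH hf) (gs_meas gH hg) (gs_sqr gH hf) (gs_sqr gH hg)).
Qed.

Lemma covar_addadd f g : H f -> H g ->
  Q (fun x => f x + g x) (fun x => f x + g x) = Q f f + Q g g + 2 * Q f g.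
Proof.
move=> hf hg; rewrite covarDr//; last exact: gs_add.
rewrite !covarDl//; rewrite (covarC g f); ring.
Qed.

Lemma covar_subsub f g : H f -> H g ->
  Q (fun x => f x - g x) (fun x => f x - g x) = Q f f + Q g g - 2 * Q f g.
Proof.
move=> hf hg; rewrite covarBr//; last exact: gs_sub.
rewrite !covarBl//; rewrite (covarC g f); ring.
Qed.

Lemma gs_sum (I : Type) (r : seq I) (g : I -> T -> R) : (forall i, H (g i)) ->
  H (fun x => \sum_(i <- r) g i x).
Proof.
move=> h; elim: r => [|i r ih].
  by under eq_fun do rewrite big_nil; exact: (gs_zero gH).
by under eq_fun do rewrite big_cons; exact: (gs_add gH (h i) ih).
Qed.

Lemma covar_sumr (I : Type) (r : seq I) (g : I -> T -> R) f : H f -> (forall i, H (g i)) ->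
  Q f (fun x => \sum_(i <- r) g i x) = \sum_(i <- r) Q f (g i).
Proof.
move=> hf h; elim: r => [|i r ih].
  rewrite big_nil /Q -[RHS](Ex_cst P); apply: Ex_ext => x.
  by rewrite big_nil mulr0.
rewrite big_cons -ih -covarDr//; last exact: gs_sum.
by congr Q; apply/funext => x; rewrite big_cons.
Qed.

Lemma covar_suml (I : Type) (r : seq I) (g : I -> T -> R) f : H f -> (forall i, H (g i)) ->
  Q (fun x => \sum_(i <- r) g i x) f = \sum_(i <- r) Q (g i) f.
Proof. by move=> hf h; rewrite covarC covar_sumr//; apply: eq_bigr => i _; rewrite covarC. Qed.

Definition gmean (f : T -> R) : R := expR (- (Q f f / 2)).

Lemma gmean_gt0 f : 0 < gmean f. Proof. exact: expR_gt0. Qed.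

Lemma gmean_le1 f : gmean f <= 1.
Proof. by rewrite /gmean -[leRHS]expR0 ler_expR oppr_le0 divr_ge0// covar_ge0. Qed.

Lemma Ex_cos f : H f -> E (fun x => cos (f x)) = gmean f.
Proof.
move=> hf; have := gs_cos gH 0 hf; rewrite cos0 mul1r -/(gmean f) => <-.
by apply: Ex_ext => x; rewrite addr0.
Qed.

Lemma gmeanD f g : H f -> H g ->
  gmean (fun x => f x + g x) = gmean f * gmean g * expR (- Q f g).
Proof. by move=> hf hg; rewrite /gmean covar_addadd// -!expRD; congr expR; field. Qed.

Lemma gmeanB f g : H f -> H g ->
  gmean (fun x => f x - g x) = gmean f * gmean g * expR (Q f g).
Proof. by move=> hf hg; rewrite /gmean covar_subsub// -!expRD; congr expR; field. Qed.

Lemma Ex_coscos f g : H f -> H g ->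
  E (fun x => cos (f x) * cos (g x)) = gmean f * gmean g * ch (Q f g).
Proof.
move=> hf hg; have mf := gs_meas gH hf; have mg := gs_meas gH hg.
have hD := gs_add gH hf hg; have hB := gs_sub hf hg.
transitivity (2^-1 * E (fun x => cos (f x + g x)) + 2^-1 * E (fun x => cos (f x - g x))).
  have b1 : bmf (fun x => cos (f x + g x)) by apply: bmf_cos; exact: gs_meas hD.
  have b2 : bmf (fun x => cos (f x - g x)) by apply: bmf_cos; exact: gs_meas hB.
  rewrite -ExZ// -ExZ// -ExD; [|exact: bmfZ..].
  by apply: Ex_ext => x; rewrite cosD cosB; field.
by rewrite (Ex_cos hD) (Ex_cos hB) gmeanD// gmeanB// /ch; field.
Qed.

Lemma Ex_sinsin f g : H f -> H g ->
  E (fun x => sin (f x) * sin (g x)) = gmean f * gmean g * sh (Q f g).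
Proof.
move=> hf hg; have mf := gs_meas gH hf; have mg := gs_meas gH hg.
have hD := gs_add gH hf hg; have hB := gs_sub hf hg.
transitivity (2^-1 * E (fun x => cos (f x - g x)) - 2^-1 * E (fun x => cos (f x + g x))).
  have b1 : bmf (fun x => cos (f x + g x)) by apply: bmf_cos; exact: gs_meas hD.
  have b2 : bmf (fun x => cos (f x - g x)) by apply: bmf_cos; exact: gs_meas hB.
  rewrite -ExZ// -ExZ// -ExB; [|exact: bmfZ..].
  by apply: Ex_ext => x; rewrite cosB cosD; field.
by rewrite (Ex_cos hD) (Ex_cos hB) gmeanB// gmeanD// /sh; field.
Qed.

(** [ch - 1] is of second order in the covariance. For sines, [Ex_sinsin] has [sh], of first order;
    this is where evenness pays. *)
Lemma Cov_cos f g : H f -> H g ->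
  E (fun x => (cos (f x) - gmean f) * (cos (g x) - gmean g)) =
  gmean f * gmean g * (ch (Q f g) - 1).
Proof.
move=> hf hg; have mf := gs_meas gH hf; have mg := gs_meas gH hg.
have bf := bmf_cos mf; have bg := bmf_cos mg.
transitivity (E (fun x => cos (f x) * cos (g x)) - gmean f * E (fun x => cos (g x))
   - gmean g * E (fun x => cos (f x)) + E (fun=> gmean f * gmean g)).
  rewrite -!ExZ// -ExB; [|exact: bmfM|exact: bmfZ].
  rewrite -ExB; [|by apply: bmfB; [exact: bmfM|exact: bmfZ]|exact: bmfZ].
  rewrite -ExD; [|by apply: bmfB; [apply: bmfB; [exact: bmfM|exact: bmfZ]|exact: bmfZ]|exact: bmf_cst].
  by apply: Ex_ext => x; ring.
by rewrite Ex_coscos// !Ex_cos// Ex_cst; ring.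
Qed.

Section shift.
Variables (I : finType) (c : I -> R) (w : I -> T -> R) (Hw : forall i, H (w i)).
Variables (g0 : T -> R) (Hg0 : H g0).
Let C i := Q g0 (w i).

Definition trigS (x : T) : R := \sum_i c i * cos (w i x).
(** When [w i] is shifted to [w i + i C i] in the complex plane, [cos (w i)] becomes [ch (C i) cos
    (w i) - i sh (C i) sin (w i)]; [shiftA] and [shiftB] collect the two parts. *)
Definition shiftA (x : T) : R := \sum_i c i * ch (C i) * cos (w i x).
Definition shiftB (x : T) : R := \sum_i c i * sh (C i) * sin (w i x).

Let XY (x : T) m := cpow (shiftA x) (- shiftB x) m.

Let mw i : measurable_fun setT (w i). Proof. exact: (gs_meas gH (Hw i)). Qed.

Lemma bmf_trigS : bmf trigS.
Proof. by apply: bmf_sum => i; apply: bmfZ; exact: bmf_cos. Qed.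

Lemma bmf_shiftA : bmf shiftA.
Proof. by apply: bmf_sum => i; apply: bmfZ; exact: bmf_cos. Qed.

Lemma bmf_shiftB : bmf shiftB.
Proof. by apply: bmf_sum => i; apply: bmfZ; exact: bmf_sin. Qed.

Let bmf_XY m : bmf (fun x => (XY x m).1) /\ bmf (fun x => (XY x m).2).
Proof.
elim: m => [|m [h1 h2]]; first by split; exact: bmf_cst.
by split=> /=; [apply: bmfB|apply: bmfD]; apply: bmfM => //;
  [exact: bmf_shiftA|apply: bmfN; exact: bmf_shiftB|exact: bmf_shiftA|apply: bmfN; exact: bmf_shiftB].
Qed.

Let aff g th : H g -> measurable_fun setT (fun x => g x + th).
Proof. by move=> hg; apply: measurable_funD => //; exact: (gs_meas gH hg). Qed.

(** The complex shift for powers of [trigS]. In the induction one factor [c i * cos (w i)] merges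
    with the leading cosine, so [g] turns into [g + w i] and [g - w i], which is why [g] and [th]
    are general. The weights [expR (- C i)] and [expR (C i)] that appear recombine into [ch] and
    [sh]. *)
Lemma shift_pow m g th : H g ->
  E (fun x => cos (g0 x + g x + th) * trigS x ^+ m) =
  gmean g0 * expR (- Q g0 g) *
  E (fun x => cos (g x + th) * (XY x m).1 - sin (g x + th) * (XY x m).2).
Proof.
elim: m g th => [|m ih] g th hg.
  have hD := gs_add gH Hg0 hg.
  transitivity (E (fun x => cos (g0 x + g x + th))); first by apply: Ex_ext => x; rewrite expr0 mulr1.
  rewrite (gs_cos gH th hD) covar_addadd//.
  transitivity (gmean g0 * expR (- Q g0 g) * E (fun x => cos (g x + th))).
    by rewrite (gs_cos gH th hg) /gmean mulrCA -mulrA -!expRD; congr (_ * expR _); field.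
  by congr (_ * _); apply: Ex_ext => x /=; rewrite mulr1 mulr0 subr0.
pose G1 i x := cos (g0 x + (g x + w i x) + th) * trigS x ^+ m.
pose G2 i x := cos (g0 x + (g x - w i x) + th) * trigS x ^+ m.
have hD i : H (fun x => g x + w i x) by exact: gs_add.
have hB i : H (fun x => g x - w i x) by exact: gs_sub.
have bS := bmf_trigS.
have bG1 i : bmf (G1 i).
  by apply: bmfM; [apply: bmf_cos; apply: aff; exact: gs_add|exact: bmfX].
have bG2 i : bmf (G2 i).
  by apply: bmfM; [apply: bmf_cos; apply: aff; exact: gs_add|exact: bmfX].
transitivity (\sum_i (c i / 2 * (E (G1 i) + E (G2 i)))).
  transitivity (E (fun x => \sum_i (c i / 2 * (G1 i x + G2 i x)))).
    apply: Ex_ext => x; rewrite exprS mulrCA {1}/trigS mulr_suml; apply: eq_bigr => i _.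
    rewrite /G1 /G2 -mulrDl (_ : g0 x + (g x + w i x) + th = (g0 x + g x + th) + w i x); last by ring.
    rewrite (_ : g0 x + (g x - w i x) + th = (g0 x + g x + th) - w i x); last by ring.
    by move: (g0 x + g x + th) => a; rewrite cosB cosD; field.
  rewrite Ex_sum; last by move=> i; apply: bmfZ; exact: bmfD.
  by apply: eq_bigr => i _; rewrite ExZ ?ExD//; exact: bmfD.
pose F (f : T -> R) x := cos (f x + th) * (XY x m).1 - sin (f x + th) * (XY x m).2.
have [bX bY] := bmf_XY m.
have bF f : H f -> bmf (F f).
  move=> hf; apply: bmfB; apply: bmfM => //; first by apply: bmf_cos; exact: aff.
  by apply: bmf_sin; exact: aff.
transitivity (\sum_i (c i / 2 * (gmean g0 * expR (- (Q g0 g + C i)) * E (F (fun x => g x + w i x)%R) +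
   gmean g0 * expR (- (Q g0 g - C i)) * E (F (fun x => g x - w i x))))).
  by apply: eq_bigr => i _; rewrite /G1 /G2 !ih// covarDr// covarBr.
transitivity (gmean g0 * expR (- Q g0 g) * \sum_i
   (E (fun x => c i / 2 * (expR (- C i) * F (fun x => g x + w i x)%R x + expR (C i) * F (fun x => g x - w i x)%R x)))).
  rewrite mulr_sumr; apply: eq_bigr => i _.
  rewrite (ExZ P (c i / 2) (bmfD (bmfZ (expR (- C i)) (bF _ (hD i))) (bmfZ (expR (C i)) (bF _ (hB i))))).
  rewrite (ExD P (bmfZ (expR (- C i)) (bF _ (hD i))) (bmfZ (expR (C i)) (bF _ (hB i)))).
  rewrite (ExZ P (expR (- C i)) (bF _ (hD i))) (ExZ P (expR (C i)) (bF _ (hB i))).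
  rewrite opprD opprB [C i - _]addrC !expRD.
  by set a := E _; set b := E _; ring.
rewrite -Ex_sum; last by move=> i; apply: bmfZ; apply: bmfD; apply: bmfZ; exact: bF.
congr (_ * _); apply: Ex_ext => x /=.
rewrite -/(XY x m) {1 2}/shiftA {1 2}/shiftB.
rewrite mulNr opprK mulrDr mulNr mulrBr.
transitivity (\sum_i (c i * ((cos (g x + th) * (XY x m).1 - sin (g x + th) * (XY x m).2) * ch (C i) * cos (w i x)
  + (cos (g x + th) * (XY x m).2 + sin (g x + th) * (XY x m).1) * sh (C i) * sin (w i x)))).
  apply: eq_bigr => i _; rewrite /F.
  rewrite (_ : g x + w i x + th = (g x + th) + w i x); last by ring.
  rewrite (_ : g x - w i x + th = (g x + th) - w i x); last by ring.
  by move: (g x + th) => a; rewrite cosB cosD sinB sinD /ch /sh; field.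
set a := cos _; set b := sin _; set X := _.1; set Y := _.2.
transitivity ((a * X - b * Y) * (\sum_i c i * ch (C i) * cos (w i x)) +
   (a * Y + b * X) * (\sum_i c i * sh (C i) * sin (w i x))).
  by rewrite !mulr_sumr -big_split; apply: eq_bigr => i _ /=; ring.
by set A := \sum_i _; set B := \sum_i _; ring.
Qed.

Let cos_seriesE (th x y : R) n : cos_series th x y n =
  \sum_(0 <= m < n) cos (th + m%:R * (pi / 2)) / m`!%:R * (cpow x y m).1.
Proof. by []. Qed.

(* [trigS] at the shifted complex argument is [shiftA - i shiftB]. *)
Lemma shift_cos th :
  E (fun x => cos (g0 x) * cos (trigS x + th)) =
  gmean g0 * E (fun x => cos (shiftA x + th) * ch (shiftB x)).
Proof.
have bS := bmf_trigS; have bA := bmf_shiftA; have bB := bmf_shiftB.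
have [mS [K1 SK1]] := bS; have [mA [K2 AK2]] := bA; have [mB [K3 BK3]] := bB.
pose K : R := `|K1| + `|K2| + `|K3|.
have SK x : `|trigS x| <= K.
  by rewrite (le_trans (SK1 x))// (le_trans (ler_norm _))// /K -addrA lerDl addr_ge0.
have AK x : `|shiftA x| <= K.
  by rewrite (le_trans (AK2 x))// (le_trans (ler_norm _))// /K addrAC lerDr addr_ge0.
have BK x : `|- shiftB x| <= K.
  by rewrite normrN (le_trans (BK3 x))// (le_trans (ler_norm _))// /K lerDr addr_ge0.
have b0 : bmf (fun x => cos (g0 x)) by apply: bmf_cos; exact: (gs_meas gH Hg0).
have bcp m : bmf (fun x => (cpow (trigS x) 0 m).1).
  by under eq_fun do rewrite cpow_real; exact: bmfX.
have bcs n : bmf (fun x => cos_series th (trigS x) 0 n).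
  by rewrite /cos_series; apply: bmf_sum => m; exact: bmfZ.
have bcs' n : bmf (fun x => cos_series th (shiftA x) (- shiftB x) n).
  by rewrite /cos_series; apply: bmf_sum => m; apply: bmfZ; have [] := bmf_XY m.
(* Exact term by term, by [shift_pow] with the zero element [0 * g0] in place of [g]. Only the
   truncation of the series costs an error, and that tends to zero. *)
have ser n : E (fun x => cos (g0 x) * cos_series th (trigS x) 0 n) =
    gmean g0 * E (fun x => cos_series th (shiftA x) (- shiftB x) n).
  transitivity (\sum_(0 <= m < n) (cos (th + m%:R * (pi / 2)) / m`!%:R *
      E (fun x => cos (g0 x) * trigS x ^+ m))).
    transitivity (E (fun x => \sum_(0 <= m < n) (cos (th + m%:R * (pi / 2)) / m`!%:R *
        (cos (g0 x) * trigS x ^+ m)))).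
      apply: Ex_ext => x; rewrite cos_seriesE mulr_sumr; apply: eq_bigr => m _.
      by rewrite cpow_real mulrCA.
    rewrite Ex_sum; last by move=> m; apply: bmfZ; apply: bmfM => //; exact: bmfX.
    apply: eq_bigr => m _; rewrite ExZ//; apply: bmfM => //; exact: bmfX.
  have -> : (fun x => cos_series th (shiftA x) (- shiftB x) n) =
     (fun x => \sum_(0 <= m < n) cos (th + m%:R * (pi / 2)) / m`!%:R * (XY x m).1) by [].
  rewrite Ex_sum; last by move=> m; apply: bmfZ; have [] := bmf_XY m.
  rewrite mulr_sumr; apply: eq_bigr => m _.
  rewrite ExZ; last by have [] := bmf_XY m.
  rewrite [RHS]mulrCA; congr (_ * _).
  have h0 : H (fun x => 0 * g0 x) by exact: gs_scale.
  have := shift_pow m 0 h0.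
  rewrite covarZr// mul0r oppr0 expR0 mulr1.
  rewrite (@Ex_ext _ _ _ _ _ (fun x => cos (g0 x) * trigS x ^+ m)); last first.
    by move=> x; rewrite mul0r !addr0.
  move=> ->; congr (_ * _); apply: Ex_ext => x.
  by rewrite mul0r addr0 cos0 sin0 mul1r mul0r subr0.
pose del n := expR K * exp_coeff (K *+ 2) n.
have err1 x n : `|cos (trigS x + th) - cos_series th (trigS x) 0 n| <= del n.
  have K0 : `|0 : R| <= K by rewrite normr0 (le_trans _ (SK x)).
  by have := cos_series_err th n (SK x) K0; rewrite ch0 mul1r (addrC th).
have err2 x n : `|cos (shiftA x + th) * ch (shiftB x) - cos_series th (shiftA x) (- shiftB x) n| <= del n.
  by have := cos_series_err th n (AK x) (BK x); rewrite chN (mulrC (ch _)) (addrC th).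
have bct : bmf (fun x => cos (trigS x + th)).
  by apply: bmf_cos; apply: measurable_funD.
have bch : bmf (fun x => ch (shiftB x)).
  have -> : (fun x => ch (shiftB x)) = (fun x => 2^-1 * (expR (shiftB x) + expR (- shiftB x))).
    by apply/funext => x; rewrite /ch mulrC.
  by apply: bmfZ; apply: bmfD; apply: bmf_exp => //; exact: bmfN.
have bca : bmf (fun x => cos (shiftA x + th) * ch (shiftB x)).
  by apply: bmfM => //; apply: bmf_cos; apply: measurable_funD.
apply/eqP; rewrite -subr_eq0 -normr_le0.
set D := _ - _.
have Dle n : `|D| <= del n *+ 2.
  have -> : D = E (fun x => cos (g0 x) * (cos (trigS x + th) - cos_series th (trigS x) 0 n)) -
    gmean g0 * E (fun x => cos (shiftA x + th) * ch (shiftB x) - cos_series th (shiftA x) (- shiftB x) n).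
    rewrite ExB// mulrBr -ser /D.
    rewrite (@Ex_ext _ _ _ _ (fun x => cos (g0 x) * (_ - _)) (fun x => cos (g0 x) * cos (trigS x + th) - cos (g0 x) * cos_series th (trigS x) 0 n)); last by move=> x; rewrite mulrBr.
    rewrite ExB; [|exact: bmfM|exact: bmfM].
    by set a := E _; set b := E _; set e := E _; ring.
  rewrite (le_trans (ler_normB _ _))// mulr2n lerD//.
    apply: Ex_norm_le; first by apply: bmfM => //; exact: bmfB.
    move=> x; rewrite normrM -[leRHS]mul1r ler_pM// cos_max//.
  rewrite normrM -[leRHS]mul1r ler_pM//.
    by rewrite ger0_norm ?gmean_le1// ltW// gmean_gt0.
  by apply: Ex_norm_le; first exact: bmfB.
have dcv : (fun n => del n *+ 2) @ \oo --> (0 : R).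
  rewrite -[0 in X in _ --> X](mul0rn R 2) -[0 in X in _ --> X](mulr0 (expR K)).
  apply: cvgMn; apply: cvgMl_tmp; exact: cvg_exp_coeff.
have ndcv : (fun n => - (del n *+ 2)) @ \oo --> (0 : R) by rewrite -[0 in X in _ --> X]oppr0; exact: cvgN.
rewrite -oppr_ge0; apply: (lim_le ndcv) => n.
by rewrite lerN2.
Qed.
End shift.
End gaussian_space.

(** * Central limit theorem for cosine sums *)

Section elementary_bounds.
Context {R : realType}.
Implicit Types x y a b : R.

Lemma sh_bound x D : `|x| <= D -> `|sh x| <= `|x| * expR D.
Proof.
move=> xD.
have pos (z : R) : 0 <= z -> z <= D -> `|sh z| <= z * expR D.
  move=> z0 zD; rewrite mulrC -[z in leRHS]expr1 -[expR D]divr1.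
  apply: (@taylor_step _ _ ch (expR D) 0 z is_derive_sh sh0) => // y /andP[y0 yz].
  rewrite expr0 mulr1 ger0_norm ?(le_trans ler01 (ch_ge1 _))//.
  by apply: ch_le; rewrite ger0_norm// (le_trans yz).
have [x0|x0] := leP 0 x.
  by rewrite (ger0_norm x0) pos// (le_trans (ler_norm _) xD).
rewrite -[sh x]opprK -shN normrN (ltr0_norm x0) pos//; first by rewrite oppr_ge0 ltW.
by rewrite -(ltr0_norm x0).
Qed.

Lemma ch_bound x D : `|x| <= D -> ch x - 1 <= x ^+ 2 * expR D.
Proof.
move=> xD.
have pos (z : R) : 0 <= z -> z <= D -> ch z - 1 <= z ^+ 2 * expR D.
  move=> z0 zD.
  have dch (y : R) : is_derive y 1 (fun y => ch y - 1) (sh y).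
    by apply: (drv_eq (drv_sub (is_derive_ch y) (drv_cst y 1))); rewrite subr0.
  have := @taylor_step _ _ sh (expR D) 1 z dch _ _ z0.
  rewrite ch0 subrr => /(_ erefl) h.
  apply: (le_trans (ler_norm _)); apply: (le_trans (h _)).
    move=> y /andP[y0 yz]; rewrite expr1 mulrC -{2}[y]ger0_norm//; apply: sh_bound.
    by rewrite ger0_norm// (le_trans yz).
  by rewrite mulrC ler_wpM2l ?sqr_ge0// ler_pdivrMr// ler_peMr ?expR_ge0// ler1n.
have [x0|x0] := leP 0 x; first by rewrite pos// (le_trans (ler_norm _) xD).
rewrite -chN -sqrrN pos//; first by rewrite oppr_ge0 ltW.
by rewrite -(ltr0_norm x0).
Qed.

Lemma sin_lip_pos a b : 0 <= b -> `|sin (a + b) - sin a| <= b.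
Proof.
move=> b0.
have ds (y : R) : is_derive y 1 (fun y => sin (a + y) - sin a) (cos (a + y)).
  apply: (drv_eq (drv_sub (drv_sin (drv_add (drv_cst y a) (drv_id y))) (drv_cst y (sin a)))).
  by rewrite add0r mulr1 subr0.
have := @taylor_step _ _ _ 1 0 b ds _ _ b0.
rewrite addr0 subrr divr1 mul1r expr1; apply => // z _.
by rewrite expr0 mulr1 cos_max.
Qed.

Lemma cos_taylor1 a b : `|cos (a + b) - cos a + b * sin a| <= b ^+ 2.
Proof.
have pos (u v : R) : 0 <= v -> `|cos (u + v) - cos u + v * sin u| <= v ^+ 2.
  move=> v0.
  have dc (y : R) : is_derive y 1 (fun y => cos (u + y) - cos u + y * sin u) (sin u - sin (u + y)).
    have h1 := drv_sub (drv_cos (drv_add (drv_cst y u) (drv_id y))) (drv_cst y (cos u)).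
    apply: (drv_eq (drv_add h1 (drv_mul (drv_id y) (drv_cst y (sin u))))).
    by ring.
  have := @taylor_step _ _ _ 1 1 v dc _ _ v0.
  rewrite addr0 mul0r subrr addr0 => /(_ erefl) h.
  apply: (le_trans (h _)).
    by move=> y /andP[y0 yz]; rewrite expr1 mul1r distrC sin_lip_pos.
  by rewrite ler_piMl ?sqr_ge0// div1r invf_le1// ler1n.
have [b0|b0] := leP 0 b; first exact: pos.
have := pos (- a) (- b); rewrite oppr_ge0 (ltW b0) sqrrN => /(_ isT).
by rewrite -opprD !cosN sinN mulrNN.
Qed.

Lemma cos_lip a b : `|cos a - cos b| <= `|a - b|.
Proof.
have pos (u v : R) : 0 <= v -> `|cos (u + v) - cos u| <= v.
  move=> v0; have ds (y : R) : is_derive y 1 (fun y => cos (u + y) - cos u) (- sin (u + y)).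
    apply: (drv_eq (drv_sub (drv_cos (drv_add (drv_cst y u) (drv_id y))) (drv_cst y (cos u)))).
    by rewrite add0r mulr1 subr0.
  have := @taylor_step _ _ _ 1 0 v ds _ _ v0.
  rewrite addr0 subrr divr1 mul1r expr1; apply => // z _.
  by rewrite expr0 mulr1 normrN sin_max.
have [h|h] := leP b a.
  rewrite (ger0_norm (_ : 0 <= a - b)) ?subr_ge0//.
  by have := pos b (a - b); rewrite subr_ge0 [b + _]addrC subrK; apply.
rewrite distrC [leRHS]distrC (ger0_norm (_ : 0 <= b - a)) ?subr_ge0 ?(ltW h)//.
by have := pos a (b - a); rewrite subr_ge0 [a + _]addrC subrK; apply; exact: ltW.
Qed.

Lemma expR_lip a b : 0 <= a -> 0 <= b -> `|expR (- a) - expR (- b)| <= `|a - b|.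
Proof.
have pos (u v : R) : 0 <= u -> 0 <= v -> u <= v -> `|expR (- u) - expR (- v)| <= v - u.
  move=> u0 v0 uv; rewrite ger0_norm ?subr_ge0 ?ler_expR ?lerN2//.
  rewrite (_ : - v = - u + - (v - u)); last by ring.
  rewrite expRD -{1}[expR (- u)]mulr1 -mulrBr.
  rewrite (@le_trans _ _ (1 - expR (- (v - u))))//.
    rewrite ler_piMl//; first by rewrite subr_ge0 -expR0 ler_expR oppr_le0 subr_ge0.
    by rewrite -expR0 ler_expR oppr_le0.
  by have := expR_ge1Dx (- (v - u)); lra.
move=> a0 b0; have [h|/ltW h] := leP a b.
  by rewrite [leRHS]distrC (ger0_norm (_ : 0 <= b - a)) ?subr_ge0// pos.
by rewrite distrC (ger0_norm (_ : 0 <= a - b)) ?subr_ge0// pos.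
Qed.

End elementary_bounds.

Section char_fun_derivative.
Context d (T : measurableType d) (R : realType) (P : probability T R).
Local Notation E := (Ex P).

Lemma is_derive_char (S : T -> R) th (t : R) : bmf S ->
  is_derive t 1 (fun t => E (fun x => cos (t * S x + th)))
    (- E (fun x => S x * sin (t * S x + th))).
Proof.
move=> bS; have [mS [K SK]] := bS.
have K0 : 0 <= K by rewrite (le_trans _ (SK point)).
have mts u : measurable_fun setT (fun x => u * S x + th).
  by apply: measurable_funD => //; exact: measurable_funM.
have cosint u : P.-integrable setT (EFin \o (fun x => cos (u * S x + th))).
  by apply: bmf_itg; exact: bmf_cos.
have d1 (u : R) x : is_derive u 1 (fun u => cos (u * S x + th)) (- (S x * sin (u * S x + th))).
  apply: (drv_eq (drv_cos (drv_add (drv_mul (drv_id u) (drv_cst u (S x))) (drv_cst u th)))).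
  by rewrite mulr0 add0r mulr1 addr0 mulNr mulrC.
have p1 (u : R) x : partial1of2 (fun u x => cos (u * S x + th)) u x = - (S x * sin (u * S x + th)).
  by rewrite partial1of2E; have [_ ->] := d1 u x.
have It : `]t - 1, t + 1[%classic t by rewrite /= in_itv/= ltrBlDr ltrDl ltr01.
have Gint : P.-integrable setT (EFin \o (cst K)) by exact: finite_measure_integrable_cst.
have Gub (u : R) x : `]t - 1, t + 1[%classic u -> setT x ->
    `|partial1of2 (fun u x => cos (u * S x + th)) u x| <= cst K x.
  by move=> _ _; rewrite p1 normrN normrM -[leRHS]mulr1 ler_pM// sin_max.
have dint (u : R) x : `]t - 1, t + 1[%classic u -> setT x -> derivable (fun u : R => cos (u * S x + th)) u 1.
  by move=> _ _; have [] := d1 u x.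
have G0 (x : T) : 0 <= cst K x by [].
apply: DeriveDef.
- exact: (@derivable_under_integral _ _ _ P _ _ measurableT t _ _ It
    (fun u _ => cosint u) dint _ G0 Gint Gub).
- rewrite -derive1E (@differentiation_under_integral _ _ _ P _ _ measurableT t _ _ It
    (fun u _ => cosint u) dint _ G0 Gint Gub).
  rewrite -ExN; last by apply: bmfM => //; exact: bmf_sin.
  by apply: eq_Rintegral => x _; rewrite p1.
Qed.

(* Gronwall for [phi' = - s2 t phi + O(eps)], whose exact solution is the Gaussian one. *)
Lemma char_ode_bound (S : T -> R) th (s2 eps tau : R) : bmf S -> 0 <= s2 ->
  (forall t, 0 <= t <= tau -> `|- E (fun x => S x * sin (t * S x + th)) +
     t * s2 * E (fun x => cos (t * S x + th))| <= eps) ->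
  0 <= tau ->
  `|E (fun x => cos (tau * S x + th)) - cos th * expR (- (s2 * tau ^+ 2 / 2))| <= tau * eps.
Proof.
move=> bS s20 h tau0.
(* Integrating factor: [G] is the difference to be bounded times [e], and its derivative is the
   assumed defect times [e]. *)
pose e (t : R) := expR (s2 * t ^+ 2 / 2).
pose G (t : R) := E (fun x => cos (t * S x + th)) * e t - cos th.
have de (t : R) : is_derive t 1 e (e t * (s2 * t)).
  have h1 := drv_exp (drv_mul (drv_mull s2 (drv_pow 1 t)) (drv_cst t 2^-1)).
  by apply: (drv_eq h1); rewrite /e expr1; field.
have dG (t : R) : is_derive t 1 G ((- E (fun x => S x * sin (t * S x + th)) +
     t * s2 * E (fun x => cos (t * S x + th))) * e t).
  have h1 := drv_sub (drv_mul (is_derive_char th t bS) (de t)) (drv_cst t (cos th)).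
  by apply: (drv_eq h1); set a := E _; set b := E _; ring.
have G0 : G 0 = 0.
  rewrite /G /e expr0n/= mulr0 mul0r expR0 mulr1.
  apply/eqP; rewrite subr_eq0; apply/eqP; rewrite -[RHS](Ex_cst P).
  by apply: Ex_ext => x; rewrite mul0r add0r.
have Gb : `|G tau| <= eps * e tau / 1%:R * tau ^+ 1.
  apply: (@taylor_step _ G _ (eps * e tau) 0 tau dG G0) => // z /andP[z0 zt].
  rewrite expr0 mulr1 normrM ler_pM//; first by apply: h; rewrite z0.
  rewrite ger0_norm ?expR_ge0// ler_expR ler_wpM2r// ler_wpM2l// -subr_ge0 subr_sqr.
  by rewrite mulr_ge0 ?subr_ge0// addr_ge0// (le_trans z0).
have ep : 0 < e tau by exact: expR_gt0.
rewrite -(ler_pM2r ep) -{1}(gtr0_norm ep) -normrM mulrBl.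
have ee : expR (- (s2 * tau ^+ 2 / 2)) * e tau = 1 by rewrite /e -expRD addNr expR0.
rewrite -(mulrA (cos th)) ee mulr1.
by move: Gb; rewrite divr1 expr1 mulrC mulrA.
Qed.
End char_fun_derivative.

Section trig_clt.
Context d (T : measurableType d) (R : realType) (P : probability T R).
Local Notation E := (Ex P).
Local Notation Q := (covar P).
Local Notation gmean := (gmean P).
Variables (H : (T -> R) -> Prop) (gH : gaussian_space P H).
Variables (I : finType) (c : I -> R) (w : I -> T -> R) (Hw : forall i, H (w i)).
(** In the application [kap] has order [n^(-1/2)], [D] and [B2] do not depend on [n], and [b1] is
    only known to be [o(sqrt n)]. *)
Variables (kap D B2 b1 : R).
Hypothesis ck : forall i, `|c i| <= kap.
Hypothesis QD : forall i j, `|Q (w i) (w j)| <= D.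
Hypothesis QB : forall i, \sum_j Q (w i) (w j) ^+ 2 <= B2.
Hypothesis Qb : forall i, \sum_j `|Q (w i) (w j)| <= b1.
Hypotheses (kap0 : 0 <= kap) (B20 : 0 <= B2) (b10 : 0 <= b1).

Let C i j := Q (w i) (w j).
Let m i := gmean (w i).
Let K := expR D.
Let K0 : 0 < K. Proof. exact: expR_gt0. Qed.
Let mw i : measurable_fun setT (w i). Proof. exact: (gs_meas gH (Hw i)). Qed.
Let m0 i : 0 < m i. Proof. exact: gmean_gt0. Qed.
Let m1 i : m i <= 1. Proof. exact: gmean_le1. Qed.
Let nm i : `|m i| = m i. Proof. by rewrite gtr0_norm. Qed.
Let K0' : 0 <= K. Proof. exact: ltW. Qed.
Let m0' i : 0 <= m i. Proof. exact: ltW. Qed.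
Let QB' i : \sum_j C i j ^+ 2 <= B2. Proof. exact: QB. Qed.
Let Qb' i : \sum_j `|C i j| <= b1. Proof. exact: Qb. Qed.
Let bcos i : bmf (fun x => cos (w i x)). Proof. exact: bmf_cos. Qed.
Let bcosm i : bmf (fun x => cos (w i x) - m i). Proof. by apply: bmfB => //; exact: bmf_cst. Qed.

Definition centS (x : T) : R := \sum_i c i * (cos (w i x) - m i).

Lemma bmf_centS : bmf centS.
Proof. by apply: bmf_sum => i; exact: bmfZ. Qed.

Let sqr_cent (q : I -> R) :
  E (fun x => (\sum_i q i * (cos (w i x) - m i)) ^+ 2) =
  \sum_i \sum_j q i * q j * (m i * m j * (ch (C i j) - 1)).
Proof.
transitivity (E (fun x => \sum_i \sum_j q i * q j * ((cos (w i x) - m i) * (cos (w j x) - m j)))).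
  apply: Ex_ext => x; rewrite expr2 mulr_suml; apply: eq_bigr => i _.
  by rewrite mulr_sumr; apply: eq_bigr => j _; ring.
rewrite Ex_sum; last by move=> i; apply: bmf_sum => j; apply: bmfZ; exact: bmfM.
apply: eq_bigr => i _; rewrite Ex_sum; last by move=> j; apply: bmfZ; exact: bmfM.
apply: eq_bigr => j _.
by rewrite (ExZ P _ (bmfM (bcosm i) (bcosm j))) (Cov_cos gH (Hw i) (Hw j)).
Qed.

Let mmch i j : `|m i * m j * (ch (C i j) - 1)| <= C i j ^+ 2 * K.
Proof.
rewrite !normrM !nm ger0_norm ?subr_ge0 ?ch_ge1//.
rewrite (@le_trans _ _ (ch (C i j) - 1))//.
  rewrite ler_piMl ?subr_ge0 ?ch_ge1//.
  by rewrite -[leRHS]mulr1 ler_pM//.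
exact/ch_bound/QD.
Qed.

Let sqr_cent_le (q : I -> R) (k : R) : (forall i, `|q i| <= k) ->
  E (fun x => (\sum_i q i * (cos (w i x) - m i)) ^+ 2) <= #|I|%:R * (k ^+ 2 * (K * B2)).
Proof.
move=> qk; rewrite sqr_cent (le_trans (ler_norm _))// (le_trans (ler_norm_sum _ _ _))//.
rewrite mulr_natl -sumr_const; apply: ler_sum => i _.
rewrite (le_trans (ler_norm_sum _ _ _))//.
rewrite (@le_trans _ _ (\sum_j k ^+ 2 * (C i j ^+ 2 * K)))//.
  apply: ler_sum => j _; rewrite normrM ler_pM//.
  by rewrite normrM expr2 ler_pM.
by rewrite -mulr_sumr -mulr_suml ler_wpM2l ?sqr_ge0// mulrC ler_wpM2l//.
Qed.

(** The shift along [w i] changes [trigS] by [A i - i B i]. The real part [A i] is of second order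
    in the covariances and hence uniformly small; the imaginary part [B i] is only of first
    order. *)
Let A i (x : T) : R := \sum_k c k * (ch (C i k) - 1) * cos (w k x).
Let B i (x : T) : R := shiftB P c w (w i) x.

Let bA i : bmf (A i).
Proof. by apply: bmf_sum => k; exact: bmfZ. Qed.

Let bB i : bmf (B i). Proof. exact: (bmf_shiftB gH c Hw (w i)). Qed.

Let A_le i x : `|A i x| <= kap * K * B2.
Proof.
rewrite (le_trans (ler_norm_sum _ _ _))//.
rewrite (@le_trans _ _ (\sum_k kap * (C i k ^+ 2 * K)))//.
  apply: ler_sum => k _; rewrite -mulrA normrM ler_pM//.
  rewrite normrM -[leRHS]mulr1 ler_pM ?cos_max//.
  by rewrite ger0_norm ?subr_ge0 ?ch_ge1// ch_bound// QD.
by rewrite -mulr_sumr -mulr_suml -mulrA ler_wpM2l// mulrC ler_wpM2l//.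
Qed.

Let B_le i x : `|B i x| <= kap * K * b1.
Proof.
rewrite (le_trans (ler_norm_sum _ _ _))//.
rewrite (@le_trans _ _ (\sum_k kap * (`|C i k| * K)))//.
  apply: ler_sum => k _; rewrite -mulrA normrM ler_pM//.
  rewrite normrM -[leRHS]mulr1 ler_pM ?sin_max//.
  exact/sh_bound/QD.
by rewrite -mulr_sumr -mulr_suml -mulrA ler_wpM2l// mulrC ler_wpM2l//.
Qed.

(** Squaring the sup bound would leave [kap^2 b1^2 = o(1)], too large for about [n] terms of weight
    [kap]. The second moment is a sum over [k] and [l] of [|C i k| |C i l| |C k l|]: the
    arithmetic-geometric inequality on the last two factors gives [B2] after summing over [l], and
    the sum over [k] gives [b1]. The result [kap^2 b1 B2] is [o(kap)]. *)
Let EB2_le i : E (fun x => B i x ^+ 2) <= kap ^+ 2 * K ^+ 3 * (b1 * B2).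
Proof.
have bs k : bmf (fun x => sin (w k x)) by exact: bmf_sin.
have -> : E (fun x => B i x ^+ 2) = \sum_k \sum_l (c k * sh (C i k)) * (c l * sh (C i l)) *
    (m k * m l * sh (C k l)).
  transitivity (E (fun x => \sum_k \sum_l (c k * sh (C i k)) * (c l * sh (C i l)) *
      (sin (w k x) * sin (w l x)))).
    apply: Ex_ext => x; rewrite expr2 /B /shiftB mulr_suml; apply: eq_bigr => k _.
    by rewrite mulr_sumr; apply: eq_bigr => l _; rewrite -/(C i k) -/(C i l); ring.
  rewrite Ex_sum; last by move=> k; apply: bmf_sum => l; apply: bmfZ; exact: bmfM.
  apply: eq_bigr => k _; rewrite Ex_sum; last by move=> l; apply: bmfZ; exact: bmfM.
  apply: eq_bigr => l _.
  by rewrite (ExZ P _ (bmfM (bs k) (bs l))) (Ex_sinsin gH (Hw k) (Hw l)).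
rewrite (le_trans (ler_norm _))// (le_trans (ler_norm_sum _ _ _))//.
rewrite (@le_trans _ _ (\sum_k kap ^+ 2 * K ^+ 3 * (`|C i k| * B2)))//; last first.
  by rewrite -mulr_sumr -mulr_suml ler_wpM2l ?ler_wpM2r// mulr_ge0 ?exprn_ge0//.
apply: ler_sum => k _; rewrite (le_trans (ler_norm_sum _ _ _))//.
rewrite (@le_trans _ _ (\sum_l kap ^+ 2 * K ^+ 3 * (`|C i k| * (`|C i l| * `|C k l|))))//.
  apply: ler_sum => l _.
  have -> : kap ^+ 2 * K ^+ 3 * (`|C i k| * (`|C i l| * `|C k l|)) =
    (kap * (`|C i k| * K)) * (kap * (`|C i l| * K)) * (`|C k l| * K) by ring.
  rewrite normrM ler_pM//.
    rewrite normrM ler_pM//; rewrite normrM ler_pM//; exact/sh_bound/QD.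
  rewrite normrM -[leRHS]mul1r ler_pM//; last exact/sh_bound/QD.
  by rewrite normrM !nm -[leRHS]mulr1 ler_pM//.
rewrite -mulr_sumr -mulr_sumr ler_wpM2l ?ler_wpM2l//.
  by rewrite mulr_ge0 ?exprn_ge0//.
have amgm (a b : R) : `|a| * `|b| <= 2^-1 * (a ^+ 2 + b ^+ 2).
  rewrite -(real_normK (num_real a)) -(real_normK (num_real b)).
  by have := sqr_ge0 (`|a| - `|b|); lra.
rewrite (@le_trans _ _ (\sum_l 2^-1 * (C i l ^+ 2 + C k l ^+ 2)))//.
  by apply: ler_sum => l _; exact: amgm.
rewrite -mulr_sumr big_split/=.
by have := QB i; have := QB k; rewrite -/(C i) -/(C k); lra.
Qed.

Let s2 : R := E (fun x => centS x ^+ 2).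

Let QQ (x : T) : R := \sum_i c i * m i * A i x.

Let bQQ : bmf QQ. Proof. by apply: bmf_sum => i; exact: bmfZ. Qed.

(** [QQ] concentrates at its mean [s2] because [QQ - s2] is again a centered cosine sum, with
    coefficients [q k] of order [kap^2]. *)
Let QQ_dev : E (fun x => `|QQ x - s2|) <=
  Num.sqrt (#|I|%:R * ((kap ^+ 2 * (K * B2)) ^+ 2 * (K * B2))).
Proof.
pose q k := c k * \sum_i c i * m i * (ch (C i k) - 1).
have QQE x : QQ x - s2 = \sum_k q k * (cos (w k x) - m k).
  rewrite /s2 /centS sqr_cent.
  under [RHS]eq_bigr do rewrite mulrBr.
  rewrite sumrB; congr (_ - _).
    rewrite /QQ /A; under eq_bigr do rewrite mulr_sumr.
    rewrite exchange_big/=; apply: eq_bigr => k _.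
    by rewrite /q mulr_sumr mulr_suml; apply: eq_bigr => i _; ring.
  rewrite exchange_big/=; apply: eq_bigr => k _.
  by rewrite /q mulr_sumr mulr_suml; apply: eq_bigr => i _; ring.
have qle k : `|q k| <= kap ^+ 2 * (K * B2).
  rewrite normrM expr2 -mulrA ler_pM// (le_trans (ler_norm_sum _ _ _))//.
  rewrite (@le_trans _ _ (\sum_i kap * (K * C k i ^+ 2)))//; last first.
    by rewrite -mulr_sumr -mulr_sumr ler_wpM2l// ler_wpM2l//.
  apply: ler_sum => i _; rewrite -mulrA normrM ler_pM//.
  rewrite normrM nm ger0_norm ?subr_ge0 ?ch_ge1//.
  rewrite (@le_trans _ _ (ch (C i k) - 1)) ?ler_piMl ?subr_ge0 ?ch_ge1//.
  by rewrite /C covarC mulrC ch_bound// QD.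
have bd : bmf (fun x => `|QQ x - s2|).
  by apply: bmf_abs; apply: bmfB => //; exact: bmf_cst.
rewrite -[leLHS]ger0_norm; last by apply: Ex_ge0.
rewrite -sqrtr_sqr ler_wsqrtr// (le_trans (Ex_sqr_le P bd))//.
rewrite (le_trans _ (sqr_cent_le qle))// le_eqVlt; apply/orP; left; apply/eqP.
by apply: Ex_ext => x; rewrite real_normK ?num_real// QQE.
Qed.

(** The first summand collects the second-order errors of the [n] shifts, the second one the
    fluctuation of [QQ]. With [kap] of order [n^(-1/2)] and [b1 = o(sqrt n)] both tend to zero. *)
Definition clt_eps (n : nat) (tau : R) : R :=
  n%:R * (kap * (tau ^+ 2 * ((kap * K * B2) ^+ 2 +
     kap ^+ 2 * K ^+ 3 * (b1 * B2) * expR (tau * (kap * K * b1))))) +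
  tau * Num.sqrt (n%:R * ((kap ^+ 2 * (K * B2)) ^+ 2 * (K * B2))).

Let shift_i i (t th : R) :
  E (fun x => (cos (w i x) - m i) * cos (t * centS x + th)) =
  m i * E (fun x => cos (t * centS x + th + t * A i x) * ch (t * B i x) - cos (t * centS x + th)).
Proof.
pose mu := \sum_k c k * m k.
(* The centering constants move into the phase, so that [shift_cos] applies to the uncentered
   sum. *)
have cE x : t * centS x + th = trigS (fun k => t * c k) w x + (th - t * mu).
  rewrite /centS /trigS /mu; under eq_bigr do rewrite mulrBr.
  rewrite sumrB; under [in RHS]eq_bigr do rewrite -mulrA.
  by rewrite -mulr_sumr; ring.
have mcS : measurable_fun setT (fun x => t * centS x + th).
  by apply: measurable_funD => //; apply: measurable_funM => //; case: bmf_centS.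
have bcS : bmf (fun x => cos (t * centS x + th)) by exact: bmf_cos.
have := shift_cos gH (fun k => t * c k) Hw (Hw i) (th - t * mu).
rewrite (@Ex_ext _ _ _ P _ (fun x => cos (w i x) * cos (t * centS x + th))); last by move=> x; rewrite cE.
move=> h.
rewrite (@Ex_ext _ _ _ P _ (fun x => cos (w i x) * cos (t * centS x + th) - m i * cos (t * centS x + th))); last by move=> x; rewrite mulrBl.
have bch : bmf (fun x => ch (t * B i x)).
  have -> : (fun x => ch (t * B i x)) = (fun x => 2^-1 * (expR (t * B i x) + expR (- (t * B i x)))).
    by apply/funext => x; rewrite /ch mulrC.
  by apply: bmfZ; apply: bmfD; apply: bmf_exp; last apply: bmfN; exact: bmfZ.
rewrite ExB; [|exact: bmfM|exact: bmfZ].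
rewrite h ExZ// ExB//; last first.
  apply: bmfM => //; apply: bmf_cos; apply: measurable_funD => //.
  by apply: measurable_funM => //; case: (bA i).
rewrite mulrBr; congr (_ - _); congr (_ * _); apply: Ex_ext => x.
congr (cos _ * ch _).
  rewrite cE /shiftA /trigS /A mulr_sumr addrAC -big_split/=; congr (_ + _).
  by apply: eq_bigr => k _; rewrite -/(C i k); ring.
by rewrite /B /shiftB mulr_sumr; apply: eq_bigr => k _; rewrite -!mulrA.
Qed.

Lemma trig_clt (tau th : R) : 0 <= tau ->
  `|E (fun x => cos (tau * centS x + th)) - cos th * expR (- (s2 * tau ^+ 2 / 2))| <=
  tau * clt_eps #|I| tau.
Proof.
move=> tau0; apply: char_ode_bound => //; first exact: bmf_centS.
  by apply: Ex_ge0 => x; exact: sqr_ge0.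
move=> t /andP[t0 tt].
have mcS u : measurable_fun setT (fun x => t * centS x + u).
  by apply: measurable_funD => //; apply: measurable_funM => //; case: bmf_centS.
(* This phase turns the sine produced by the derivative into a cosine, the form that [shift_i]
   handles. *)
pose th' := th + pi / 2.
have cosE x : cos (t * centS x + th') = - sin (t * centS x + th).
  by rewrite addrA cosDpihalf.
have sinE x : sin (t * centS x + th') = cos (t * centS x + th).
  by rewrite addrA sinDpihalf.
have bcS u : bmf (fun x => cos (t * centS x + u)) by exact: bmf_cos.
have bc x := bmf_centS.
have -> : - E (fun x => centS x * sin (t * centS x + th)) =
   \sum_i c i * E (fun x => (cos (w i x) - m i) * cos (t * centS x + th')).
  transitivity (E (fun x => \sum_i c i * ((cos (w i x) - m i) * cos (t * centS x + th')))).
    rewrite -ExN; last by apply: bmfM; [exact: bmf_centS|exact: bmf_sin].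
    apply: Ex_ext => x; rewrite -mulrN -cosE {1}/centS mulr_suml.
    by apply: eq_bigr => i _; rewrite mulrA.
  rewrite Ex_sum; last by move=> i; apply: bmfZ; exact: bmfM.
  by apply: eq_bigr => i _; rewrite ExZ//; exact: bmfM.
(* What remains of the shifted cosine after the term linear in [A i]; it is quadratic in [A i] and
   [B i]. *)
pose err i x := cos (t * centS x + th' + t * A i x) * ch (t * B i x) - cos (t * centS x + th') +
   t * A i x * sin (t * centS x + th').
have bch i : bmf (fun x => ch (t * B i x)).
  have -> : (fun x => ch (t * B i x)) = (fun x => 2^-1 * (expR (t * B i x) + expR (- (t * B i x)))).
    by apply/funext => x; rewrite /ch mulrC.
  by apply: bmfZ; apply: bmfD; apply: bmf_exp; last apply: bmfN; exact: bmfZ.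
have bmain i : bmf (fun x => cos (t * centS x + th' + t * A i x) * ch (t * B i x) - cos (t * centS x + th')).
  apply: bmfB => //; apply: bmfM => //; apply: bmf_cos; apply: measurable_funD => //.
  by apply: measurable_funM => //; case: (bA i).
have bsinA i : bmf (fun x => t * A i x * sin (t * centS x + th')).
  by apply: bmfM; [exact: bmfZ|exact: bmf_sin].
have berr i : bmf (err i) by exact: bmfD.
have errE i : E (err i) <= tau ^+ 2 * ((kap * K * B2) ^+ 2 +
     kap ^+ 2 * K ^+ 3 * (b1 * B2) * expR (tau * (kap * K * b1))) /\
   `|E (err i)| <= tau ^+ 2 * ((kap * K * B2) ^+ 2 +
     kap ^+ 2 * K ^+ 3 * (b1 * B2) * expR (tau * (kap * K * b1))).
  suff h : `|E (err i)| <= tau ^+ 2 * ((kap * K * B2) ^+ 2 +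
     kap ^+ 2 * K ^+ 3 * (b1 * B2) * expR (tau * (kap * K * b1))).
    by split => //; rewrite (le_trans (ler_norm _)).
  have bub : bmf (fun x => tau ^+ 2 * (kap * K * B2) ^+ 2 + tau ^+ 2 * expR (tau * (kap * K * b1)) * B i x ^+ 2).
    by apply: bmfD; [exact: bmf_cst|apply: bmfZ; exact: bmfX].
  rewrite (le_trans (Ex_norm P (berr i)))// (le_trans (Ex_le P (bmf_abs (berr i)) bub _))//.
    move=> x; set u := t * centS x + th'.
    have -> : err i x = cos (u + t * A i x) * (ch (t * B i x) - 1) +
       (cos (u + t * A i x) - cos u + t * A i x * sin u) by rewrite /err -/u; ring.
    rewrite (le_trans (ler_normD _ _))// addrC lerD//.
      rewrite (le_trans (cos_taylor1 _ _))// exprMn ler_pM ?sqr_ge0//.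
        by rewrite lerXn2r// nnegrE.
      rewrite -real_normK ?num_real// lerXn2r// ?nnegrE// (le_trans _ (A_le i x))//.
    rewrite normrM -[leRHS]mul1r ler_pM// ?cos_max// ger0_norm ?subr_ge0 ?ch_ge1//.
    have tB : `|t * B i x| <= tau * (kap * K * b1).
      by rewrite normrM ler_pM// ?B_le// ger0_norm.
    rewrite (le_trans (ch_bound tB))// exprMn mulrAC ler_wpM2r ?sqr_ge0//.
    by rewrite ler_wpM2r ?expR_ge0// lerXn2r// nnegrE.
  rewrite ExD; [|exact: bmf_cst|by apply: bmfZ; exact: bmfX].
  rewrite Ex_cst ExZ; last exact: bmfX.
  rewrite mulrDr lerD2l -(mulrA (tau ^+ 2)) ler_wpM2l ?sqr_ge0// [leRHS]mulrC.
  by rewrite ler_wpM2l ?expR_ge0.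
have step i : c i * E (fun x => (cos (w i x) - m i) * cos (t * centS x + th')) =
    c i * m i * E (err i) - t * E (fun x => c i * m i * A i x * cos (t * centS x + th)).
  have bAc : bmf (fun x => c i * m i * A i x * cos (t * centS x + th)).
    by apply: bmfM => //; exact: bmfZ.
  have -> : t * E (fun x => c i * m i * A i x * cos (t * centS x + th)) =
      c i * m i * E (fun x => t * A i x * sin (t * centS x + th')).
    rewrite -(ExZ P _ (bsinA i)) -(ExZ P _ bAc); apply: Ex_ext => x.
    by rewrite sinE; ring.
  rewrite (ExD P (bmain i) (bsinA i) : E (err i) = _) shift_i.
  by set a := E _; set b := E _; ring.
under eq_bigr do rewrite step.
rewrite sumrB -mulr_sumr -Ex_sum; last by move=> i; apply: bmfM => //; exact: bmfZ.
(* The linear terms add up to [QQ]. Splitting off its mean [s2] leaves exactly the drift of the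
   Gaussian differential equation. *)
have -> : E (fun x => \sum_i c i * m i * A i x * cos (t * centS x + th)) =
   E (fun x => (QQ x - s2) * cos (t * centS x + th)) + s2 * E (fun x => cos (t * centS x + th)).
  rewrite -ExZ// -ExD//; [|apply: bmfM => //; apply: bmfB => //; exact: bmf_cst|exact: bmfZ].
  apply: Ex_ext => x; rewrite -mulr_suml -/(QQ x); ring.
rewrite mulrDr opprD addrA mulrA subrK.
rewrite (le_trans (ler_normB _ _))// /clt_eps lerD//.
  rewrite (le_trans (ler_norm_sum _ _ _))// mulr_natl -sumr_const; apply: ler_sum => i _.
  rewrite normrM ler_pM//; last by have [] := errE i.
  by rewrite normrM -[leRHS]mulr1 ler_pM// gtr0_norm.
rewrite normrM ler_pM//; first by rewrite ger0_norm.
have bQ : bmf (fun x => (QQ x - s2) * cos (t * centS x + th)).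
  by apply: bmfM => //; apply: bmfB => //; exact: bmf_cst.
rewrite (le_trans _ QQ_dev)// (le_trans (Ex_norm P bQ))// Ex_le//.
- exact: bmf_abs.
- by apply: bmf_abs; apply: bmfB => //; exact: bmf_cst.
- by move=> x; rewrite normrM -[leRHS]mulr1 ler_pM// cos_max.
Qed.

End trig_clt.

Lemma lim_le2 (R : realType) (u v : nat -> R) (l k : R) :
  u @ \oo --> l -> v @ \oo --> k -> (forall n, u n <= v n) -> l <= k.
Proof.
move=> ul vk uv; have h : (fun n => u n - v n) @ \oo --> l - k by exact: cvgB.
by rewrite -subr_le0; apply: (lim_le h) => n; rewrite subr_le0.
Qed.

Lemma cvg_finsum (R : realType) (I : Type) (r : seq I) (f : I -> nat -> R) (l : I -> R) :
  (forall i, f i @ \oo --> l i) ->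
  (fun n => \sum_(i <- r) f i n) @ \oo --> \sum_(i <- r) l i.
Proof.
move=> h; elim: r => [|i r ih].
  by rewrite big_nil; under eq_fun do rewrite big_nil; exact: cvg_cst.
by rewrite big_cons; under eq_fun do rewrite big_cons; exact: cvgD.
Qed.

(** * Semidefinite factorization and a Schur test on tensor powers *)

Section cholesky.
Context {R : realType}.

(** Elimination of the first coordinate: a zero pivot forces its whole row to vanish, a positive one
    leaves the Schur complement. As [S] is only semidefinite, [B] may be singular. *)
Lemma cholesky n (S : 'M[R]_n) : S^T = S ->
  (forall x : 'rV[R]_n, 0 <= (x *m S *m x^T) 0 0) -> exists B : 'M[R]_n, S = B *m B^T.
Proof.
elim: n S => [|n ih] S ST Spsd.
  by exists 0; apply/matrixP => -[].
rewrite -[n.+1]/(1 + n)%N in S ST Spsd *.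
have [a [v [D [SE DT]]]] : exists (a : 'M[R]_1) (v : 'M[R]_(1, n)) (D : 'M[R]_n),
    S = block_mx a v v^T D /\ D^T = D.
  exists (ulsubmx S), (ursubmx S), (drsubmx S); rewrite trmx_drsub ST trmx_ursub ST.
  by rewrite submxK.
have form (t : 'M[R]_1) (y : 'rV[R]_n) : 0 <= (t *m a *m t^T + y *m v^T *m t^T + (t *m v *m y^T + y *m D *m y^T)) 0 0.
  have := Spsd (row_mx t y).
  by rewrite {1}SE mul_row_block tr_row_mx mul_row_col !mulmxDl.
have aE : a = (a 0 0)%:M by apply/matrixP => i j; rewrite !ord1 [RHS]mxE eqxx mulr1n.
have a0 : 0 <= a 0 0.
  have := form 1%:M 0; rewrite !mul0mx trmx0 mulmx0 trmx1 mulmx1 mul1mx !addr0.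
  exact.
have yv (y : 'rV[R]_n) : (y *m v^T) 0 0 = (v *m y^T) 0 0.
  by rewrite !mxE; apply: eq_bigr => i _; rewrite !mxE mulrC.
have vv (y : 'rV[R]_n) (t : R) : ((t%:M *m v *m y^T) 0 0 = t * (v *m y^T) 0 0) * ((y *m v^T *m (t%:M)^T) 0 0 = t * (v *m y^T) 0 0).
  split; first by rewrite mul_scalar_mx -scalemxAl mxE.
  by rewrite tr_scalar_mx mul_mx_scalar mxE yv.
have form2 (t : R) (y : 'rV[R]_n) : 0 <= t ^+ 2 * a 0 0 + 2 * t * (v *m y^T) 0 0 + (y *m D *m y^T) 0 0.
  have := form t%:M y; rewrite mxE mxE [(_ + y *m D *m y^T) 0 0]mxE !vv.
  rewrite {1}aE tr_scalar_mx -!scalar_mxM mxE eqxx mulr1n; lra.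
have [a00|ap] := eqVneq (a 0 0) 0.
  have v0 : v = 0.
    pose q := (v *m v^T) 0 0.
    have qE : q = \sum_i v 0 i ^+ 2 by rewrite /q mxE; apply: eq_bigr => i _; rewrite mxE.
    have q0 : q = 0.
      (* With [a = 0] the form is affine in its first argument; the chosen value makes it equal to
         -1. *)
      apply/eqP/negP => /negP qn; have := form2 (- ((v *m D *m v^T) 0 0 + 1) / (2 * q)) v.
      rewrite a00 mulr0 add0r -/q (_ : 2 * _ * q + _ = -1); first by rewrite lerNr oppr0 ler10.
      by field.
    apply/rowP => i; rewrite mxE; apply/eqP; rewrite -sqrf_eq0; apply/eqP.
    move: q0; rewrite qE => /psumr_eq0P; apply => // j _; exact: sqr_ge0.
  have [|y|B' DE] := ih D; first exact: DT.
    by have := form2 0 y; rewrite expr0n/= mul0r mulr0 mul0r !add0r.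
  exists (block_mx 0 0 0 B').
  rewrite SE aE a00 v0 trmx0 tr_block_mx !trmx0 mulmx_block !mul0mx !mulmx0 !addr0 add0r -DE.
  by congr (block_mx _ _ _ _); apply/matrixP => i j; rewrite !mxE mul0rn.
have {}ap : 0 < a 0 0 by rewrite lt_neqAle eq_sym ap.
have [||B' DE] := ih (D - (a 0 0)^-1 *: (v^T *m v)).
- by rewrite linearB/= DT linearZ/= trmx_mul trmxK.
(* The value of the first coordinate that minimizes the form for given [y]; the minimum is the form
   of the Schur complement. *)
- move=> y; have := form2 (- (v *m y^T) 0 0 / a 0 0) y.
  have sube (A B : 'M[R]_1) : (A - B) 0 0 = A 0 0 - B 0 0 by rewrite !mxE.
  have scale (k : R) (A : 'M[R]_1) : (k *: A) 0 0 = k * A 0 0 by rewrite !mxE.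
  have vvE : (y *m (v^T *m v) *m y^T) 0 0 = (v *m y^T) 0 0 * (v *m y^T) 0 0.
    by rewrite mulmxA -(mulmxA _ v) mxE big_ord1 yv.
  rewrite mulmxBr mulmxBl -scalemxAr -scalemxAl sube scale vvE.
  set p := (v *m y^T) 0 0; set q := (y *m D *m y^T) 0 0.
  by rewrite (_ : _ + q = q - (a 0 0)^-1 * (p * p)) //; field; rewrite gt_eqF.
pose s := Num.sqrt (a 0 0).
have ss : s * s = a 0 0 by rewrite -expr2 sqr_sqrtr.
have s0 : s != 0 by rewrite gt_eqF// sqrtr_gt0.
exists (block_mx s%:M 0 (s^-1 *: v^T) B').
rewrite tr_block_mx tr_scalar_mx trmx0 mulmx_block !mul0mx !mulmx0 !addr0.
rewrite linearZ/= trmxK -DE {1}SE; congr (block_mx _ _ _ _).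
- by rewrite -scalar_mxM ss.
- by rewrite mul_scalar_mx scalerA divff// scale1r.
- by rewrite mul_mx_scalar scalerA divff// scale1r.
- by rewrite -scalemxAl -scalemxAr scalerA -invfM ss addrC subrK.
Qed.

End cholesky.

Section tensor_bound.
Context {R : realType} (n : nat) (J : finType).
Variables (a : J -> 'I_n -> R) (w : J -> R) (K : 'I_n -> 'I_n -> R) (theta : R).
Hypothesis Kr : forall u, \sum_v `|K u v| <= theta.
Hypothesis Kc : forall v, \sum_u `|K u v| <= theta.

(* The two sides are quadratic forms in the coordinates [t f] of the order-[M] tensor
   [\sum_j w j *: (a j)^(tensor M)]; the Schur test bounds the [M]-th tensor power of [K]. *)
Lemma tensor_bound (M : nat) :
  `|\sum_i \sum_j w i * w j * (\sum_u \sum_v a i u * K u v * a j v) ^+ M| <=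
  theta ^+ M * \sum_i \sum_j w i * w j * (\sum_u a i u * a j u) ^+ M.
Proof.
pose F := {ffun 'I_M -> 'I_n}.
pose t (f : F) := \sum_i w i * \prod_(k < M) a i (f k).
pose kap (f g : F) := \prod_(k < M) K (f k) (g k).
have powE (x : 'I_n -> R) : (\sum_u x u) ^+ M = \sum_(f : F) \prod_(k < M) x (f k).
  rewrite -[in LHS](card_ord M) -prodr_const.
  by rewrite (bigA_distr_bigA (fun _ u => x u)).
have rhsE : \sum_i \sum_j w i * w j * (\sum_u a i u * a j u) ^+ M = \sum_(f : F) t f ^+ 2.
  transitivity (\sum_i \sum_j \sum_(f : F) (w i * \prod_(k < M) a i (f k)) * (w j * \prod_(k < M) a j (f k))).
    apply: eq_bigr => i _; apply: eq_bigr => j _; rewrite powE mulr_sumr.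
    by apply: eq_bigr => f _; rewrite big_split/=; ring.
  under eq_bigr do rewrite exchange_big/=.
  rewrite exchange_big/=; apply: eq_bigr => f _.
  rewrite expr2 {1}/t mulr_suml; apply: eq_bigr => i _.
  by rewrite /t mulr_sumr.
have lhsE : \sum_i \sum_j w i * w j * (\sum_u \sum_v a i u * K u v * a j v) ^+ M =
    \sum_f \sum_g t f * t g * kap f g.
  transitivity (\sum_i \sum_j \sum_(f : F) \sum_(g : F) (w i * \prod_(k < M) a i (f k)) * (w j * \prod_(k < M) a j (g k)) * kap f g).
    apply: eq_bigr => i _; apply: eq_bigr => j _; rewrite powE mulr_sumr.
    apply: eq_bigr => f _.
    rewrite (bigA_distr_bigA (fun k v => a i (f k) * K (f k) v * a j v)) mulr_sumr.
    by apply: eq_bigr => g _; rewrite !big_split/=; rewrite /kap; ring.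
  under eq_bigr do rewrite exchange_big/=.
  rewrite exchange_big/=; apply: eq_bigr => f _.
  under eq_bigr do rewrite exchange_big/=.
  rewrite exchange_big/=; apply: eq_bigr => g _.
  rewrite {1}/t !mulr_suml; apply: eq_bigr => i _.
  by rewrite /t mulr_sumr mulr_suml.
have theta0 : (0 < n)%N -> 0 <= theta.
  by move=> n0; rewrite (le_trans _ (Kr (Ordinal n0)))// sumr_ge0.
have krow (f : F) : \sum_g `|kap f g| <= theta ^+ M.
  under eq_bigr do rewrite normr_prod.
  rewrite -(bigA_distr_bigA (fun k v => `|K (f k) v|)).
  rewrite -[in X in _ <= X](card_ord M) -prodr_const; apply: ler_prod => k _.
  by rewrite sumr_ge0/=.
have kcol (g : F) : \sum_f `|kap f g| <= theta ^+ M.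
  under eq_bigr do rewrite normr_prod.
  rewrite -(bigA_distr_bigA (fun k u => `|K u (g k)|)).
  rewrite -[in X in _ <= X](card_ord M) -prodr_const; apply: ler_prod => k _.
  by rewrite sumr_ge0/=.
rewrite rhsE lhsE (le_trans (ler_norm_sum _ _ _))//.
(* Schur test: [t f * t g] is at most the mean of the two squares, and each half is summed first
   over the index that its square does not involve. *)
rewrite (@le_trans _ _ (\sum_f \sum_g (2^-1 * (t f ^+ 2 * `|kap f g|) + 2^-1 * (t g ^+ 2 * `|kap f g|))))//.
  apply: ler_sum => f _; rewrite (le_trans (ler_norm_sum _ _ _))//; apply: ler_sum => g _.
  rewrite normrM -mulrDr -mulrDl mulrA ler_wpM2r// normrM.
  rewrite -(real_normK (num_real (t f))) -(real_normK (num_real (t g))).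
  by have := sqr_ge0 (`|t f| - `|t g|); lra.
under eq_bigr do rewrite big_split/=.
rewrite big_split/= [X in _ + X]exchange_big/=.
have h1 : \sum_f \sum_g 2^-1 * (t f ^+ 2 * `|kap f g|) <= 2^-1 * (theta ^+ M * \sum_(f : F) t f ^+ 2).
  rewrite mulr_sumr mulr_sumr; apply: ler_sum => f _; rewrite -mulr_sumr ler_wpM2l//.
  by rewrite -mulr_sumr mulrC ler_wpM2r// sqr_ge0.
have h2 : \sum_g \sum_f 2^-1 * (t g ^+ 2 * `|kap f g|) <= 2^-1 * (theta ^+ M * \sum_(f : F) t f ^+ 2).
  rewrite mulr_sumr mulr_sumr; apply: ler_sum => f _; rewrite -mulr_sumr ler_wpM2l//.
  by rewrite -mulr_sumr mulrC ler_wpM2r// sqr_ge0.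
lra.
Qed.

(** Every power in the series of [ch - 1] has degree [M >= 2] and a nonnegative coefficient, so
    [tensor_bound] applies to each degree, and [theta <= 1] allows [theta ^+ M] to be replaced by
    [theta ^+ 2]. *)
Lemma ch_form_bound : 0 <= theta <= 1 ->
  `|\sum_i \sum_j w i * w j * (ch (\sum_u \sum_v a i u * K u v * a j v) - 1)| <=
  theta ^+ 2 * \sum_i \sum_j w i * w j * (ch (\sum_u a i u * a j u) - 1).
Proof.
move=> /andP[t0 t1].
(* Coefficients of the hyperbolic cosine: [1 / M!] for even [M] and 0 for odd [M]. *)
pose e (M : nat) : R := (1 + (-1) ^+ M) / 2 / M`!%:R.
have e0 M : 0 <= e M.
  by rewrite /e -signr_odd; case: odd; rewrite ?expr1 ?expr0 ?subrr ?mul0r.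
have chcv (x : R) : (fun N => \sum_(2 <= M < N.+2) e M * x ^+ M) @ \oo --> ch x - 1.
  have h1 : series (exp_coeff x) N @[N --> \oo] --> expR x.
    exact: is_cvg_series_exp_coeff.
  have h2 : series (exp_coeff (- x)) N @[N --> \oo] --> expR (- x).
    exact: is_cvg_series_exp_coeff.
  have h3 : (series (exp_coeff x) N + series (exp_coeff (- x)) N) / 2 - 1 @[N --> \oo] --> ch x - 1.
    apply: cvgB; last exact: cvg_cst.
    apply: cvgM; last exact: cvg_cst.
    exact: cvgD.
  move: h3; rewrite -(cvg_shiftn 2) => h3.
  rewrite (_ : (fun N => _) = (fun N => (series (exp_coeff x) (N + 2)%N + series (exp_coeff (- x)) (N + 2)%N) / 2 - 1))//.
  apply/funext => N; rewrite addn2 /series/= -big_split/= mulr_suml.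
  rewrite (@big_cat_nat _ _ _ 2 0 N.+2)//= addrAC.
  rewrite (_ : \sum_(0 <= i < 2) _ = 1); last first.
    rewrite big_nat_recl// big_nat1 !exp_coeffE !expr0 !expr1 !factS !fact0 !invr1 !mul1r.
    by field.
  rewrite subrr add0r; apply: eq_bigr => M _.
  by rewrite !exp_coeffE exprNn /e; field; rewrite pnatr_eq0 -lt0n fact_gt0.
pose L N := \sum_i \sum_j w i * w j * (\sum_(2 <= M < N.+2) e M * (\sum_u \sum_v a i u * K u v * a j v) ^+ M).
pose G N := \sum_i \sum_j w i * w j * (\sum_(2 <= M < N.+2) e M * (\sum_u a i u * a j u) ^+ M).
have Lcv : L @ \oo --> \sum_i \sum_j w i * w j * (ch (\sum_u \sum_v a i u * K u v * a j v) - 1).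
  apply: cvg_finsum => i; apply: cvg_finsum => j; apply: cvgMl_tmp; exact: chcv.
have Gcv : G @ \oo --> \sum_i \sum_j w i * w j * (ch (\sum_u a i u * a j u) - 1).
  apply: cvg_finsum => i; apply: cvg_finsum => j; apply: cvgMl_tmp; exact: chcv.
have LG N : `|L N| <= theta ^+ 2 * G N.
  have -> : L N = \sum_(2 <= M < N.+2) e M * \sum_i \sum_j w i * w j * (\sum_u \sum_v a i u * K u v * a j v) ^+ M.
    rewrite /L; under eq_bigr do (under eq_bigr do rewrite mulr_sumr); under eq_bigr do rewrite exchange_big/=.
    rewrite exchange_big/=; apply: eq_bigr => M _; rewrite mulr_sumr; apply: eq_bigr => i _.
    by rewrite mulr_sumr; apply: eq_bigr => j _; rewrite mulrCA.
  have -> : G N = \sum_(2 <= M < N.+2) e M * \sum_i \sum_j w i * w j * (\sum_u a i u * a j u) ^+ M.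
    rewrite /G; under eq_bigr do (under eq_bigr do rewrite mulr_sumr); under eq_bigr do rewrite exchange_big/=.
    rewrite exchange_big/=; apply: eq_bigr => M _; rewrite mulr_sumr; apply: eq_bigr => i _.
    by rewrite mulr_sumr; apply: eq_bigr => j _; rewrite mulrCA.
  rewrite (le_trans (ler_norm_sum _ _ _))// mulr_sumr !big_nat; apply: ler_sum => M /andP[M2 _].
  rewrite normrM ger0_norm// mulrCA ler_wpM2l// (le_trans (tensor_bound M))//.
  have g0 : 0 <= theta ^+ M * \sum_i \sum_j w i * w j * (\sum_u a i u * a j u) ^+ M.
    by rewrite (le_trans _ (tensor_bound M)).
  (* The sign of the form of degree [M] is read off [g0] after division by [theta ^+ M], so
     [theta = 0] is treated apart; there both sides vanish because [M >= 2]. *)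
  have [->|tn] := eqVneq theta 0; first by rewrite !expr0n; case: M M2 {g0} => [|[|M]]//= _; rewrite !mul0r.
  have tp : 0 < theta by rewrite lt_neqAle eq_sym tn.
  rewrite ler_wpM2r//; first by move: g0; rewrite pmulr_rge0// exprn_gt0.
  exact: ler_wiXn2l.
have Gcv2 : (fun N => theta ^+ 2 * G N) @ \oo --> theta ^+ 2 * (\sum_i \sum_j w i * w j * (ch (\sum_u a i u * a j u) - 1)).
  by apply: cvgMl_tmp; exact: Gcv.
exact: (lim_le2 (cvg_norm Lcv) Gcv2 LG).
Qed.
End tensor_bound.

(** * Stationary Gaussian vectors *)

Section stationary.
Context d (T : measurableType d) (R : realType) (P : probability T R).
Local Notation E := (Ex P).
Local Notation Q := (covar P).
Local Notation gmean := (gmean P).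
Variables (H : (T -> R) -> Prop) (gH : gaussian_space P H).
Variables (N : nat) (X : 'I_N -> int -> T -> R) (G : int -> 'M[R]_N).
Hypothesis HX : forall u j, H (X u j).
Hypothesis XG : forall u v j k, Q (X u j) (X v (j + k)) = G k u v.

Definition lin (l : 'rV[R]_N) (j : int) (x : T) : R := \sum_u l 0 u * X u j x.

Definition covform (l : 'rV[R]_N) (k : int) (l' : 'rV[R]_N) : R := (l *m G k *m l'^T) 0 0.

Lemma H_lin l j : H (lin l j).
Proof. by apply: (gs_sum gH) => u; exact: (gs_scale gH). Qed.

Lemma covformE l k l' : covform l k l' = \sum_u \sum_v l 0 u * G k u v * l' 0 v.
Proof.
rewrite /covform mxE exchange_big/=; apply: eq_bigr => v _.
by rewrite !mxE mulr_suml.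
Qed.

Lemma covar_lin l l' j k : Q (lin l j) (lin l' (j + k)) = covform l k l'.
Proof.
have hX u i (a : R) : H (fun x => a * X u i x) by exact: (gs_scale gH).
rewrite covformE /lin (covar_suml gH)//; last exact: H_lin.
apply: eq_bigr => u _; rewrite (covar_sumr gH)//; apply: eq_bigr => v _.
by rewrite (covarZl gH)// (covarZr gH)// XG mulrA mulrAC.
Qed.

Lemma covar_linE l l' i j : Q (lin l i) (lin l' j) = covform l (j - i) l'.
Proof. by rewrite -(covar_lin _ _ i) addrCA subrr addr0. Qed.

Definition mean0 (l : 'rV[R]_N) : R := expR (- (covform l 0 l / 2)).

Lemma gmean_lin l j : gmean (lin l j) = mean0 l.
Proof. by rewrite /gmean /mean0 -(covar_lin _ _ j) addr0. Qed.

Definition gam (k : int) : R := \sum_u \sum_v `|G k u v|.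

Lemma gam_ge0 k : 0 <= gam k.
Proof. by apply: sumr_ge0 => u _; apply: sumr_ge0. Qed.

Lemma G_opp k u v : G (- k) u v = G k v u.
Proof. by rewrite -(XG u v k (- k)) subrr covarC -(XG v u 0 k) add0r. Qed.

Lemma gam_opp k : gam (- k) = gam k.
Proof.
rewrite /gam exchange_big/=; apply: eq_bigr => u _; apply: eq_bigr => v _.
by rewrite G_opp.
Qed.

Lemma covform_le l k l' : `|covform l k l'| <= (\sum_u `|l 0 u|) * gam k * (\sum_u `|l' 0 u|).
Proof.
have lu (q : 'rV[R]_N) u : `|q 0 u| <= \sum_v `|q 0 v|.
  by rewrite (bigD1 u)//= lerDl sumr_ge0.
suff key (A B : R) : (forall u, `|l 0 u| <= A) -> (forall u, `|l' 0 u| <= B) ->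
    `|covform l k l'| <= A * gam k * B by exact: key.
move=> lA lB; rewrite covformE /gam mulr_sumr mulr_suml (le_trans (ler_norm_sum _ _ _))//.
apply: ler_sum => u _; rewrite mulr_sumr mulr_suml (le_trans (ler_norm_sum _ _ _))//.
by apply: ler_sum => v _; rewrite !normrM ler_pM ?mulr_ge0// ler_pM.
Qed.

(* The factor [K] of [G k = B K B^T], where [G 0 = B B^T]; it exists even when [G 0] is
   singular because, by Cauchy-Schwarz, [G k] vanishes on the kernel of [G 0]. *)
Lemma covar_factor : exists (B : 'M[R]_N) (kap : R), [/\ 0 <= kap, G 0 = B *m B^T &
  forall k, exists K : 'M[R]_N, G k = B *m K *m B^T /\ forall u v, `|K u v| <= kap * gam k].
Proof.
have [||B GB] := @cholesky R N (G 0).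
- by apply/matrixP => u v; rewrite mxE -G_opp oppr0.
- by move=> x; rewrite -/(covform x 0 x) -(covar_lin x x 0) addr0; exact: covar_ge0.
pose A := pinvmx B.
have BAB : B *m A *m B = B by rewrite mulmxKpV.
have [al [al0 Aal]] : exists al : R, 0 <= al /\ forall u v, `|A u v| <= al.
  exists (\sum_u \sum_v `|A u v|); split.
    by apply: sumr_ge0 => u _; apply: sumr_ge0.
  move=> u v; rewrite (bigD1 u)//= (bigD1 v)//= -addrA lerDl addr_ge0 ?sumr_ge0// => i _.
  exact: sumr_ge0.
exists B, (al ^+ 2); split; [by rewrite sqr_ge0|by []|move=> k].
exists (A *m G k *m A^T); split; last first.
  move=> u v; rewrite mxE (le_trans (ler_norm_sum _ _ _))//.
  rewrite /gam exchange_big/= mulr_sumr; apply: ler_sum => t _.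
  rewrite normrM mxE [A^T _ _]mxE.
  rewrite (@le_trans _ _ ((\sum_s `|A u s| * `|G k s t|) * al))//.
    rewrite ler_pM//; first by rewrite (le_trans (ler_norm_sum _ _ _))//; apply: ler_sum => s _; rewrite normrM.
  rewrite mulr_sumr mulr_suml; apply: ler_sum => s _.
  by rewrite mulrAC expr2 ler_wpM2r// ler_wpM2r.
(* Since [B A B = B], the rows of [1 - Pi] lie in the kernel of [G 0]; hence [Pi] fixes [G k] from
   both sides, and [A *m G k *m A^T] is a factor. *)
pose Pi := B *m A.
have ker0 (x : 'rV[R]_N) : x *m G 0 = 0 -> forall l j i, Q (lin x j) (lin l i) = 0.
  move=> x0 l j i; apply/eqP; rewrite -sqrf_eq0 -normr_le0 ger0_norm ?sqr_ge0//.
  rewrite (le_trans (covar_CS gH (H_lin _ _) (H_lin _ _)))//.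
  by rewrite [X in X * _]covar_linE subrr /covform x0 mul0mx mxE mul0r.
have rowPi (i : 'I_N) : row i (1%:M - Pi) *m G 0 = 0.
  by rewrite -row_mul mulmxBl mul1mx GB mulmxA BAB subrr row0.
pose e (v : 'I_N) : 'rV[R]_N := delta_mx 0 v.
have G1 : Pi *m G k = G k.
  apply/eqP; rewrite eq_sym -subr_eq0 -{1}[G k]mul1mx -mulmxBl; apply/eqP/matrixP => i v.
  have := ker0 _ (rowPi i) (e v) 0 k; rewrite covar_linE subr0 /covform.
  by rewrite trmx_delta -colE -row_mul !mxE.
have G2 : G k *m Pi^T = G k.
  apply/eqP; rewrite eq_sym -subr_eq0 -{1}[G k]mulmx1 -[X in _ *m X - _]trmx1 -mulmxBr -linearB/=.
  apply/eqP/matrixP => u i.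
  have := ker0 _ (rowPi i) (e u) k 0; rewrite covarC covar_linE subr0 /covform.
  rewrite -rowE => h; rewrite [RHS]mxE -h mxE [RHS]mxE; apply: eq_bigr => v _.
  by rewrite !mxE.
by rewrite -{1}G2 -{1}G1 /Pi trmx_mul !mulmxA.
Qed.

Section polynomial.
Variables (J : finType) (c : J -> R) (l : J -> 'rV[R]_N).

Definition cpoly (j : int) (x : T) : R := \sum_a c a * (cos (lin (l a) j x) - mean0 (l a)).

Let bcos a j : bmf (fun x => cos (lin (l a) j x) - mean0 (l a)).
Proof. by apply: bmfB; [apply: bmf_cos; exact: (gs_meas gH (H_lin _ _))|exact: bmf_cst]. Qed.

Lemma bmf_cpoly j : bmf (cpoly j).
Proof. by apply: bmf_sum => a; exact: bmfZ. Qed.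

Lemma cov_cpoly i j : E (fun x => cpoly i x * cpoly j x) =
  \sum_a \sum_b (c a * mean0 (l a)) * (c b * mean0 (l b)) * (ch (covform (l a) (j - i) (l b)) - 1).
Proof.
transitivity (E (fun x => \sum_a \sum_b c a * c b *
   ((cos (lin (l a) i x) - mean0 (l a)) * (cos (lin (l b) j x) - mean0 (l b))))).
  apply: Ex_ext => x; rewrite mulr_suml; apply: eq_bigr => a _.
  by rewrite mulr_sumr; apply: eq_bigr => b _; ring.
rewrite Ex_sum; last by move=> a; apply: bmf_sum => b; apply: bmfZ; exact: bmfM.
apply: eq_bigr => a _; rewrite Ex_sum; last by move=> b; apply: bmfZ; exact: bmfM.
apply: eq_bigr => b _; rewrite (ExZ P _ (bmfM (bcos a i) (bcos b j))).
rewrite -{1}(gmean_lin (l a) i) -{1}(gmean_lin (l b) j).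
rewrite (Cov_cos gH (H_lin _ _) (H_lin _ _)) covar_linE !gmean_lin.
by ring.
Qed.
End polynomial.

(** One constant serves all sums because a sum enters only through its coefficients and the
    coordinates [l s *m B], while [kap] comes from the factorization of the process. *)
Lemma cov_cpoly_le : exists kap : R, 0 <= kap /\
  forall (J : finType) (c : J -> R) (l : J -> 'rV[R]_N) (i j : int),
  `|E (fun x => cpoly c l i x * cpoly c l j x)| <=
     (kap * gam (j - i)) ^+ 2 * E (fun x => cpoly c l i x ^+ 2).
Proof.
have [B [kap [kap0 GB GK]]] := covar_factor.
(* A row or column of [K] has [N] entries, each at most [kap * gam k], which gives the [theta] of
   the Schur test. *)
exists (N%:R * kap); split; first by rewrite mulr_ge0.
move=> J c l i j; set k := j - i.
have th0 : 0 <= N%:R * kap * gam k by rewrite !mulr_ge0// gam_ge0.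
have EE : E (fun x => cpoly c l i x ^+ 2) =
  \sum_a \sum_b (c a * mean0 (l a)) * (c b * mean0 (l b)) * (ch (covform (l a) 0 (l b)) - 1).
  by rewrite -(subrr i) -cov_cpoly; apply: Ex_ext => x; rewrite expr2.
have EE2 : E (fun x => cpoly c l j x ^+ 2) = E (fun x => cpoly c l i x ^+ 2).
  by rewrite EE -(subrr j) -cov_cpoly; apply: Ex_ext => x; rewrite expr2.
(* A factor above 1 leaves nothing to prove beyond Cauchy-Schwarz and the stationarity of the
   variance; the other case meets the hypothesis [theta <= 1] of [ch_form_bound]. *)
have [th1|th1] := leP (N%:R * kap * gam k) 1; last first.
  have v0 : 0 <= E (fun x => cpoly c l i x ^+ 2) by apply: Ex_ge0 => x; exact: sqr_ge0.
  rewrite (@le_trans _ _ (E (fun x => cpoly c l i x ^+ 2)))//; last first.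
    by rewrite ler_peMl// exprn_ege1// ltW.
  rewrite -(@ler_pXn2r _ 2)// ?nnegrE// real_normK ?num_real//.
  rewrite [leRHS]expr2 -{2}EE2.
  have b1 := bmf_cpoly c l i; have b2 := bmf_cpoly c l j.
  by apply: Ex_CS; [case: b1|case: b2|apply: bmf_itg; exact: bmfX|apply: bmf_itg; exact: bmfX].
rewrite cov_cpoly EE -/k.
have [K [GKE KK]] := GK k.
pose a (s : J) (u : 'I_N) : R := (l s *m B) 0 u.
have f0 s t : covform (l s) 0 (l t) = \sum_u a s u * a t u.
  rewrite /covform GB mulmxA -mulmxA -trmx_mul mxE; apply: eq_bigr => u _.
  by rewrite [X in _ * X]mxE.
have fk s t : covform (l s) k (l t) = \sum_u \sum_v a s u * K u v * a t v.
  rewrite /covform GKE !mulmxA -mulmxA -trmx_mul mxE exchange_big/=; apply: eq_bigr => v _.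
  by rewrite [X in _ * X]mxE mxE mulr_suml.
under eq_bigr do under eq_bigr do rewrite fk.
under [in X in _ <= X]eq_bigr do under eq_bigr do rewrite f0.
have Kle : \sum_(v < N) kap * gam k <= N%:R * kap * gam k.
  by rewrite sumr_const card_ord -[_ *+ N]mulr_natl mulrA.
apply: (@ch_form_bound _ _ _ a (fun s => c s * mean0 (l s))).
- by move=> u; rewrite (le_trans _ Kle)//; apply: ler_sum => v _; exact: KK.
- by move=> u; rewrite (le_trans _ Kle)//; apply: ler_sum => v _; exact: KK.
- by rewrite th0.
Qed.

End stationary.

(** * Sums over lags and convergence rates *)

Section real_sequences.
Context {R : realType}.

(** From a fixed [j], each distance below [n] is attained at most twice. *)
Lemma sum_dist_le (b : int -> R) (n j : nat) : (forall k, b (- k) = b k) ->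
  (forall k, 0 <= b k) -> (j < n)%N ->
  \sum_(l < n) b (l%:Z - j%:Z) <= 2 * \sum_(0 <= k < n) b k%:Z.
Proof.
move=> bN b0 jn.
rewrite -(big_mkord xpredT (fun l => b (l%:Z - j%:Z))).
rewrite (@big_cat_nat _ _ _ j 0 n)//= 1?ltnW// mulr_natl mulr2n lerD//.
- rewrite big_nat_rev/= add0n.
  rewrite (eq_big_nat _ _ (F2 := fun i => b i.+1%:Z)); last first.
    move=> i /andP[_ ij]; rewrite -bN opprB; congr b.
    by rewrite -subzn// -[j%:Z]/(j%:Z) opprB addrCA subrr addr0.
  rewrite -(big_add1 _ _ 0 j.+1 xpredT (fun i => b i%:Z)).
  rewrite [leRHS](@big_cat_nat _ _ _ j.+1 0 n)//= [X in _ <= X + _]big_ltn// -addrA addrCA.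
  by rewrite lerDl addr_ge0// sumr_ge0.
- rewrite -{1}[j]add0n big_addn.
  rewrite [leRHS](@big_cat_nat _ _ _ (n - j) 0 n)//= ?leq_subr//.
  rewrite (eq_big_nat _ _ (F2 := fun i => b i%:Z)); last first.
    by move=> i _; congr b; rewrite PoszD addrK.
  by rewrite lerDl sumr_ge0.
Qed.

Lemma cvg_invsqrt : (fun n => (Num.sqrt (n%:R : R))^-1) @ \oo --> (0 : R).
Proof.
rewrite -(cvg_shiftS _)/=.
have -> : (fun n => (Num.sqrt (n.+1%:R : R))^-1) = (fun n => Num.sqrt (harmonic n)).
  by apply/funext => n; rewrite /harmonic/= sqrtrV.
have h : (fun n => Num.sqrt (harmonic n : R)) @ \oo --> Num.sqrt (0 : R).
  by apply: (cvg_comp (harmonic : nat -> R) Num.sqrt); [exact: cvg_harmonic|exact: sqrt_continuous].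
by rewrite sqrtr0 in h.
Qed.

(** A fixed head is negligible after division by [sqrt n], and Cauchy-Schwarz bounds the tail by
    [sqrt n] times the root of a small tail of the square series. This replaces summability of the
    correlations. *)
Lemma l2_avg (b : nat -> R) (M : R) : (forall k, 0 <= b k) ->
  (forall n, \sum_(0 <= k < n) b k ^+ 2 <= M) ->
  (fun n => (Num.sqrt n%:R)^-1 * \sum_(0 <= k < n) b k) @ \oo --> (0 : R).
Proof.
move=> b0 bM.
pose s n := \sum_(0 <= k < n) b k ^+ 2.
have sS m n : (m <= n)%N -> s n = s m + \sum_(m <= k < n) b k ^+ 2.
  by move=> mn; rewrite /s (@big_cat_nat _ _ _ m).
have snd : nondecreasing_seq s.
  by move=> m n mn; rewrite (sS _ _ mn) lerDl sumr_ge0// => k _; exact: sqr_ge0.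
have scv : cvgn s.
  by apply: nondecreasing_is_cvgn => //; exists M => _ [n _ <-]; exact: bM.
have sle n : s n <= limn s by exact: nondecreasing_cvgn_le.
apply/cvgrPdist_le => e e0.
have e20 : 0 < (e / 2) ^+ 2 by rewrite exprn_gt0// divr_gt0.
have /cvgrPdist_lt/(_ _ e20)[m _ hm] := scv.
have {hm}hm : limn s - s m < (e / 2) ^+ 2.
  by have := hm m (leqnn m); rewrite ger0_norm// subr_ge0 sle.
have c1 : (fun n => (Num.sqrt (n%:R : R))^-1 * \sum_(0 <= k < m) b k) @ \oo --> (0 : R).
  by rewrite -[0 in X in _ --> X](mul0r (\sum_(0 <= k < m) b k)); apply: cvgMr_tmp; exact: cvg_invsqrt.
have e2 : 0 < e / 2 by rewrite divr_gt0.
have /cvgrPdist_le/(_ _ e2) [m' _ hm'] := c1.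
exists (maxn m m').+1 => // n /=; rewrite gtn_max => /andP[mn m'n].
have n0 : (0 < n)%N by rewrite (leq_ltn_trans _ mn).
have sn0 : 0 < Num.sqrt (n%:R : R) by rewrite sqrtr_gt0 ltr0n.
rewrite sub0r normrN ger0_norm; last by rewrite mulr_ge0 ?invr_ge0 ?sqrtr_ge0 ?sumr_ge0.
rewrite (@big_cat_nat _ _ _ m 0 n)//= 1?ltnW// mulrDr (splitr e) lerD//.
  by have := hm' n (ltnW m'n); rewrite sub0r normrN; apply: le_trans; exact: ler_norm.
rewrite mulrC ler_pdivrMr//.
set q := Num.sqrt n%:R.
have q2 : q * q = n%:R by rewrite -expr2 sqr_sqrtr.
(* Cauchy-Schwarz in arithmetic-geometric form; the weights are balanced so that each half sums to
   at most half of [e / 2 * q]. *)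
rewrite (@le_trans _ _ (\sum_(m <= k < n) 2^-1 * (e / 2 / q + q / (e / 2) * b k ^+ 2)))//.
  apply: ler_sum => k _.
  have := sqr_ge0 (e / 2 / q - b k).
  have -> : 2^-1 * (e / 2 / q + q / (e / 2) * b k ^+ 2) = b k + 2^-1 * (q / (e / 2)) * (e / 2 / q - b k) ^+ 2.
    by field; rewrite !gt_eqF.
  by move=> h; rewrite lerDl mulr_ge0// mulr_ge0// divr_ge0// ltW.
rewrite -mulr_sumr big_split/=.
rewrite [X in _ * (_ + X)](_ : _ = q / (e / 2) * \sum_(m <= k < n) b k ^+ 2); last by rewrite mulr_sumr.
have h1 : \sum_(m <= k < n) b k ^+ 2 <= (e / 2) ^+ 2.
  by have := sS _ _ (ltnW mn); have := sle n; lra.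
have h2 : \sum_(m <= k < n) e / 2 / q <= e / 2 * q.
  rewrite sumr_const_nat -[_ *+ _]mulr_natl (@le_trans _ _ (n%:R * (e / 2 / q)))//.
    by rewrite ler_wpM2r ?ler_nat ?leq_subr// divr_ge0// ltW.
  by rewrite -q2 le_eqVlt; apply/orP; left; apply/eqP; field; rewrite gt_eqF.
have h3 : q / (e / 2) * \sum_(m <= k < n) b k ^+ 2 <= e / 2 * q.
  rewrite (@le_trans _ _ (q / (e / 2) * (e / 2) ^+ 2))//.
    by rewrite ler_wpM2l// divr_ge0// ltW.
  by rewrite le_eqVlt; apply/orP; left; apply/eqP; field; rewrite gt_eqF.
lra.
Qed.

(** With coefficients [c1 / sqrt n] and [n * p] terms, the powers of [n] cancel up to a factor
    [1 / sqrt n] or [b n / sqrt n]. The index is moved to [n + 1] to make [sqrt n] invertible. *)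
Lemma clt_eps_cvg (c1 D B2 : R) (b : nat -> R) (p : nat) (tau : R) :
  (fun n => (Num.sqrt n%:R)^-1 * b n) @ \oo --> (0 : R) ->
  (fun n => clt_eps ((Num.sqrt n%:R)^-1 * c1) D B2 (b n) (n * p) tau) @ \oo --> (0 : R).
Proof.
move=> bcv; rewrite -(cvg_shiftS _)/=.
pose u n : R := (Num.sqrt n.+1%:R)^-1.
pose v n : R := u n * b n.+1.
have ucv : u @ \oo --> (0 : R) by have := cvg_invsqrt; rewrite -(cvg_shiftS _).
have vcv : v @ \oo --> (0 : R) by have := bcv; rewrite -(cvg_shiftS _).
set K := expR D.
have u2 n : u n ^+ 2 * n.+1%:R = 1.
  by rewrite /u exprVn sqr_sqrtr// mulVf// pnatr_eq0.
have u0 n : 0 <= u n by rewrite invr_ge0 sqrtr_ge0.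
have eE n : clt_eps (u n * c1) D B2 (b n.+1) (n.+1 * p) tau =
   p%:R * c1 ^+ 3 * tau ^+ 2 * (u n * ((K * B2) ^+ 2) + K ^+ 3 * B2 * v n * expR (tau * c1 * K * v n)) +
   tau * (u n * Num.sqrt (p%:R * (c1 ^+ 4 * (K * B2) ^+ 3))).
  rewrite /clt_eps -/K natrM; congr (_ + _ * _).
    rewrite (_ : tau * (u n * c1 * K * b n.+1) = tau * c1 * K * v n); last by rewrite /v; ring.
    rewrite /v; move: (expR _) => e; move: (u2 n); set un := u n; set bn := b n.+1 => h.
    transitivity ((un ^+ 2 * n.+1%:R) * (p%:R * c1 ^+ 3 * tau ^+ 2 * (un * ((K * B2) ^+ 2) + K ^+ 3 * B2 * (un * bn) * e))); last by rewrite h mul1r.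
    by ring.
  rewrite -[u n in RHS]ger0_norm// -sqrtr_sqr -sqrtrM ?sqr_ge0//; congr Num.sqrt.
  move: (u2 n); set un := u n => h.
  transitivity ((un ^+ 2 * n.+1%:R) * (un ^+ 2 * (p%:R * (c1 ^+ 4 * (K * B2) ^+ 3)))); last by rewrite h mul1r.
  by ring.
under eq_fun do rewrite eE.
have key : (fun n => p%:R * c1 ^+ 3 * tau ^+ 2 * (u n * ((K * B2) ^+ 2) + K ^+ 3 * B2 * v n * expR (tau * c1 * K * v n)) +
   tau * (u n * Num.sqrt (p%:R * (c1 ^+ 4 * (K * B2) ^+ 3)))) @ \oo -->
   p%:R * c1 ^+ 3 * tau ^+ 2 * (0 * ((K * B2) ^+ 2) + K ^+ 3 * B2 * 0 * expR (tau * c1 * K * 0)) +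
   tau * (0 * Num.sqrt (p%:R * (c1 ^+ 4 * (K * B2) ^+ 3))).
  apply: cvgD.
    apply: cvgMl_tmp; apply: cvgD; first exact: cvgMr_tmp.
    apply: cvgM; first exact: cvgMl_tmp.
    apply: (cvg_comp (fun n => tau * c1 * K * v n) expR); last exact: continuous_expR.
    exact: cvgMl_tmp.
  by apply: cvgMl_tmp; exact: cvgMr_tmp.
by move: key; rewrite !(mulr0, mul0r, addr0).
Qed.

End real_sequences.

Lemma dist_triangle3 (R : realDomainType) (a b c d : R) :
  `|a - d| <= `|a - b| + `|b - c| + `|c - d|.
Proof. by rewrite (le_trans (ler_distD c _ _))// lerD2r ler_distD. Qed.

Lemma lim_uniq (R : realType) (u : nat -> R) (l k : R) :
  u @ \oo --> l -> u @ \oo --> k -> l = k.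
Proof.
move=> ul uk; apply/eqP; rewrite eq_le.
by rewrite (lim_le2 ul uk)// (lim_le2 uk ul).
Qed.

(** * Central limit theorem for bounded pointwise limits of cosine sums *)

Section stationary_clt.
Context d (T : measurableType d) (R : realType) (P : probability T R).
Local Notation E := (Ex P).
Variables (H : (T -> R) -> Prop) (gH : gaussian_space P H).
Variables (N : nat) (X : 'I_N -> int -> T -> R) (G : int -> 'M[R]_N).
Hypothesis HX : forall u j, H (X u j).
Hypothesis XG : forall u v j k, covar P (X u j) (X v (j + k)) = G k u v.
Variable (M : R).
Hypothesis gamM : forall n, \sum_(0 <= k < n) gam G k%:Z ^+ 2 <= M.

Local Notation lin := (lin X).
Local Notation mean0 := (mean0 G).
Local Notation tp := (seq (R * 'rV[R]_N)).

(** Cosine sums are lists of coefficients and forms, so that a difference of two of them is a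
    concatenation, again a cosine sum; [cs] and [ls] recover the indexed families used before. *)
Definition evalp (s : tp) (j : int) (x : T) : R := \sum_(p <- s) p.1 * cos (lin p.2 j x).
Definition meanp (s : tp) : R := \sum_(p <- s) p.1 * mean0 p.2.
Definition cevalp (s : tp) (j : int) (x : T) : R := evalp s j x - meanp s.
Definition negp (s : tp) : tp := [seq (- p.1, p.2) | p <- s].

Let cs (s : tp) (a : 'I_(size s)) : R := (nth (0, 0) s a).1.
Let ls (s : tp) (a : 'I_(size s)) : 'rV[R]_N := (nth (0, 0) s a).2.

Let cevalpE s j x : cevalp s j x = cpoly X G (@cs s) (@ls s) j x.
Proof.
rewrite /cevalp /evalp /meanp -sumrB (big_nth (0, 0)) big_mkord /cpoly.
by apply: eq_bigr => a _; rewrite mulrBr.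
Qed.

Let bmf_cevalp s j : bmf (cevalp s j).
Proof.
rewrite (_ : cevalp s j = cpoly X G (@cs s) (@ls s) j); last first.
  by apply/funext => x; exact: cevalpE.
exact: (bmf_cpoly gH G HX).
Qed.

Let mlin l j : measurable_fun setT (lin l j).
Proof. exact: (gs_meas gH (H_lin gH HX l j)). Qed.

Let bmf_evalp s j : bmf (evalp s j).
Proof. by apply: bmf_sum => p; apply: bmfZ; exact: bmf_cos. Qed.

Let Ex_evalp s j : E (evalp s j) = meanp s.
Proof.
rewrite Ex_sum; last by move=> p; apply: bmfZ; exact: bmf_cos.
apply: eq_bigr => p _; rewrite ExZ; last exact: bmf_cos.
by rewrite (Ex_cos gH (H_lin gH HX _ _)) (gmean_lin gH HX XG).
Qed.

Let cevalpB s t j x : cevalp (s ++ negp t) j x = cevalp s j x - cevalp t j x.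
Proof.
have e1 : evalp (negp t) j x = - evalp t j x.
  rewrite /evalp /negp big_map/= -sumrN; apply: eq_bigr => p _; exact: mulNr.
have e2 : meanp (negp t) = - meanp t.
  rewrite /meanp /negp big_map/= -sumrN; apply: eq_bigr => p _; exact: mulNr.
rewrite /cevalp {1}/evalp {1}/meanp !big_cat/= -/(evalp s j x) -/(meanp s).
by rewrite -/(evalp (negp t) j x) -/(meanp (negp t)) e1 e2; ring.
Qed.

Let cov_cevalp_shift s i j a :
  E (fun x => cevalp s i x * cevalp s j x) = E (fun x => cevalp s (i + a) x * cevalp s (j + a) x).
Proof.
transitivity (E (fun x => cpoly X G (@cs s) (@ls s) i x * cpoly X G (@cs s) (@ls s) j x)).
  by apply: Ex_ext => x; rewrite !cevalpE.
transitivity (E (fun x => cpoly X G (@cs s) (@ls s) (i + a) x * cpoly X G (@cs s) (@ls s) (j + a) x)); last first.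
  by apply: Ex_ext => x; rewrite !cevalpE.
rewrite !(cov_cpoly gH HX XG); apply: eq_bigr => u _; apply: eq_bigr => v _.
by rewrite (_ : j + a - (i + a) = j - i)// opprD addrACA subrr addr0.
Qed.

Let gam_nat (k : int) : gam G k = gam G `|k|%N.
Proof. by case: k => n//; rewrite NegzE (gam_opp XG). Qed.

Let gam_le k : gam G k <= 1 + M.
Proof.
rewrite gam_nat; set n := `|k|%N.
have h := gamM n.+1; rewrite big_nat_recr//= in h.
have h2 : 0 <= \sum_(0 <= i < n) gam G i%:Z ^+ 2 by apply: sumr_ge0 => i _; exact: sqr_ge0.
by have := sqr_ge0 (gam G n - 1); have := gam_ge0 G n; nra.
Qed.

Let M0 : 0 <= M. Proof. by have := gamM 0; rewrite big_geq. Qed.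

Let gam_sum2 (n : nat) (j : 'I_n) : \sum_(l < n) gam G (l%:Z - j%:Z) ^+ 2 <= 2 * M.
Proof.
have h := @sum_dist_le R (fun k => gam G k ^+ 2) n j.
rewrite (le_trans (h _ _ _))//.
- by move=> k; rewrite (gam_opp XG).
- by move=> k; exact: sqr_ge0.
- by rewrite ler_wpM2l.
Qed.

Let dist_shift (l j : nat) : (l.+1%:Z - j.+1%:Z)%R = l%:Z - j%:Z.
Proof. by rewrite !intS opprD addrACA subrr add0r. Qed.

Definition nsum (F : int -> T -> R) (n : nat) (x : T) : R :=
  (Num.sqrt n%:R)^-1 * \sum_(j < n) F j.+1%:Z x.

Lemma bmf_nsum F n : (forall j, bmf (F j)) -> bmf (nsum F n).
Proof. by move=> h; apply: bmfZ; apply: bmf_sum. Qed.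

Let nsqrt (n : nat) : (Num.sqrt n.+1%:R)^-1 ^+ 2 * n.+1%:R = 1 :> R.
Proof. by rewrite exprVn sqr_sqrtr// mulVf// pnatr_eq0. Qed.

Let Ex_nsum2 F n : (forall j, bmf (F j)) ->
  E (fun x => nsum F n x ^+ 2) = (Num.sqrt n%:R)^-1 ^+ 2 *
   \sum_(i < n) \sum_(j < n) E (fun x => F i.+1%:Z x * F j.+1%:Z x).
Proof.
move=> bF; transitivity (E (fun x => (Num.sqrt n%:R)^-1 ^+ 2 *
    \sum_(i < n) \sum_(j < n) (F i.+1%:Z x * F j.+1%:Z x))).
  apply: Ex_ext => x; rewrite /nsum exprMn; congr (_ * _); rewrite expr2 mulr_suml.
  by apply: eq_bigr => i _; rewrite mulr_sumr.
rewrite ExZ; last by apply: bmf_sum => i; apply: bmf_sum => j; exact: bmfM.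
congr (_ * _); rewrite Ex_sum; last by move=> i; apply: bmf_sum => j; exact: bmfM.
by apply: eq_bigr => i _; rewrite Ex_sum// => j; exact: bmfM.
Qed.

Let sum_ordc (m : nat) (k : R) : \sum_(i < m) k = m%:R * k.
Proof. by rewrite sumr_const card_ord mulr_natl. Qed.

Lemma evalp_clt (s : tp) (tau th : R) : 0 <= tau ->
  (fun n => E (fun x => cos (tau * nsum (cevalp s) n x + th)) -
     cos th * expR (- (E (fun x => nsum (cevalp s) n x ^+ 2) * tau ^+ 2 / 2))) @ \oo --> (0 : R).
Proof.
move=> tau0.
pose C1 := \sum_(a < size s) `|cs a|.
pose ell := \sum_(a < size s) \sum_u `|ls a 0 u|.
have csC a : `|@cs s a| <= C1 by rewrite /C1 (bigD1 a)//= lerDl sumr_ge0.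
have C10 : 0 <= C1 by apply: sumr_ge0.
have lsl a : \sum_u `|@ls s a 0 u| <= ell.
  by rewrite /ell (bigD1 a)//= lerDl sumr_ge0// => b _; apply: sumr_ge0.
have ell0 : 0 <= ell by apply: sumr_ge0 => a _; apply: sumr_ge0.
have formle a b k : `|covform G (@ls s a) k (@ls s b)| <= ell ^+ 2 * gam G k.
  rewrite (le_trans (covform_le G _ _ _))// expr2 mulrAC ler_wpM2r ?gam_ge0//.
  by rewrite ler_pM ?sumr_ge0.
(* [ell] bounds the l1 norms of the forms, so covariances at lag [k] are at most
   [ell ^+ 2 * gam G k]. [D] uses [gam <= 1 + M]; in [B2] and [b1] the factor 2 accounts for lags of
   both signs and [size s] for the number of terms at each time. *)
pose D := ell ^+ 2 * (1 + M).
pose B2 := (size s)%:R * (ell ^+ 4 * (2 * M)).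
pose b1 n := (size s)%:R * ell ^+ 2 * 2 * \sum_(0 <= k < n) gam G k%:Z.
have b1cv : (fun n => (Num.sqrt n%:R)^-1 * b1 n) @ \oo --> (0 : R).
  rewrite -[0 in X in _ --> X](mulr0 ((size s)%:R * ell ^+ 2 * 2)).
  under eq_fun do rewrite /b1 mulrCA.
  by apply: cvgMl_tmp; apply: (l2_avg _ gamM) => k; exact: gam_ge0.
have ecv := clt_eps_cvg C1 D B2 (size s) tau b1cv.
have main n : `|E (fun x => cos (tau * nsum (cevalp s) n x + th)) -
     cos th * expR (- (E (fun x => nsum (cevalp s) n x ^+ 2) * tau ^+ 2 / 2))| <=
     tau * clt_eps ((Num.sqrt n%:R)^-1 * C1) D B2 (b1 n) (n * size s) tau.
  pose I := ('I_n * 'I_(size s))%type.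
  pose c (i : I) := (Num.sqrt n%:R)^-1 * @cs s i.2.
  pose w (i : I) := lin (@ls s i.2) i.1.+1%:Z.
  have Hw i : H (w i) by exact: (H_lin gH HX).
  have QE i j : covar P (w i) (w j) = covform G (@ls s i.2) (j.1%:Z - i.1%:Z) (@ls s j.2).
    by rewrite /w (covar_linE gH HX XG) dist_shift.
  have Sn x : nsum (cevalp s) n x = centS P c w x.
    rewrite /nsum /centS; under eq_bigr do rewrite cevalpE.
    rewrite mulr_sumr; under eq_bigr do rewrite /cpoly mulr_sumr.
    rewrite pair_big/=; apply: eq_bigr => -[j a] _.
    by rewrite /c /w/= (gmean_lin gH HX XG) mulrA.
  have isq : 0 <= (Num.sqrt n%:R)^-1 :> R by rewrite invr_ge0 sqrtr_ge0.
  have := @trig_clt d T R P H gH I c w Hw ((Num.sqrt n%:R)^-1 * C1) D B2 (b1 n) _ _ _ _ _ _ tau th tau0.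
  rewrite card_prod !card_ord => h.
  under Ex_ext do rewrite Sn.
  under [X in expR (- (X * _ / _))]Ex_ext do rewrite Sn.
  apply: h.
  - by move=> i; rewrite normrM (ger0_norm isq) ler_wpM2l.
  - move=> i j; rewrite QE (le_trans (formle _ _ _))// ler_wpM2l ?sqr_ge0//.
  - move=> i; under eq_bigr do rewrite QE.
    rewrite -(pair_big xpredT xpredT (fun (j : 'I_n) (a : 'I_(size s)) => covform G (@ls s i.2) (j%:Z - i.1%:Z) (@ls s a) ^+ 2))/=.
    rewrite (@le_trans _ _ (\sum_(j < n) (size s)%:R * (ell ^+ 4 * gam G (j%:Z - i.1%:Z) ^+ 2)))//.
      apply: ler_sum => j _; rewrite -sum_ordc.
      apply: ler_sum => a _; rewrite -real_normK ?num_real// (_ : 4%N = (2 * 2)%N)// exprM -exprMn.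
      by rewrite lerXn2r ?nnegrE// mulr_ge0 ?sqr_ge0// gam_ge0.
    by rewrite -mulr_sumr ler_wpM2l// -mulr_sumr ler_wpM2l ?exprn_ge0.
  - move=> i; under eq_bigr do rewrite QE.
    rewrite -(pair_big xpredT xpredT (fun (j : 'I_n) (a : 'I_(size s)) => `|covform G (@ls s i.2) (j%:Z - i.1%:Z) (@ls s a)|))/=.
    rewrite (@le_trans _ _ (\sum_(j < n) (size s)%:R * (ell ^+ 2 * gam G (j%:Z - i.1%:Z))))//.
      apply: ler_sum => j _; rewrite -sum_ordc.
      by apply: ler_sum => a _.
    rewrite -mulr_sumr -mulr_sumr /b1 -!mulrA ler_wpM2l// ler_wpM2l// ler_wpM2l//.
    by apply: (@sum_dist_le _ (gam G) n i.1) => // k; [exact: (gam_opp XG)|exact: gam_ge0].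
  - exact: mulr_ge0.
  - by rewrite /B2 mulr_ge0// mulr_ge0 ?exprn_ge0// mulr_ge0.
apply: norm_cvg0.
apply: (@squeeze_cvgr _ _ _ _ (cst 0) (fun n => tau * clt_eps ((Num.sqrt n%:R)^-1 * C1) D B2 (b1 n) (n * size s) tau)).
- by apply: nearW => n; rewrite /= normr_ge0 main.
- exact: cvg_cst.
- by rewrite -[0 in X in _ --> X](mulr0 tau); exact: cvgMl_tmp.
Qed.

Variables (f : int -> T -> R) (S : nat -> tp).
Hypothesis mf : forall j, measurable_fun setT (f j).
Hypothesis S1 : forall m j x, `|evalp (S m) j x| <= 1.
Hypothesis Sf : forall j x, (fun m => evalp (S m) j x) @ \oo --> f j x.

Let f1 j x : `|f j x| <= 1.
Proof.
have h : (fun m => `|evalp (S m) j x|) @ \oo --> `|f j x| by apply: cvg_norm; exact: Sf.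
by apply: (lim_le h) => m; exact: S1.
Qed.

Let bf j : bmf (f j). Proof. exact: (bmf_bound (mf j) (f1 j)). Qed.

Let p : R := E (f 0).

Let meanp_cvg j : (fun m => meanp (S m)) @ \oo --> E (f j).
Proof.
have h : (fun m => E (evalp (S m) j)) @ \oo --> E (f j).
  by apply: (@Ex_cvg _ _ _ P _ _ 1) => // m; case: (bmf_evalp (S m) j).
by under eq_fun do rewrite -(Ex_evalp _ j).
Qed.

Lemma Ex_stationary j : E (f j) = p.
Proof. by apply: (@lim_uniq R (fun m => meanp (S m))); exact: meanp_cvg. Qed.

Definition fbar j (x : T) : R := f j x - E (f 0).

Let bfbar j : bmf (fbar j). Proof. by apply: bmfB => //; exact: bmf_cst. Qed.

Let D (s : tp) j (x : T) : R := fbar j x - cevalp s j x.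

Let bD s j : bmf (D s j). Proof. exact: bmfB. Qed.

(** The error [D s] with [f] replaced by its approximation [S m]: a genuine cosine sum, to which
    [cov_cpoly_le] applies. *)
Let Dm (s : tp) m j (x : T) : R := cevalp (S m ++ negp s) j x.

Let Dm_cvg s j x : (fun m => Dm s m j x) @ \oo --> D s j x.
Proof.
under eq_fun do rewrite /Dm cevalpB.
apply: cvgB; last exact: cvg_cst.
apply: cvgB; first exact: Sf.
exact: meanp_cvg.
Qed.

Let mean_le1 m : `|meanp (S m)| <= 1.
Proof. by rewrite -(Ex_evalp _ 0); apply: Ex_norm_le. Qed.

Let DmDm_cvg s i j : (fun m => E (fun x => Dm s m i x * Dm s m j x)) @ \oo --> E (fun x => D s i x * D s j x).
Proof.
have [K hK] : exists K, forall m (k : int) x, k \in [:: i; j] -> `|Dm s m k x| <= K.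
  have [_ [K1 h1]] := bmf_cevalp s i; have [_ [K2 h2]] := bmf_cevalp s j.
  exists (2 + (`|K1| + `|K2|)) => m k x kij; rewrite /Dm cevalpB (le_trans (ler_normB _ _))// lerD//.
    by rewrite (le_trans (ler_normB _ _))// lerD.
  move: kij; rewrite !inE => /orP[] /eqP->.
    by rewrite (le_trans (h1 x))// (le_trans (ler_norm _))// lerDl.
  by rewrite (le_trans (h2 x))// (le_trans (ler_norm _))// lerDr.
apply: (@Ex_cvg _ _ _ P _ _ (K * K)).
- move=> m; rewrite /Dm; apply: measurable_funM; last by case: (bmf_cevalp (S m ++ negp s) j).
  by case: (bmf_cevalp (S m ++ negp s) i).
- by apply: measurable_funM; [case: (bD s i)|case: (bD s j)].
- by move=> m x; rewrite normrM ler_pM// hK// !inE eqxx ?orbT.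
- by move=> x; apply: cvgM; exact: Dm_cvg.
Qed.

Lemma D_shift s i j a : E (fun x => D s i x * D s j x) = E (fun x => D s (i + a) x * D s (j + a) x).
Proof.
apply: (@lim_uniq R (fun m => E (fun x => Dm s m i x * Dm s m j x))); first exact: DmDm_cvg.
rewrite (_ : (fun m => _) = (fun m => E (fun x => Dm s m (i + a) x * Dm s m (j + a) x))); first exact: DmDm_cvg.
by apply/funext => m; exact: cov_cevalp_shift.
Qed.

(** The constant for [Dm] does not depend on [m], so the covariance bound survives the limit in [m]
    and holds for errors that are no longer cosine sums. *)
Lemma D_cov : exists kap : R, 0 <= kap /\ forall s i j,
  `|E (fun x => D s i x * D s j x)| <= (kap * gam G (j - i)) ^+ 2 * E (fun x => D s 0 x ^+ 2).
Proof.
have [kap [kap0 h]] := cov_cpoly_le gH HX XG.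
exists kap; split => // s i j.
have -> : E (fun x => D s 0 x ^+ 2) = E (fun x => D s i x * D s i x).
  by rewrite -[i]add0r -D_shift; apply: Ex_ext => x; rewrite expr2.
have c2 : (fun m => (kap * gam G (j - i)) ^+ 2 * E (fun x => Dm s m i x * Dm s m i x)) @ \oo -->
    (kap * gam G (j - i)) ^+ 2 * E (fun x => D s i x * D s i x).
  by apply: cvgMl_tmp; exact: DmDm_cvg.
have c1 : (fun m => `|E (fun x => Dm s m i x * Dm s m j x)|) @ \oo --> `|E (fun x => D s i x * D s j x)|.
  by apply: cvg_norm; exact: DmDm_cvg.
apply: (lim_le2 c1 c2) => m.
have := h _ (@cs (S m ++ negp s)) (@ls (S m ++ negp s)) i j.
under [X in `|X|]Ex_ext do rewrite -!cevalpE.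
by under [X in _ * X]Ex_ext do rewrite expr2 -!cevalpE.
Qed.

(** The squares of [gam] summed over both signs of the lag are at most [2 * M], so the normalized
    sum has, for all [n] at once, at most a fixed multiple of the variance of one term. *)
Let nsum_D_le : exists C : R, 0 <= C /\ forall s n,
  E (fun x => nsum (D s) n x ^+ 2) <= C * E (fun x => D s 0 x ^+ 2).
Proof.
have [kap [kap0 h]] := D_cov.
exists (kap ^+ 2 * (2 * M)); split; first by rewrite mulr_ge0 ?sqr_ge0// mulr_ge0.
move=> s [|n].
  rewrite Ex_nsum2// big_ord0 mulr0 mulr_ge0//; first by rewrite mulr_ge0 ?sqr_ge0// mulr_ge0.
  by apply: Ex_ge0 => x; exact: sqr_ge0.
have v0 : 0 <= E (fun x => D s 0 x ^+ 2) by apply: Ex_ge0 => x; exact: sqr_ge0.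
rewrite Ex_nsum2// (_ : kap ^+ 2 * (2 * M) * _ = (Num.sqrt n.+1%:R)^-1 ^+ 2 *
  (n.+1%:R * (kap ^+ 2 * (2 * M) * E (fun x => D s 0 x ^+ 2)))); last by rewrite [RHS]mulrA nsqrt mul1r.
rewrite ler_wpM2l ?sqr_ge0//.
rewrite -sum_ordc; apply: ler_sum => i _.
rewrite (le_trans (ler_norm _))// (le_trans (ler_norm_sum _ _ _))//.
rewrite (@le_trans _ _ (\sum_(j < n.+1) (kap ^+ 2 * gam G (j%:Z - i%:Z) ^+ 2) * E (fun x => D s 0 x ^+ 2)))//.
  by apply: ler_sum => j _; rewrite -exprMn -dist_shift.
by rewrite -mulr_suml ler_wpM2r// -mulr_sumr ler_wpM2l ?sqr_ge0.
Qed.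

Let v_cvg : (fun m => E (fun x => D (S m) 0 x ^+ 2)) @ \oo --> (0 : R).
Proof.
rewrite -[0 in X in _ --> X](Ex_cst P).
apply: (@Ex_cvg _ _ _ P _ _ (4 ^+ 2)).
- by move=> m; apply: measurable_funX; case: (bD (S m) 0).
- by [].
- move=> m x; rewrite normrX lerXn2r ?nnegrE//.
  rewrite /D /fbar /cevalp (le_trans (ler_normB _ _))// (_ : 4 = 2 + 2); last by rewrite -natrD.
  rewrite lerD// (le_trans (ler_normB _ _))// (_ : 2 = 1 + 1)// lerD//.
  exact: Ex_norm_le.
- move=> x; rewrite (_ : 0 = (fbar 0 x - fbar 0 x) ^+ 2); last by rewrite subrr expr0n.
  apply: (cvg_comp (fun m => D (S m) 0 x) (fun y : R => y ^+ 2)); last exact: exprn_continuous.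
  apply: cvgB; first exact: cvg_cst.
  by apply: cvgB; [exact: Sf|exact: meanp_cvg].
Qed.

Definition autocov (k : int) : R := E (fun x => fbar 0 x * fbar k x).

(** The empty sum makes [fbar] a case of [D], so stationarity and covariance bounds need no second
    proof. *)
Let fbarE j : fbar j = D [::] j.
Proof.
by apply/funext => x; rewrite /D /cevalp /evalp /meanp !big_nil subrr subr0.
Qed.

Lemma autocovE i j : E (fun x => fbar i x * fbar j x) = autocov (j - i).
Proof. by rewrite /autocov !fbarE (D_shift _ i j (- i)) subrr. Qed.

Lemma autocov_opp k : autocov (- k) = autocov k.
Proof. by rewrite -[k in LHS]subr0 opprB -autocovE /autocov; apply: Ex_ext => x; rewrite mulrC. Qed.

Definition autocov_sum (n : nat) : R := autocov 0 + 2 * \sum_(0 <= k < n) autocov k.+1%:Z.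

Lemma autocov_sum_cvg : cvgn autocov_sum.
Proof.
have [kap [kap0 h]] := D_cov.
pose v := E (fun x => fbar 0 x ^+ 2).
have v0 : 0 <= v by apply: Ex_ge0 => x; exact: sqr_ge0.
have acle (k : nat) : `|autocov k.+1%:Z| <= kap ^+ 2 * v * gam G k.+1%:Z ^+ 2.
  by have := h [::] 0 k.+1%:Z; rewrite -!fbarE subr0 exprMn mulrAC -/v.
have scv : cvgn (series (fun k => autocov k.+1%:Z)).
  apply: normed_cvg; apply: (@series_le_cvg _ _ (fun k => kap ^+ 2 * v * gam G k.+1%:Z ^+ 2)).
  - by move=> n; exact: normr_ge0.
  - by move=> n; rewrite mulr_ge0 ?sqr_ge0// mulr_ge0 ?sqr_ge0.
  - exact: acle.
  - apply: nondecreasing_is_cvgn.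
      apply: nondecreasing_series => k _ _; rewrite mulr_ge0 ?sqr_ge0// mulr_ge0 ?sqr_ge0//.
    exists (kap ^+ 2 * v * M) => _ [n _ <-]; rewrite /series/= -mulr_sumr ler_wpM2l//.
      by rewrite mulr_ge0 ?sqr_ge0.
    rewrite (le_trans _ (gamM n.+1))// [leRHS]big_nat_recl//= lerDr; exact: sqr_ge0.
apply: is_cvgD; first exact: is_cvg_cst.
apply: is_cvgM; first exact: is_cvg_cst.
exact: scv.
Qed.

Definition sigma2 : R := limn autocov_sum.

(** Going from [n] to [n + 1] adds one row and one column, together [autocov_sum n]. The variance of
    the normalized sum is therefore a Cesaro mean of [autocov_sum]. *)
Let Esum n : \sum_(i < n) \sum_(j < n) autocov (j%:Z - i%:Z) = \sum_(0 <= k < n) autocov_sum k.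
Proof.
elim: n => [|n ih]; first by rewrite big_ord0 big_geq.
rewrite big_ord_recr/= big_nat_recr//= -ih.
under eq_bigr do rewrite big_ord_recr/=.
rewrite big_split/= -addrA; congr (_ + _).
rewrite big_ord_recr/= subrr /autocov_sum.
have e1 : \sum_(i < n) autocov (n%:Z - i%:Z) = \sum_(0 <= k < n) autocov k.+1%:Z.
  rewrite -(big_mkord xpredT (fun i => autocov (n%:Z - i%:Z))) big_nat_rev/= add0n.
  apply: eq_big_nat => i /andP[_ iltn]; congr autocov.
  by rewrite -subzn// opprB addrCA subrr addr0.
have e2 : \sum_(i < n) autocov (i%:Z - n%:Z) = \sum_(0 <= k < n) autocov k.+1%:Z.
  by rewrite -e1; apply: eq_bigr => i _; rewrite -autocov_opp opprB.
by rewrite e1 e2; ring.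
Qed.

Lemma nsum_var_cvg : (fun n => E (fun x => nsum fbar n x ^+ 2)) @ \oo --> sigma2.
Proof.
rewrite -(cvg_shiftS _)/=.
have := cesaro autocov_sum_cvg.
rewrite -/sigma2; apply: cvg_trans; apply: near_eq_cvg; apply: nearW => n.
rewrite Ex_nsum2//; under eq_bigr do under eq_bigr do rewrite autocovE dist_shift.
by rewrite Esum exprVn sqr_sqrtr// /arithmetic_mean /harmonic/=.
Qed.

Lemma sigma2_ge0 : 0 <= sigma2.
Proof.
have h0 : (fun _ : nat => 0 : R) @ \oo --> (0 : R) by exact: cvg_cst.
by apply: (lim_le2 h0 nsum_var_cvg) => n; apply: Ex_ge0 => x; exact: sqr_ge0.
Qed.

Lemma nsum_var_bounded : exists C, forall n, E (fun x => nsum fbar n x ^+ 2) <= C.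
Proof.
have [C [C0 h]] := nsum_D_le.
exists (C * E (fun x => D [::] 0 x ^+ 2)) => n.
by have := h [::] n; rewrite (_ : D [::] = fbar)//; apply/funext => j; rewrite fbarE.
Qed.

Lemma stationary_clt (tau th : R) : 0 <= tau ->
  (fun n => E (fun x => cos (tau * nsum fbar n x + th))) @ \oo -->
    cos th * expR (- (sigma2 * tau ^+ 2 / 2)).
Proof.
move=> tau0.
have [C [C0 hC]] := nsum_D_le.
have [V hV] := nsum_var_bounded.
pose vm m := E (fun x => D (S m) 0 x ^+ 2).
have vm0 m : 0 <= vm m by apply: Ex_ge0 => x; exact: sqr_ge0.
pose phi n := E (fun x => cos (tau * nsum fbar n x + th)).
pose s2 n := E (fun x => nsum fbar n x ^+ 2).
pose phim m n := E (fun x => cos (tau * nsum (cevalp (S m)) n x + th)).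
pose s2m m n := E (fun x => nsum (cevalp (S m)) n x ^+ 2).
have s20 n : 0 <= s2 n by apply: Ex_ge0 => x; exact: sqr_ge0.
have s2m0 m n : 0 <= s2m m n by apply: Ex_ge0 => x; exact: sqr_ge0.
have V0 : 0 <= V by exact: le_trans (s20 0%N) (hV 0%N).
have nD m n x : nsum fbar n x - nsum (cevalp (S m)) n x = nsum (D (S m)) n x.
  by rewrite /nsum -mulrBr -sumrB.
have bn1 n : bmf (nsum fbar n) by exact: bmf_nsum.
have bn2 m n : bmf (nsum (cevalp (S m)) n) by exact: bmf_nsum.
have bn3 m n : bmf (nsum (D (S m)) n) by exact: bmf_nsum.
have bcos g : bmf g -> bmf (fun x => cos (tau * g x + th)).
  by move=> [mg _]; apply: bmf_cos; apply: measurable_funD => //; exact: measurable_funM.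
have EabsD m n : E (fun x => `|nsum (D (S m)) n x|) <= Num.sqrt (C * vm m).
  rewrite -[leLHS]ger0_norm; last by apply: Ex_ge0.
  rewrite -sqrtr_sqr ler_wsqrtr// (le_trans (Ex_sqr_le P (bmf_abs (bn3 m n))))//.
  rewrite (le_trans _ (hC (S m) n))// le_eqVlt; apply/orP; left; apply/eqP.
  by apply: Ex_ext => x; rewrite real_normK ?num_real.
have dphi m n : `|phi n - phim m n| <= tau * Num.sqrt (C * vm m).
  rewrite /phi /phim -ExB; [|exact: bcos|exact: bcos].
  rewrite (le_trans (Ex_norm P _))//; first by apply: bmfB; exact: bcos.
  rewrite (@le_trans _ _ (E (fun x => tau * `|nsum (D (S m)) n x|)))//.
    apply: Ex_le.
    - by apply: bmf_abs; apply: bmfB; exact: bcos.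
    - by apply: bmfZ; exact: bmf_abs.
    - move=> x; rewrite (le_trans (cos_lip _ _))// -nD opprD addrACA subrr addr0 -mulrBr.
      by rewrite normrM ger0_norm.
  by rewrite ExZ ?ler_wpM2l//; exact: bmf_abs.
have ds2 m n : `|s2 n - s2m m n| <= Num.sqrt (C * vm m) * (2 * Num.sqrt V) + C * vm m.
  have bnn : bmf (fun x => nsum (D (S m)) n x * nsum fbar n x) by exact: bmfM.
  have -> : s2 n - s2m m n = 2 * E (fun x => nsum (D (S m)) n x * nsum fbar n x) -
      E (fun x => nsum (D (S m)) n x ^+ 2).
    rewrite /s2 /s2m -ExB; [|exact: bmfX|exact: bmfX].
    rewrite -ExZ// -ExB; [|exact: bmfZ|exact: bmfX].
    apply: Ex_ext => x; rewrite -nD; ring.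
  rewrite (le_trans (ler_normB _ _))// lerD//; last first.
    by rewrite ger0_norm ?hC//; apply: Ex_ge0 => x; exact: sqr_ge0.
  rewrite normrM (ger0_norm (_ : 0 <= 2))// mulrCA ler_wpM2l// -sqrtrM ?mulr_ge0//.
  rewrite -sqrtr_sqr ler_wsqrtr//.
  have [m1 _] := bn3 m n; have [m2 _] := bn1 n.
  rewrite (le_trans (Ex_CS m1 m2 _ _))//; [by apply: bmf_itg; exact: bmfX|by apply: bmf_itg; exact: bmfX|].
  by rewrite ler_pM//; apply: Ex_ge0 => x; exact: sqr_ge0.
pose target s := cos th * expR (- (s * tau ^+ 2 / 2)).
have tlip s s' : 0 <= s -> 0 <= s' -> `|target s - target s'| <= tau ^+ 2 / 2 * `|s - s'|.
  move=> h h'; rewrite /target -mulrBr normrM -[leRHS]mul1r ler_pM// ?cos_max//.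
  rewrite (le_trans (expR_lip _ _))// ?divr_ge0 ?mulr_ge0 ?sqr_ge0//.
  rewrite -mulrBl -mulrBl normrM normrM (ger0_norm (sqr_ge0 _)) (ger0_norm (_ : 0 <= 2^-1))// mulrAC -mulrA mulrC.
  by rewrite (mulrC 2^-1).
pose err m := tau * Num.sqrt (C * vm m) + tau ^+ 2 / 2 * (Num.sqrt (C * vm m) * (2 * Num.sqrt V) + C * vm m).
have errcv : err @ \oo --> (0 : R).
  have cv1 : (fun m => C * vm m) @ \oo --> (0 : R).
    by rewrite -[0 in X in _ --> X](mulr0 C); apply: cvgMl_tmp; exact: v_cvg.
  have cv2 : (fun m => Num.sqrt (C * vm m)) @ \oo --> (0 : R).
    have h : (fun m => Num.sqrt (C * vm m)) @ \oo --> Num.sqrt (0 : R).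
      by apply: (cvg_comp (fun m => C * vm m) Num.sqrt); [exact: cv1|exact: sqrt_continuous].
    by rewrite sqrtr0 in h.
  have h : err @ \oo --> tau * 0 + tau ^+ 2 / 2 * (0 * (2 * Num.sqrt V) + 0).
    apply: cvgD; first exact: cvgMl_tmp.
    by apply: cvgMl_tmp; apply: cvgD => //; exact: cvgMr_tmp.
  by move: h; rewrite !(mulr0, mul0r, addr0).
(* [phi n] is compared with the Gaussian value at the variance [s2 n] of the same [n]. One fixed
   [m0] then suffices, and no limit variance is needed for the approximating sums. *)
have goal0 : (fun n => phi n - target (s2 n)) @ \oo --> (0 : R).
  apply/cvgrPdist_le => e e0.
  have e2 : 0 < e / 2 by rewrite divr_gt0.
  have /cvgrPdist_le/(_ _ e2)[m0 _ /(_ m0 (leqnn _))] := errcv.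
  rewrite sub0r normrN => hm.
  have hm' : err m0 <= e / 2 by rewrite (le_trans (ler_norm _)).
  have /cvgrPdist_le/(_ _ e2)[n0 _ hn] := evalp_clt (S m0) th tau0.
  exists n0 => // n nn0; have h1 : `|phim m0 n - target (s2m m0 n)| <= e / 2.
    by move: (hn n nn0); rewrite -normrN opprB subr0.
  rewrite -normrN opprB subr0.
  have h2 := tlip _ _ (s2m0 m0 n) (s20 n); rewrite [in leRHS]distrC in h2.
  have h3 : tau ^+ 2 / 2 * `|s2 n - s2m m0 n| <= tau ^+ 2 / 2 * (Num.sqrt (C * vm m0) * (2 * Num.sqrt V) + C * vm m0).
    by rewrite ler_wpM2l// divr_ge0 ?sqr_ge0.
  have h4 := lerD (dphi m0 n) (le_trans h2 h3).
  have h5 : `|phi n - target (s2 n)| <= `|phi n - phim m0 n| + `|phim m0 n - target (s2m m0 n)| +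
      `|target (s2m m0 n) - target (s2 n)| by exact: dist_triangle3.
  by rewrite (le_trans h5)// addrAC [leRHS]splitr lerD// (le_trans h4).
have tcv : (fun n => target (s2 n)) @ \oo --> target sigma2.
  apply: cvgM; first exact: cvg_cst.
  apply: (cvg_comp (fun n => - (s2 n * tau ^+ 2 / 2)) expR); last exact: continuous_expR.
  apply: cvgN; apply: cvgM; last exact: cvg_cst.
  by apply: cvgM; [exact: nsum_var_cvg|exact: cvg_cst].
have h : (fun n => (phi n - target (s2 n)) + target (s2 n)) @ \oo --> 0 + target sigma2 by exact: cvgD.
rewrite add0r in h; rewrite (_ : (fun n => _) = fun n => (phi n - target (s2 n)) + target (s2 n))//.
by apply/funext => n; rewrite subrK.
Qed.
End stationary_clt.

(** * Trigonometric approximation of the sign *)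

Section sign_approximation.
Context (R : realType).
Implicit Types x y z : R.

(** The fixed points 1 and -1 attract (the derivative vanishes there) and 0 repels. Being an odd
    polynomial, it maps sine sums to sine sums. *)
Definition qsgn y : R := (3 * y - y ^+ 3) / 2.

Lemma qsgn_opp y : qsgn (- y) = - qsgn y.
Proof. by rewrite /qsgn; ring. Qed.

Lemma iter_qsgn_opp n y : iter n qsgn (- y) = - iter n qsgn y.
Proof. by elim: n => //= n ->; rewrite qsgn_opp. Qed.

Lemma qsgn_bounds y : 0 < y -> y <= 1 -> 0 < qsgn y /\ qsgn y <= 1.
Proof.
move=> y0 y1; split.
  rewrite /qsgn (_ : _ / 2 = y * (3 - y ^+ 2) / 2); last by ring.
  rewrite divr_gt0// mulr_gt0//; nra.
rewrite -subr_ge0 /qsgn (_ : 1 - _ = (1 - y) ^+ 2 * (2 + y) / 2); last by field.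
by rewrite divr_ge0// mulr_ge0 ?sqr_ge0//; lra.
Qed.

Lemma iter_qsgn_bounds n y : 0 < y -> y <= 1 -> 0 < iter n qsgn y /\ iter n qsgn y <= 1.
Proof. by move=> y0 y1; elim: n => //= n [h1 h2]; exact: qsgn_bounds. Qed.

(* [1 / q y - 1 <= (2 / 3) (1 / y - 1)], with denominators cleared *)
Lemma qsgn_contract y : 0 < y -> y <= 1 -> (1 - qsgn y) * y <= 2 / 3 * ((1 - y) * qsgn y).
Proof.
move=> y0 y1; rewrite -subr_ge0 /qsgn.
rewrite (_ : _ - _ = (1 - y) * (y * (3 * y + y ^+ 2)) / 6); last by field.
rewrite divr_ge0// mulr_ge0 ?subr_ge0// mulr_ge0 ?ltW// addr_gt0 ?mulr_gt0// exprn_gt0//.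
Qed.

Lemma iter_qsgn_contract n y : 0 < y -> y <= 1 ->
  (1 - iter n qsgn y) * y <= (2 / 3) ^+ n * ((1 - y) * iter n qsgn y).
Proof.
move=> y0 y1; elim: n => [|n ih]; first by rewrite expr0 mul1r.
have [] := iter_qsgn_bounds n y0 y1; have [] := iter_qsgn_bounds n.+1 y0 y1.
move: ih => /=; move: (iter n qsgn y) => w ih q0 q1 w0 w1.
rewrite -(ler_pM2r w0) exprS; have := qsgn_contract w0 w1.
move: ih q0 q1; move: ((2 / 3) ^+ n) (qsgn w) => c q ih q0 q1 h.
rewrite (@le_trans _ _ (2 / 3 * ((1 - w) * q) * y))//; first by rewrite mulrAC ler_wpM2r// ltW.
rewrite (_ : _ * y = 2 / 3 * q * ((1 - w) * y)); last by ring.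
rewrite (_ : _ * w = 2 / 3 * q * (c * ((1 - y) * w))); last by ring.
by rewrite ler_wpM2l// mulr_ge0// ltW.
Qed.

Lemma iter_qsgn_ge n y : 0 < y -> y <= 1 -> 1 - (2 / 3) ^+ n / y <= iter n qsgn y.
Proof.
move=> y0 y1; have [h0 h1] := iter_qsgn_bounds n y0 y1.
rewrite lerBlDr -lerBlDl ler_pdivlMr// (le_trans (iter_qsgn_contract n y0 y1))//.
have c0 : 0 <= (2 / 3) ^+ n :> R by rewrite exprn_ge0.
rewrite -[leRHS]mulr1 ler_wpM2l// -[leRHS]mulr1 ler_pM// ?subr_ge0//; first exact: ltW.
by rewrite lerBlDr lerDl ltW.
Qed.

Lemma iter_qsgn_norm n y : `|y| <= 1 -> `|iter n qsgn y| <= 1.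
Proof.
move=> y1.
have pos z : 0 < z -> z <= 1 -> `|iter n qsgn z| <= 1.
  by move=> z0 z1; have [h0 h1] := iter_qsgn_bounds n z0 z1; rewrite ger0_norm// ltW.
have [y0|y0|->] := ltgtP y 0.
- rewrite -normrN in y1.
  by rewrite -normrN -iter_qsgn_opp pos ?oppr_gt0// (le_trans (ler_norm _)).
- by rewrite pos// (le_trans (ler_norm _)).
- suff -> : iter n qsgn 0 = 0 by rewrite normr0.
  by elim: n {pos} => //= n ->; rewrite /qsgn; ring.
Qed.

(** From [cos w >= 1 - w^2] one gets [sin z >= z - z^3 / 3]. *)
Lemma sin_ge_half z : 0 <= z -> z <= 1 -> z / 2 <= sin z.
Proof.
move=> z0 z1.
have d (w : R) : is_derive w 1 (fun w => sin w - w + 3^-1 * w ^+ 3) (cos w - 1 + w ^+ 2).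
  apply: (drv_eq (drv_add (drv_sub (drv_sin (drv_id w)) (drv_id w)) (drv_mull 3^-1 (drv_pow 2 w)))).
  by rewrite mulr1 mulrA mulVf// mul1r.
have h : 0 <= sin z - z + 3^-1 * z ^+ 3.
  suff : sin 0 - 0 + 3^-1 * 0 ^+ 3 <= sin z - z + 3^-1 * z ^+ 3 by rewrite sin0 expr0n/= mulr0 subr0 addr0.
  apply: (drv_ge0_le d) => // w _.
  have := cos_taylor1 0 w; rewrite add0r cos0 sin0 mulr0 addr0 ler_norml => /andP[+ _].
  by rewrite -subr_ge0 opprK.
have h2 : z ^+ 3 <= z.
  by rewrite exprS -[leRHS]mulr1 ler_wpM2l// expr_le1.
lra.
Qed.

(** The division by [m.+1] eventually puts any [x] where the sine has its sign. The sine is then of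
    size at least [|x| / (2 (m + 1))], and the rate [(2 / 3) ^+ m] of the iteration absorbs that
    loss. *)
Definition sgn_approx (m : nat) x : R := iter m qsgn (sin (x / m.+1%:R)).

Lemma sgn_approx_norm m x : `|sgn_approx m x| <= 1.
Proof. by apply: iter_qsgn_norm; rewrite ler_norml sin_geN1 sin_le1. Qed.

Lemma sgn_approx_cvg x : (fun m => sgn_approx m x) @ \oo --> Num.sg x.
Proof.
have pos y : 0 < y -> (fun m => sgn_approx m y) @ \oo --> (1 : R).
  move=> y0.
  have c0 : (fun m => 1 - m.+1%:R * (2 / 3 : R) ^+ m * (2 / y)) @ \oo --> (1 : R).
    rewrite -[1 in X in _ --> X](subr0 1) -[0 in X in _ --> X](mul0r (2 / y)).
    apply: cvgB; first exact: cvg_cst.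
    apply: cvgMr_tmp.
    (* Bernoulli gives [(4 / 3)^m >= 1 + m / 3], which trades the linear factor for a slower
       geometric rate: [8 / 9 = 4 / 3 * 2 / 3]. *)
    have le98 m : m.+1%:R * (2 / 3 : R) ^+ m <= 3 * (8 / 9) ^+ m.
      have h : 1 + m%:R / 3 <= (4 / 3 : R) ^+ m.
        elim: m => [|m ih]; first by rewrite mul0r addr0 expr0.
        rewrite exprS -natr1; have : 0 <= m%:R :> R by []; move: ih.
        by move: (_ ^+ m) m%:R => u v; lra.
      rewrite (_ : 8 / 9 = 4 / 3 * (2 / 3) :> R); last by field.
      rewrite (exprMn m (4 / 3)) mulrA ler_wpM2r ?exprn_ge0//.
      by rewrite -natr1; move: h; move: (_ ^+ m) m%:R (ler0n R m) => u v; lra.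
    apply: (@squeeze_cvgr _ _ _ _ (cst 0) (fun m => 3 * (8 / 9 : R) ^+ m)).
    - by apply: nearW => m; rewrite le98 andbT mulr_ge0 ?exprn_ge0.
    - exact: cvg_cst.
    - by apply: (@cvg_geometric R); rewrite ger0_norm//; lra.
  apply: (@squeeze_cvgr _ _ _ _ (fun m => 1 - m.+1%:R * (2 / 3 : R) ^+ m * (2 / y)) (cst 1)) => //; last exact: cvg_cst.
  near=> m.
  have ym : y <= m.+1%:R 
    by rewrite (@le_trans _ _ m%:R) ?ler_nat//; near: m; exact: nbhs_infty_ger.
  rewrite /sgn_approx.
  have z0 : 0 < y / m.+1%:R by rewrite divr_gt0.
  have z1 : y / m.+1%:R <= 1 by rewrite ler_pdivrMr// mul1r.
  have s0 := sin_ge_half (ltW z0) z1.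
  have s1 : 0 < sin (y / m.+1%:R) by rewrite (lt_le_trans _ s0)// divr_gt0.
  have [h0 h1] := iter_qsgn_bounds m s1 (sin_le1 _).
  rewrite [X in _ && X]h1 andbT (le_trans _ (iter_qsgn_ge m s1 (sin_le1 _)))//.
  rewrite lerD2l lerN2 -[leRHS]mulrA [leRHS]mulrCA ler_wpM2l ?exprn_ge0//.
  rewrite -[leRHS]invrK lef_pV2 ?posrE// ?invr_gt0 ?mulr_gt0// ?invr_gt0//.
  rewrite (le_trans _ s0)// le_eqVlt (_ : _ == _)//; apply/eqP; field.
  by rewrite nat1r pnatr_eq0 lt0r_neq0.
have [x0|x0|->] := ltgtP x 0.
- rewrite ltr0_sg// (_ : (fun m => _) = (fun m => - sgn_approx m (- x))).
    by apply: cvgN; apply: pos; rewrite oppr_gt0.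
  by apply/funext => m; rewrite /sgn_approx mulNr sinN iter_qsgn_opp opprK.
- by rewrite gtr0_sg//; exact: pos.
- rewrite sgr0 (_ : (fun m => _) = fun=> 0); first exact: cvg_cst.
  apply/funext => m; rewrite /sgn_approx mul0r sin0; elim: m => //= n ->.
  by rewrite /qsgn; ring.
Unshelve. all: by end_near. Qed.
End sign_approximation.

Section trigonometric_sums.
Context (R : realType) (V : lmodType R) (W : Type) (ev : V -> W -> R).
Hypothesis evD : forall u v w, ev (u + v) w = ev u w + ev v w.
Hypothesis evZ : forall a u w, ev (a *: u) w = a * ev u w.

(** One list serves all [w]. With [w = (j, x)] this yields the same coefficients at every time [j];
    with [w] real it yields trigonometric sums of one variable. *)
Definition cos_sum f := exists s : seq (R * V), forall w, f w = \sum_(p <- s) p.1 * cos (ev p.2 w).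
Definition sin_sum f := exists s : seq (R * V), forall w, f w = \sum_(p <- s) p.1 * sin (ev p.2 w).

Let evB u v w : ev (u - v) w = ev u w - ev v w.
Proof. by rewrite -scaleN1r evD evZ mulN1r. Qed.

Lemma cos_sum_ext f g : f =1 g -> cos_sum f -> cos_sum g.
Proof. by move=> fg [s h]; exists s => w; rewrite -fg. Qed.

Lemma sin_sum_ext f g : f =1 g -> sin_sum f -> sin_sum g.
Proof. by move=> fg [s h]; exists s => w; rewrite -fg. Qed.

Lemma cos_sum1 v : cos_sum (fun w => cos (ev v w)).
Proof. by exists [:: (1, v)] => w; rewrite big_seq1 mul1r. Qed.

Lemma sin_sum1 v : sin_sum (fun w => sin (ev v w)).
Proof. by exists [:: (1, v)] => w; rewrite big_seq1 mul1r. Qed.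

Lemma cos_sumD f g : cos_sum f -> cos_sum g -> cos_sum (fun w => f w + g w).
Proof. by move=> [s hs] [t ht]; exists (s ++ t) => w; rewrite big_cat/= -hs -ht. Qed.

Lemma sin_sumD f g : sin_sum f -> sin_sum g -> sin_sum (fun w => f w + g w).
Proof. by move=> [s hs] [t ht]; exists (s ++ t) => w; rewrite big_cat/= -hs -ht. Qed.

Lemma cos_sumZ a f : cos_sum f -> cos_sum (fun w => a * f w).
Proof.
move=> [s hs]; exists [seq (a * p.1, p.2) | p <- s] => w.
by rewrite big_map hs mulr_sumr; apply: eq_bigr => p _; rewrite mulrA.
Qed.

Lemma sin_sumZ a f : sin_sum f -> sin_sum (fun w => a * f w).
Proof.
move=> [s hs]; exists [seq (a * p.1, p.2) | p <- s] => w.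
by rewrite big_map hs mulr_sumr; apply: eq_bigr => p _; rewrite mulrA.
Qed.

Lemma cos_sum_cst a : cos_sum (fun=> a).
Proof.
exists [:: (a, 0)] => w; rewrite big_seq1/= (_ : ev 0 w = 0) ?cos0 ?mulr1//.
by have := evZ 0 0 w; rewrite mul0r scale0r.
Qed.

Lemma cos_sum_bigop (I : Type) (s : seq I) (f : I -> W -> R) :
  (forall i, cos_sum (f i)) -> cos_sum (fun w => \sum_(i <- s) f i w).
Proof.
move=> hf; elim: s => [|i s ih].
  by apply: cos_sum_ext (cos_sum_cst 0) => w; rewrite big_nil.
by apply: cos_sum_ext (cos_sumD (hf i) ih) => w; rewrite big_cons.
Qed.

Lemma sin_sum_bigop (I : Type) (s : seq I) (f : I -> W -> R) :
  (forall i, sin_sum (f i)) -> sin_sum (fun w => \sum_(i <- s) f i w).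
Proof.
move=> hf; elim: s => [|i s ih]; first by exists [::] => w; rewrite !big_nil.
by apply: sin_sum_ext (sin_sumD (hf i) ih) => w; rewrite big_cons.
Qed.

Lemma cos_sum_cosM f g : cos_sum f -> cos_sum g -> cos_sum (fun w => f w * g w).
Proof.
move=> [s hs] [t ht].
have h (p q : R * V) : cos_sum (fun w => p.1 * cos (ev p.2 w) * (q.1 * cos (ev q.2 w))).
  apply: cos_sum_ext (cos_sumZ (p.1 * q.1 / 2) (cos_sumD (cos_sum1 (p.2 - q.2)) (cos_sum1 (p.2 + q.2)))) => w.
  by rewrite evB evD cosB cosD; field.
apply: cos_sum_ext (cos_sum_bigop s (fun p => cos_sum_bigop t (h p))) => w.
by rewrite hs ht mulr_suml; apply: eq_bigr => p _; rewrite mulr_sumr.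
Qed.

Lemma sin_sum_sinM f g : sin_sum f -> sin_sum g -> cos_sum (fun w => f w * g w).
Proof.
move=> [s hs] [t ht].
have h (p q : R * V) : cos_sum (fun w => p.1 * sin (ev p.2 w) * (q.1 * sin (ev q.2 w))).
  apply: cos_sum_ext (cos_sumZ (p.1 * q.1 / 2) (cos_sumD (cos_sum1 (p.2 - q.2))
    (cos_sumZ (-1) (cos_sum1 (p.2 + q.2))))) => w.
  by rewrite evB evD cosB cosD; field.
apply: cos_sum_ext (cos_sum_bigop s (fun p => cos_sum_bigop t (h p))) => w.
by rewrite hs ht mulr_suml; apply: eq_bigr => p _; rewrite mulr_sumr.
Qed.

Lemma cos_sum_sinM f g : cos_sum f -> sin_sum g -> sin_sum (fun w => f w * g w).
Proof.
move=> [s hs] [t ht].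
have h (p q : R * V) : sin_sum (fun w => p.1 * cos (ev p.2 w) * (q.1 * sin (ev q.2 w))).
  apply: sin_sum_ext (sin_sumZ (p.1 * q.1 / 2) (sin_sumD (sin_sum1 (q.2 - p.2)) (sin_sum1 (q.2 + p.2)))) => w.
  by rewrite evB evD sinB sinD; field.
apply: sin_sum_ext (sin_sum_bigop s (fun p => sin_sum_bigop t (h p))) => w.
by rewrite hs ht mulr_suml; apply: eq_bigr => p _; rewrite mulr_sumr.
Qed.

Lemma sin_sum_qsgn f : sin_sum f -> sin_sum (fun w => qsgn (f w)).
Proof.
move=> sf; apply: sin_sum_ext (sin_sumD (sin_sumZ (3 / 2) sf)
  (sin_sumZ (- 2^-1) (cos_sum_sinM (sin_sum_sinM sf sf) sf))) => w.
by rewrite /qsgn; field.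
Qed.

Lemma sin_sum_iter_qsgn f n : sin_sum f -> sin_sum (fun w => iter n (@qsgn R) (f w)).
Proof. by move=> sf; elim: n => //= n ih; exact: sin_sum_qsgn ih. Qed.

Lemma sin_sum_sgn_approx m v : sin_sum (fun w => sgn_approx m (ev v w)).
Proof.
apply: sin_sum_iter_qsgn; apply: sin_sum_ext (sin_sum1 (m.+1%:R^-1 *: v)) => w.
by rewrite evZ mulrC.
Qed.

Lemma cos_sum_prod (I : Type) (s : seq I) (P : pred I) (f : I -> W -> R) :
  (forall i, cos_sum (f i)) -> cos_sum (fun w => \prod_(i <- s | P i) f i w).
Proof.
move=> hf; elim: s => [|i s ih].
  by apply: cos_sum_ext (cos_sum_cst 1) => w; rewrite big_nil.
case Pi : (P i); last by apply: cos_sum_ext ih => w; rewrite big_cons Pi.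
by apply: cos_sum_ext (cos_sum_cosM (hf i) ih) => w; rewrite big_cons Pi.
Qed.
End trigonometric_sums.

(** * Continuity theorem *)

Section indicators.
Context d (T : measurableType d) (R : realType) (P : probability T R).

Let boolE (b : T -> bool) : (fun x => (b x)%:R : R) = \1_[set x | b x].
Proof. by apply/funext => x; rewrite indicE mem_setE. Qed.

Lemma bmf_bool (b : T -> bool) : measurable [set x | b x] -> bmf (fun x => (b x)%:R : R).
Proof.
move=> mb; apply: (@bmf_bound _ _ _ _ 1); first by rewrite boolE; exact: measurable_indic.
by move=> x; case: (b x); rewrite ?normr1 ?normr0.
Qed.

Lemma Ex_bool (b : T -> bool) : measurable [set x | b x] ->
  Ex P (fun x => (b x)%:R) = fine (P [set x | b x]).
Proof. by move=> mb; rewrite boolE /Ex /Rintegral integral_indic// setIT. Qed.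

Lemma measurable_le_cst (g : T -> R) u : measurable_fun setT g -> measurable [set x | g x <= u].
Proof.
move=> mg; rewrite (_ : [set _ | _] = g @^-1` [set` `]-oo, u]]); last first.
  by apply/seteqP; split => x /=; rewrite in_itv.
by rewrite -[X in measurable X]setTI; apply: mg.
Qed.

Lemma measurable_gt_cst (g : T -> R) u : measurable_fun setT g -> measurable [set x | u < g x].
Proof.
move=> mg; rewrite (_ : [set _ | _] = g @^-1` [set` `]u, +oo[]); last first.
  by apply/seteqP; split => x /=; rewrite in_itv/= andbT.
by rewrite -[X in measurable X]setTI; apply: mg.
Qed.

Lemma chebyshev_bool (g : T -> R) (M : R) : 0 < M -> bmf g ->
  Ex P (fun x => (M < `|g x|)%R%:R) <= Ex P (fun x => g x ^+ 2) / M ^+ 2.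
Proof.
move=> M0 bg; have [mg _] := bmf_abs bg.
rewrite mulrC -ExZ; last exact: bmfX.
apply: Ex_le; [by apply: bmf_bool; exact: measurable_gt_cst|by apply: bmfZ; exact: bmfX|].
move=> x; case: ltP => h /=; last by rewrite mulr_ge0 ?sqr_ge0// invr_ge0 sqr_ge0.
rewrite mulrC ler_pdivlMr ?exprn_gt0// mul1r -[leRHS]real_normK ?num_real//.
by rewrite lerXn2r// ?nnegrE ltW.
Qed.

Lemma tail_small (g : T -> R) (e : R) : 0 < e -> measurable_fun setT g ->
  exists M : R, 0 < M /\ forall M' : R, M <= M' -> Ex P (fun x => (M' < `|g x|)%R%:R) <= e.
Proof.
move=> e0 mg; have mag : measurable_fun setT (fun x => `|g x|) by exact: measurableT_comp.
have h : (fun n => Ex P (fun x => (n%:R < `|g x|)%R%:R)) @ \oo --> (0 : R).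
  rewrite -[0 in X in _ --> X](Ex_cst P 0); apply: (@Ex_cvg _ _ _ _ _ _ 1).
  - by move=> n; case: (bmf_bool (measurable_gt_cst n%:R mag)).
  - exact: measurable_cst.
  - by move=> n x; case: (_ < _); rewrite ?normr1 ?normr0.
  - move=> x; apply/cvgrPdist_le => e' e'0; near=> n.
    have hn : `|g x| <= n%:R by near: n; exact: nbhs_infty_ger.
    by rewrite ltNge hn subrr normr0 ltW.
have /cvgrPdist_le/(_ _ e0)[n _ /(_ n.+1 (leqnSn n))] := h.
rewrite sub0r normrN => hn; exists n.+1%:R; split => // M' nM.
rewrite (le_trans _ (le_trans (ler_norm _) hn))//; apply: Ex_le.
- by apply: bmf_bool; exact: measurable_gt_cst.
- by apply: bmf_bool; exact: measurable_gt_cst.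
- by move=> x; rewrite ler_nat; case: ltP => //= /(le_lt_trans nM) ->.
Unshelve. all: by end_near. Qed.
End indicators.

Section trigonometric_step.
Context (R : realType).

(** A pair of a frequency and a phase; the phase makes sines count as cosine sums. *)
Definition affine_ev (v : (R^o * R^o)%type) (z : R) : R := v.1 * z + v.2.

Let evD u v z : affine_ev (u + v) z = affine_ev u z + affine_ev v z.
Proof. by rewrite /affine_ev/=; ring. Qed.

Let evZ a u z : affine_ev (a *: u) z = a * affine_ev u z.
Proof. by rewrite /affine_ev/= /GRing.scale/=; ring. Qed.

(** The approximate sign of [sin ((z - c) / M)], rescaled to decrease from 1 to 0 across [c].
    Periodicity spoils it only at distance above [M], where the bound [0 <= f <= 1] is all that is
    needed. *)
Lemma trigonometric_step (c del eta M : R) : 0 < del -> 0 < eta -> 0 < M ->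
  exists f, [/\ cos_sum affine_ev f, forall z, 0 <= f z <= 1,
    forall z, `|z - c| <= M -> c + del <= z -> f z <= eta &
    forall z, `|z - c| <= M -> z <= c - del -> 1 - eta <= f z].
Proof.
move=> d0 e0 M0.
(* By [sin_ge_half], a lower bound for the sine at distance at least [del] from [c]. *)
pose w := del / M / 2.
have w0 : 0 < w by rewrite !divr_gt0.
have [K hK] : exists K, (2 / 3 : R) ^+ K / w <= eta.
  have h : (fun K => (w^-1 * (2 / 3 : R) ^+ K)) @ \oo --> (0 : R).
    by apply: (@cvg_geometric R); rewrite ger0_norm//; lra.
  have /cvgrPdist_le/(_ _ e0)[K _ /(_ K (leqnn K))] := h.
  by rewrite sub0r normrN => hK; exists K; rewrite mulrC (le_trans (ler_norm _)).
pose f z := 2^-1 + (- 2^-1) * iter K (@qsgn R) (sin (M^-1 * z - M^-1 * c)).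
have bnd z : `|iter K (@qsgn R) (sin z)| <= 1.
  by apply: iter_qsgn_norm; rewrite ler_norml sin_geN1 sin_le1.
have low z : del <= z -> z <= M -> 1 - eta <= iter K (@qsgn R) (sin (M^-1 * z)).
  move=> dz zM.
  have z0 : 0 <= M^-1 * z by rewrite mulr_ge0 ?invr_ge0 ?ltW// (lt_le_trans d0).
  have z1 : M^-1 * z <= 1 by rewrite mulrC ler_pdivrMr// mul1r.
  have ws : w <= sin (M^-1 * z).
    rewrite (le_trans _ (sin_ge_half z0 z1))// /w ler_pM2r// mulrC ler_pM2l// invr_gt0//.
  have s0 := lt_le_trans w0 ws.
  rewrite (le_trans _ (iter_qsgn_ge K s0 (sin_le1 _)))// lerD2l lerN2 (le_trans _ hK)//.
  by rewrite ler_wpM2l ?exprn_ge0// lef_pV2.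
exists f; split.
- have q g n : cos_sum affine_ev g -> cos_sum affine_ev (fun z => iter n (@qsgn R) (g z)).
    move=> sg; elim: n => //= n ih.
    apply: cos_sum_ext (cos_sumD (cos_sumZ (3 / 2) ih) (cos_sumZ (- 2^-1)
      (cos_sum_cosM evD evZ (cos_sum_cosM evD evZ ih ih) ih))) => z.
    by rewrite /qsgn; field.
  apply: cos_sumD; first exact: (cos_sum_cst evZ).
  apply: cos_sumZ; apply: q.
  (* The phase [- pi / 2] writes the sine as a cosine. *)
  apply: cos_sum_ext (cos_sum1 affine_ev (M^-1, - (M^-1 * c) - pi / 2)) => z.
  by rewrite /affine_ev/= addrA cosBpihalf.
- by move=> z; have := bnd (M^-1 * z - M^-1 * c); rewrite /f ler_norml => /andP[h1 h2]; apply/andP; split; lra.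
- move=> z zM cz; have := @low (z - c); rewrite mulrBr => h.
  have {}h : 1 - eta <= iter K (@qsgn R) (sin (M^-1 * z - M^-1 * c)).
    by apply: h; [lra|rewrite (le_trans (ler_norm _))].
  by rewrite /f; lra.
- move=> z zM cz; have := @low (c - z).
  rewrite (_ : _ * (c - z) = - (M^-1 * z - M^-1 * c)); last by ring.
  rewrite sinN iter_qsgn_opp => h.
  have {}h : 1 - eta <= - iter K (@qsgn R) (sin (M^-1 * z - M^-1 * c)).
    by apply: h; [lra|rewrite (le_trans (ler_norm _))// distrC].
  by rewrite /f; lra.
Qed.
End trigonometric_step.

Section continuity_theorem.
Context d (T : measurableType d) (R : realType) (P : probability T R).
Context d' (T' : measurableType d') (P' : probability T' R).
(** The limit variable [g] has a probability space of its own. The moment bound [C] makes [Z]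
    tight. *)
Variables (Z : nat -> T -> R) (g : T' -> R) (C : R).
Hypothesis bZ : forall n, bmf (Z n).
Hypothesis mg : measurable_fun setT g.
Hypothesis ZC : forall n, Ex P (fun x => Z n x ^+ 2) <= C.
Hypothesis Zg : forall tau th,
  (fun n => Ex P (fun x => cos (tau * Z n x + th))) @ \oo -->
    Ex P' (fun x => cos (tau * g x + th)).

Let cos_sum_cvg f : cos_sum (@affine_ev R) f ->
  (fun n => Ex P (fun x => f (Z n x))) @ \oo --> Ex P' (fun x => f (g x)).
Proof.
move=> [s hs].
have mZ n : measurable_fun setT (Z n) by case: (bZ n).
have bc n (p : R * (R^o * R^o)) : bmf (fun x => cos (affine_ev p.2 (Z n x))).
  by apply: bmf_cos; apply: measurable_funD => //; exact: measurable_funM.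
have bc' (p : R * (R^o * R^o)) : bmf (fun x => cos (affine_ev p.2 (g x))).
  by apply: bmf_cos; apply: measurable_funD => //; exact: measurable_funM.
have -> : Ex P' (fun x => f (g x)) = \sum_(p <- s) p.1 * Ex P' (fun x => cos (affine_ev p.2 (g x))).
  rewrite (Ex_ext P' (fun x => hs (g x))) Ex_sum; last by move=> p; exact: bmfZ.
  by apply: eq_bigr => p _; rewrite ExZ.
have -> : (fun n => Ex P (fun x => f (Z n x))) =
    fun n => \sum_(p <- s) p.1 * Ex P (fun x => cos (affine_ev p.2 (Z n x))).
  apply/funext => n; rewrite (Ex_ext P (fun x => hs (Z n x))) Ex_sum; last by move=> p; exact: bmfZ.
  by apply: eq_bigr => p _; rewrite ExZ.
by apply: (@cvg_finsum R) => p; apply: cvgMl_tmp; exact: Zg.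
Qed.

Let F n u := Ex P (fun x => (Z n x <= u)%R%:R).
Let G u := Ex P' (fun x => (g x <= u)%R%:R).

(** One trigonometric step around [c] lies, up to [eta] and the tails, between the indicators of
    [z <= c - del] and [z <= c + del]; its expectations converge because it is a cosine sum. *)
Lemma cdf_interlace (c del e : R) : 0 < del -> 0 < e ->
  \forall n \near \oo, F n (c - del) <= G (c + del) + e /\ G (c - del) <= F n (c + del) + e.
Proof.
(* Five losses: a step error and a tail for each of the two laws, and one for the convergence of the
   expectations of the step. *)
move=> d0 e0; pose eta := e / 5.
have h0 : 0 < eta by rewrite divr_gt0.
have C0 : 0 <= C by apply: le_trans (ZC 0); apply: Ex_ge0 => x; exact: sqr_ge0.
have mgc : measurable_fun setT (fun x => g x - c) by exact: measurable_funB.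
have bZc n : bmf (fun x => Z n x - c) by apply: bmfB => //; exact: bmf_cst.
have mZ n : measurable_fun setT (Z n) by case: (bZ n).
have [M1 [M10 hM1]] := tail_small P' h0 mgc.
pose B := 2 * C + 2 * c ^+ 2.
have B0 : 0 <= B by rewrite addr_ge0// mulr_ge0// sqr_ge0.
(* [M1] handles the tail of [g]. For [Z n], [M >= B / eta] and [M >= 1] give [B / M^2 <= eta] in
   Chebyshev's inequality. *)
pose M := M1 + B / eta + 1.
have BE0 : 0 <= B / eta by rewrite divr_ge0// ltW.
have M0 : 0 < M by rewrite /M; lra.
have tg : Ex P' (fun x => (M < `|g x - c|)%R%:R) <= eta by apply: hM1; rewrite /M; lra.
have tZ n : Ex P (fun x => (M < `|Z n x - c|)%R%:R) <= eta.
  rewrite (le_trans (chebyshev_bool P M0 (bZc n)))//.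
  have EB : Ex P (fun x => (Z n x - c) ^+ 2) <= B.
    have bq : bmf (fun x => 2 * Z n x ^+ 2) by apply: bmfZ; exact: bmfX.
    rewrite (@le_trans _ _ (Ex P (fun x => 2 * Z n x ^+ 2 + 2 * c ^+ 2)))//.
      apply: Ex_le; [exact: bmfX|by apply: bmfD => //; exact: bmf_cst|].
      by move=> x; rewrite -subr_ge0 (_ : _ - _ = (Z n x + c) ^+ 2) ?sqr_ge0//; ring.
    by rewrite ExD ?Ex_cst ?ExZ//; [rewrite lerD2r ler_wpM2l|exact: bmfX|exact: bmf_cst].
  rewrite ler_pdivrMr ?exprn_gt0// (le_trans EB)//.
  rewrite mulrC -ler_pdivrMr// expr2 (@le_trans _ _ M)//; first by rewrite /M; lra.
  by rewrite -[leLHS]mulr1 ler_wpM2l ?ltW// /M; lra.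
have [f [cf f01 fr fl]] := trigonometric_step c d0 h0 M0.
have fA z : (z <= c - del)%R%:R <= f z + eta + (M < `|z - c|)%R%:R.
  have /andP[f0 f1] := f01 z; case: (leP `|z - c| M) => hz.
    by case: (leP z (c - del)) => hz2 /=; [have := fl _ hz hz2|]; lra.
  by case: (leP z (c - del)) => hz2 /=; lra.
have fB z : f z <= (z <= c + del)%R%:R + eta + (M < `|z - c|)%R%:R.
  have /andP[f0 f1] := f01 z; case: (leP `|z - c| M) => hz.
    by case: (leP z (c + del)) => hz2 /=; [|have := fr _ hz (ltW hz2)]; lra.
  by case: (leP z (c + del)) => hz2 /=; lra.
have [s hs] := cf.
have mf : measurable_fun setT f.
  rewrite (_ : f = fun z => \sum_(p <- s) p.1 * cos (p.2.1 * z + p.2.2)); last by apply/funext => z; rewrite hs.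
  apply: measurable_sum => p; apply: measurable_funM => //.
  have mp : measurable_fun setT (fun z : R => p.2.1 * z + p.2.2) by apply: measurable_funD => //; exact: measurable_funM.
  by case: (bmf_cos mp).
have bf S (D : measurableType S) (k : D -> R) : measurable_fun setT k -> bmf (fun x => f (k x)).
  move=> mk; apply: (@bmf_bound _ _ _ _ 1); first exact: (measurableT_comp mf mk).
  by move=> x; have /andP[h1 h2] := f01 (k x); rewrite ger0_norm.
have bt S (D : measurableType S) (k : D -> R) : measurable_fun setT k -> bmf (fun x => (M < `|k x - c|)%R%:R : R).
  move=> mk; apply: bmf_bool; apply: measurable_gt_cst; apply: measurableT_comp => //.
  exact: measurable_funB.
have bi S (D : measurableType S) (k : D -> R) u : measurable_fun setT k -> bmf (fun x => (k x <= u)%R%:R : R).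
  by move=> mk; apply: bmf_bool; exact: measurable_le_cst.
have up S (D : measurableType S) (Pr : probability D R) (k : D -> R) : measurable_fun setT k ->
    Ex Pr (fun x => (M < `|k x - c|)%R%:R) <= eta ->
    Ex Pr (fun x => (k x <= c - del)%R%:R) <= Ex Pr (fun x => f (k x)) + eta + eta /\
    Ex Pr (fun x => f (k x)) <= Ex Pr (fun x => (k x <= c + del)%R%:R) + eta + eta.
  move=> mk tk; have b1 := bf _ _ _ mk; have b2 := bt _ _ _ mk; have b3 := bmf_cst D eta.
  have b4 := bi _ _ _ (c + del) mk; have b5 := bmfD b1 b3; have b6 := bmfD b4 b3.
  split.
    rewrite (@le_trans _ _ (Ex Pr (fun x => f (k x) + eta + (M < `|k x - c|)%R%:R)))//.
      by apply: Ex_le => //; [exact: bi|exact: bmfD].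
    by rewrite ExD// ExD// Ex_cst lerD2l.
  rewrite (@le_trans _ _ (Ex Pr (fun x => (k x <= c + del)%R%:R + eta + (M < `|k x - c|)%R%:R)))//.
    by apply: Ex_le => //; exact: bmfD.
  by rewrite ExD// ExD// Ex_cst lerD2l.
have [upA' upB'] := up _ _ P' _ mg tg.
have /cvgrPdist_le/(_ _ h0) := cos_sum_cvg cf; apply: filterS => n.
rewrite ler_norml => /andP[h1 h2].
have [upA upB] := up _ _ P _ (mZ n) (tZ n); have e5 : e = eta *+ 5 by rewrite /eta -mulr_natr divfK.
by rewrite !mulrS mulr0n addr0 in e5; split; rewrite /F /G; lra.
Qed.

Lemma cdf_cvg t : {for t, continuous G} -> (fun n => F n t) @ \oo --> G t.
Proof.
move=> ct; apply/cvgrPdist_le => e e0.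
have e2 : 0 < e / 2 by rewrite divr_gt0.
have /cvgrPdist_le/(_ _ e2)/nbhs_ballP[r /= r0 hr] := ct.
(* The interlacing is centered at [t + del] and [t - del], so [G] is evaluated at distance
   [2 del < r] from [t]. *)
pose del := r / 3.
have d0 : 0 < del by rewrite divr_gt0.
have r3 : r = del + del + del by rewrite /del; field.
have h1 : `|G t - G (t + del + del)| <= e / 2.
  by apply: hr; rewrite /ball/= -addrA opprD addNKr normrN gtr0_norm; lra.
have h2 : `|G t - G (t - del - del)| <= e / 2.
  by apply: hr; rewrite /ball/= -addrA opprD opprD !opprK addNKr gtr0_norm; lra.
near=> n.
have [a1 _] : F n (t + del - del) <= G (t + del + del) + e / 2 /\ G (t + del - del) <= F n (t + del + del) + e / 2.
  by near: n; exact: cdf_interlace.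
have [_ a2] : F n (t - del - del) <= G (t - del + del) + e / 2 /\ G (t - del - del) <= F n (t - del + del) + e / 2.
  by near: n; exact: cdf_interlace.
rewrite addrK in a1; rewrite subrK in a2.
move: h1 h2; rewrite !ler_norml => /andP[h1 h2] /andP[h3 h4]; apply/andP; split; lra.
Unshelve. all: by end_near. Qed.
End continuity_theorem.

Lemma normal_prob_cos (R : realType) (s tau th : R) : 0 < s ->
  Ex (normal_prob 0 s) (fun x => cos (tau * x + th)) =
    cos th * expR (- (s ^+ 2 * tau ^+ 2 / 2)).
Proof.
move=> s0; rewrite -(normal_char s0) /Ex /Rintegral integral_normal_prob//.
apply: (@bmf_itg _ (measurableTypeR R) R (normal_prob 0 s) (fun x : R => cos (tau * x + th))).
by apply: bmf_cos; apply: measurable_funD => //; exact: measurable_funM.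
Qed.

Lemma gauss_law_cvg d (T : measurableType d) (R : realType) (P : probability T R)
  (Z : nat -> T -> R) (v C : R) : 0 <= v -> (forall n, bmf (Z n)) ->
  (forall n, Ex P (fun x => Z n x ^+ 2) <= C) ->
  (forall tau th, 0 <= tau ->
    (fun n => Ex P (fun x => cos (tau * Z n x + th))) @ \oo -->
      cos th * expR (- (v * tau ^+ 2 / 2))) ->
  cvg_in_law P Z (gauss_law v).
Proof.
move=> v0 bZ ZC Zcv.
have {}Zcv tau th : (fun n => Ex P (fun x => cos (tau * Z n x + th))) @ \oo -->
    cos th * expR (- (v * tau ^+ 2 / 2)).
  have [t0|t0] := leP 0 tau; first exact: Zcv.
  have := Zcv (- tau) (- th); rewrite oppr_ge0 => /(_ (ltW t0)).
  rewrite cosN sqrrN => h; rewrite (_ : (fun n => _) = (fun n => Ex P (fun x => cos (- tau * Z n x + - th))))//.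
  by apply/funext => n; apply: Ex_ext => x; rewrite -cosN opprD mulNr.
have mZ n u : measurable [set x | Z n x <= u] by apply: measurable_le_cst; case: (bZ n).
move=> t ct; rewrite (_ : (fun n => _) = (fun n => Ex P (fun x => (Z n x <= t)%R%:R))); last first.
  by apply/funext => n; rewrite Ex_bool.
(* For [v = 0] the limit variable is the constant 0; otherwise it is the identity under
   [normal_prob]. *)
have [v00|vN0] := eqVneq v 0.
  have GE u : fine (gauss_law v [set y | y <= u]) = Ex P (fun x => (0 <= u)%R%:R).
    by rewrite Ex_cst /gauss_law v00 eqxx diracE mem_setE.
  rewrite (funext GE) in ct; rewrite GE; apply: (@cdf_cvg _ _ _ P _ _ P Z (fun=> 0) C) => //.
    move=> tau th; rewrite Ex_cst mulr0 add0r.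
  by have := Zcv tau th; rewrite v00 !mul0r oppr0 expR0 mulr1.
have vp : 0 < v by rewrite lt_neqAle eq_sym vN0.
have sp : 0 < Num.sqrt v by rewrite sqrtr_gt0.
have GE u : fine (gauss_law v [set y | y <= u]) =
    Ex (normal_prob 0 (Num.sqrt v)) (fun x => (x <= u)%R%:R).
  rewrite /gauss_law (negbTE vN0) (@Ex_bool _ (measurableTypeR R) R (normal_prob 0 (Num.sqrt v)) (fun x => (x <= u)%R))//.
  exact: (@measurable_le_cst _ (measurableTypeR R) R id).
rewrite (funext GE) in ct; rewrite GE; apply: (@cdf_cvg _ _ _ P _ (measurableTypeR R) (normal_prob 0 (Num.sqrt v)) Z id C) => //.
  by move=> tau th; rewrite normal_prob_cos// sqr_sqrtr.
Qed.

(** * Ordinal patterns and summability *)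

Section ordinal_patterns.
Context (R : realType).
Implicit Types x : nat -> R.

Let pat_le x i k := (x k < x i) || ((x i == x k) && (i <= k)%N).

Let pat_le_ltn x i k : (i < k)%N -> pat_le x i k = (x k <= x i).
Proof. by move=> ik; rewrite /pat_le (ltnW ik) andbT le_eqVlt orbC eq_sym. Qed.

Let pat_le_gtn x i k : (i < k)%N -> pat_le x k i = ~~ (x k <= x i).
Proof. by move=> ik; rewrite /pat_le leqNgt ik andbF orbF ltNge. Qed.

Let pat_le_total x : total (pat_le x).
Proof.
move=> i k; have [ik|ki|->] := ltngtP i k.
- by rewrite pat_le_ltn// pat_le_gtn// orbN.
- by rewrite pat_le_gtn// pat_le_ltn// orNb.
- by rewrite /pat_le eqxx leqnn orbT.
Qed.

Let pat_le_anti x : antisymmetric (pat_le x).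
Proof.
move=> i k; have [ik|ki|->//] := ltngtP i k.
- by rewrite pat_le_ltn// pat_le_gtn// andbN.
- by rewrite pat_le_gtn// pat_le_ltn// andNb.
Qed.

Let pat_le_trans x : transitive (pat_le x).
Proof.
move=> k i l; rewrite /pat_le => /orP[h1|/andP[/eqP -> h1]] /orP[h2|/andP[/eqP e2 h2]].
- by rewrite (lt_trans h2 h1).
- by rewrite -e2 h1.
- by rewrite h2.
- by rewrite -e2 eqxx (leq_trans h1 h2) orbT.
Qed.

(** The sorting order is total and antisymmetric, so the sorted list and the order determine each
    other. For [i < k] a tie puts [i] first, hence the single test [x k <= x i] decides the pair. *)
Lemma ord_pattern_eq h x x' : (ord_pattern h x == ord_pattern h x') =
  [forall i : 'I_h.+1, forall k : 'I_h.+1, (i < k)%N ==> ((x k <= x i) == (x' k <= x' i))].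
Proof.
have srt y : sorted (pat_le y) (ord_pattern h y) by exact: sort_sorted.
have prm (y : nat -> R) : perm_eq (ord_pattern h y) (iota 0 h.+1) by rewrite perm_sort.
have inpat (y : nat -> R) (i : 'I_h.+1) : (i : nat) \in ord_pattern h y.
  by rewrite (perm_mem (prm y)) mem_iota/= add0n.
apply/eqP/idP => [e|/forallP hx].
  apply/forallP => i; apply/forallP => k; apply/implyP => ik; apply/eqP.
  have srt' := srt x'; rewrite -e in srt'.
  have [lt|lt|eq] := ltngtP (index (i : nat) (ord_pattern h x)) (index (k : nat) (ord_pattern h x)).
  - have := sorted_ltn_index (@pat_le_trans x) (srt x) _ _ (inpat x i) (inpat x k) lt.
    have := sorted_ltn_index (@pat_le_trans x') srt' _ _ (inpat x i) (inpat x k) lt.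
    by rewrite !pat_le_ltn// => -> ->.
  - have := sorted_ltn_index (@pat_le_trans x) (srt x) _ _ (inpat x k) (inpat x i) lt.
    have := sorted_ltn_index (@pat_le_trans x') srt' _ _ (inpat x k) (inpat x i) lt.
    by rewrite !pat_le_gtn// => /negbTE -> /negbTE ->.
  - by move: ik; rewrite -(nth_index 0%N (inpat x i)) eq nth_index ?inpat// ltnn.
apply: (sorted_eq (@pat_le_trans x) (@pat_le_anti x)) => //.
  have hx' a b (ah : (a < h.+1)%N) (bh : (b < h.+1)%N) : (a < b)%N -> (x b <= x a) = (x' b <= x' a).
    by move=> ab; apply/eqP; have /forallP/(_ (Ordinal bh))/implyP := hx (Ordinal ah); exact.
  have pe : {in (fun i => i < h.+1)%N &, pat_le x =2 pat_le x'}.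
    move=> i k; rewrite !unfold_in => ih kh.
    have [ik|ki|->] := ltngtP i k.
    - by rewrite !pat_le_ltn// hx'.
    - by rewrite !pat_le_gtn// hx'.
    - by rewrite /pat_le !eqxx !leqnn !orbT.
  rewrite (eq_in_sorted pe) ?srt//; apply/allP => i.
  by rewrite (perm_mem (prm x')) mem_iota add0n.
by rewrite (perm_trans (prm x))// perm_sym.
Qed.

Lemma ord_pattern_ind h x x' : (if ord_pattern h x == ord_pattern h x' then 1 else 0 : R) =
  \prod_(i < h.+1) \prod_(k < h.+1 | (i < k)%N) ((x k <= x i) == (x' k <= x' i))%:R.
Proof.
rewrite ord_pattern_eq; case: ifPn => [/forallP hx|].
  rewrite big1// => i _; rewrite big1// => k ik.
  by have /forallP/(_ k)/implyP/(_ ik) := hx i => ->.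
rewrite negb_forall => /existsP[i]; rewrite negb_forall => /existsP[k].
rewrite negb_imply => /andP[ik /negbTE hik].
by rewrite (bigD1 i)//= (bigD1 k)//= hik !mul0r.
Qed.
End ordinal_patterns.

Section summability.
Context (R : realType).

(** Telescoping bound for the power series: with [k.+2] factored out it reads
    [1 + b / k.+2 <= (1 - 1 / k.+2)^(-b)], a consequence of [1 + u <= exp u] and
    [ln (1 + u) <= u]. *)
Lemma powR_step (b : R) (k : nat) : 0 <= b ->
  b * k.+2%:R `^ (- b - 1) <= k.+1%:R `^ (- b) - k.+2%:R `^ (- b).
Proof.
move=> b0.
have k0 : 0 < k.+2%:R :> R by [].
have -> : k.+1%:R = k.+2%:R * (1 - k.+2%:R^-1) :> R.
  by rewrite mulrBr mulr1 divff// -(natrB _ (_ : 1 <= k.+2)%N)// subn1.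
have i1 : k.+2%:R^-1 < 1 :> R by rewrite invf_lt1// ltr1n.
rewrite (powRM _ (ltW k0)); last by rewrite subr_ge0 ltW.
have -> : k.+2%:R `^ (- b - 1) = k.+2%:R `^ (- b) * k.+2%:R^-1 :> R.
  by rewrite powRD ?powR_inv1//; apply/implyP => _; rewrite gt_eqF.
move: (powR_ge0 k.+2%:R (- b) : 0 <= _ :> R); move: (k.+2%:R `^ (- b)) => p p0.
rewrite (_ : p * _ - p = p * ((1 - k.+2%:R^-1) `^ (- b) - 1)); last by ring.
rewrite mulrCA ler_wpM2l//.
rewrite lerBrDr addrC /powR ifF; last by rewrite gt_eqF// subr_gt0.
rewrite (le_trans (expR_ge1Dx _))// ler_expR mulNr -mulrN ler_wpM2l// lerNr.
by rewrite le_ln1Dx// ltrN2.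
Qed.

Lemma sum_powR_le (b : R) (n : nat) : 0 < b ->
  \sum_(0 <= k < n) k.+1%:R `^ (- b - 1) <= 1 + b^-1.
Proof.
move=> b0; case: n => [|n]; first by rewrite big_geq// addr_ge0// invr_ge0 ltW.
rewrite big_nat_recl// powR1 lerD2l.
rewrite -[leRHS]mulr1 mulrC -ler_pdivrMr ?invr_gt0// invrK mulrC mulr_sumr.
rewrite (@le_trans _ _ (\sum_(0 <= k < n) (k.+1%:R `^ (- b) - k.+2%:R `^ (- b))))//.
  by apply: ler_sum => k _; exact/powR_step/ltW.
have -> : \sum_(0 <= k < n) (k.+1%:R `^ (- b) - k.+2%:R `^ (- b)) = 1 - n.+1%:R `^ (- b) :> R.
  elim: n => [|n ih]; first by rewrite big_geq// powR1 subrr.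
  by rewrite big_nat_recr//= ih; ring.
by rewrite lerBlDr lerDl powR_ge0.
Qed.

(** Entries of the window covariance at lag [k] are correlations at [k + c] for a fixed offset [c]
    of either sign; the two bounds cover the nonnegative and the negative arguments. *)
Lemma sum_int_shift (rho : int -> R) (M : R) (c : int) (n : nat) :
  (forall z, 0 <= rho z) ->
  (forall m, \sum_(0 <= k < m) rho k%:Z <= M) ->
  (forall m, \sum_(0 <= k < m) rho (- k%:Z) <= M) ->
  \sum_(0 <= k < n) rho (k%:Z + c) <= M + M.
Proof.
move=> r0 h1 h2; have M0 : 0 <= M by have := h1 0%N; rewrite big_geq.
have shift (F : nat -> R) (a : nat) : \sum_(a <= k < a + n) F k = \sum_(0 <= k < n) F (k + a)%N.
  by rewrite -{1}[a]add0n big_addn addKn.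
have [[a ->]|[a ->]] : (exists a : nat, c = a%:Z) \/ (exists a : nat, c = - a%:Z).
  by case: c => a; [left; exists a|right; exists a.+1; rewrite NegzE].
- rewrite (@le_trans _ _ M)//; last by rewrite lerDl.
  rewrite (le_trans _ (h1 (a + n)%N))// [leRHS](@big_cat_nat _ _ _ a)//=; last exact: leq_addr.
  rewrite (shift (fun k => rho k%:Z)) (_ : \sum_(0 <= k < n) rho (k%:Z + a%:Z) = \sum_(0 <= k < n) rho (k + a)%N%:Z)//.
  by rewrite lerDr sumr_ge0.
- rewrite (@le_trans _ _ (\sum_(0 <= k < a + n) rho (k%:Z - a%:Z)))//.
    by rewrite (addnC a) [leRHS](@big_cat_nat _ _ _ n)//= ?leq_addr// lerDl sumr_ge0.
  rewrite (@big_cat_nat _ _ _ a)//= ?leq_addr// lerD//.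
    rewrite big_nat_rev/= add0n (le_trans _ (h2 a.+1))// big_nat_recl// oppr0.
    rewrite (le_trans _ (_ : \sum_(0 <= k < a) rho (- k.+1%:Z) <= _)) ?lerDr//.
    rewrite [leLHS]big_nat [leRHS]big_nat; apply: ler_sum => k /andP[_ ka].
    by rewrite -subzn// addrAC subrr add0r.
  rewrite shift (_ : \sum_(0 <= i < n) _ = \sum_(0 <= i < n) rho i%:Z)//.
  by apply: eq_bigr => i _; rewrite PoszD addrK.
Qed.

Lemma cvg_norm_le (u : nat -> R) (l : R) : u @ \oo --> l -> exists K, 0 <= K /\ forall n, `|u n| <= K.
Proof.
move=> ul; have [M [_ hM]] : bounded_fun u by apply: cvg_seq_bounded; apply/cvg_ex; exists l.
exists (`|M| + 1); split; first exact: addr_ge0.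
by move=> n; apply: hM => //; rewrite (le_lt_trans (ler_norm _))// ltrDl.
Qed.

(** [e < -1/2] is what makes the exponent [2 e = - b - 1] of the squares summable, since then
    [b > 0]; the convergent factor [Lf] is bounded. *)
Lemma power_law_summable (r Lf : nat -> R) (e l : R) : e < - 2^-1 ->
  (forall k, (1 <= k)%N -> r k = k%:R `^ e * Lf k) -> Lf @ \oo --> l ->
  exists M, forall n, \sum_(0 <= k < n) r k ^+ 2 <= M.
Proof.
move=> e2 re /cvg_norm_le[K [K0 LK]]; pose b := - (e * 2) - 1.
have b0 : 0 < b by rewrite /b; lra.
have M0 : 0 <= K ^+ 2 * (1 + b^-1) by rewrite mulr_ge0 ?sqr_ge0// addr_ge0// invr_ge0 ltW.
exists (r 0%N ^+ 2 + K ^+ 2 * (1 + b^-1)) => -[|n].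
  by rewrite big_geq// addr_ge0// sqr_ge0.
rewrite big_nat_recl// lerD2l.
rewrite (le_trans _ (ler_wpM2l (sqr_ge0 K) (sum_powR_le n b0)))// mulr_sumr.
apply: ler_sum => k _; rewrite re// exprMn mulrC ler_pM ?sqr_ge0//.
  by rewrite -real_normK ?num_real// lerXn2r// nnegrE.
rewrite -powR_mulrn ?powR_ge0// -powRrM (_ : - b - 1 = e * 2)//.
by rewrite /b; ring.
Qed.
End summability.

(** * Bivariate Gaussian processes *)

Lemma sqr_sum_le (R : realDomainType) (I : Type) (s : seq I) (a : I -> R) :
  (\sum_(i <- s) a i) ^+ 2 <= 2 ^+ size s * \sum_(i <- s) a i ^+ 2.
Proof.
elim: s => [|i s ih]; first by rewrite !big_nil mulr0 expr0n.
rewrite !big_cons /= [2 ^+ _.+1]exprS.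
have h : 0 <= \sum_(j <- s) a j ^+ 2 by apply: sumr_ge0 => j _; exact: sqr_ge0.
have h1 : 1 <= 2 ^+ size s :> R by rewrite exprn_ege1// ler1n.
move: ih h h1; move: (2 ^+ size s) (\sum_(j <- s) a j ^+ 2) (\sum_(j <- s) a j) (a i) => p q u v ih h h1.
rewrite (@le_trans _ _ (2 * v ^+ 2 + 2 * u ^+ 2))//.
  by rewrite -subr_ge0 (_ : _ - _ = (v - u) ^+ 2) ?sqr_ge0//; ring.
rewrite -mulrDr -mulrA ler_wpM2l// mulrDr lerD//.
by rewrite -[leLHS]mul1r ler_wpM2r// sqr_ge0.
Qed.

(** Relates the symmetric partial sums of the theorem to [autocov_sum]. *)
Lemma sum_centered (R : realDomainType) (c : int -> R) (N : nat) : (forall k, c (- k) = c k) ->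
  \sum_(0 <= i < N.*2.+1) c (i%:Z - N%:Z) = c 0 + 2 * \sum_(0 <= k < N) c k.+1%:Z.
Proof.
move=> cN; rewrite (@big_cat_nat _ _ _ N)//=; last by rewrite -addnn leqW// leq_addr.
rewrite big_nat_rev/= add0n.
have -> : \sum_(0 <= i < N) c ((N - i.+1)%:Z - N%:Z) = \sum_(0 <= k < N) c k.+1%:Z.
  rewrite big_nat [RHS]big_nat; apply: eq_bigr => k /andP[_ kN].
  by rewrite -subzn// addrAC subrr add0r cN.
have -> : \sum_(N <= i < N.*2.+1) c (i%:Z - N%:Z) = c 0 + \sum_(0 <= k < N) c k.+1%:Z.
  rewrite -{1}[N]add0n big_addn -addnn -addnS addKn -[RHS](@big_nat_recl _ _ _ _ 0 (fun k : nat => c k%:Z))//.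
  by apply: eq_bigr => i _; rewrite PoszD addrK.
by ring.
Qed.

(** Accounts for the normalization by [sqrt n / (n - h)] instead of [1 / sqrt (n - h)]. *)
Lemma Ex_cos_scale_le d (T : measurableType d) (R : realType) (P : probability T R)
  (W : T -> R) (a tau th C : R) : 0 <= tau -> bmf W -> Ex P (fun x => W x ^+ 2) <= C ->
  `|Ex P (fun x => cos (tau * (a * W x) + th)) - Ex P (fun x => cos (tau * W x + th))|
    <= tau * `|a - 1| * Num.sqrt C.
Proof.
move=> t0 bW WC.
have bc (g : T -> R) : bmf g -> bmf (fun x => cos (tau * g x + th)).
  by move=> [mg _]; apply: bmf_cos; apply: measurable_funD => //; exact: measurable_funM.
have b1 := bc _ bW; have b2 := bc _ (bmfZ a bW); have b3 := bmf_abs bW.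
rewrite -ExB// (le_trans (Ex_norm P (bmfB b2 b1)))//.
rewrite (@le_trans _ _ (Ex P (fun x => tau * `|a - 1| * `|W x|)))//.
  apply: Ex_le; [exact: bmf_abs (bmfB b2 b1)|exact: bmfZ|] => x.
  rewrite (le_trans (cos_lip _ _))// opprD addrACA subrr addr0 -mulrBr -[X in _ * (_ - X)]mul1r -mulrBl.
  by rewrite !normrM (ger0_norm t0) mulrA.
rewrite ExZ// ler_wpM2l ?mulr_ge0// -[leLHS]ger0_norm; last exact: Ex_ge0.
rewrite -sqrtr_sqr ler_wsqrtr// (le_trans (Ex_sqr_le P b3))//.
rewrite (le_trans _ WC)// le_eqVlt; apply/orP; left; apply/eqP.
by apply: Ex_ext => x; rewrite real_normK ?num_real.
Qed.

Section bivariate_gaussian.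
Context d (T : measurableType d) (R : realType) (P : probability T R).
Local Notation E := (Ex P).
Local Notation Q := (covar P).
Local Notation itg f := (P.-integrable setT (EFin \o f)).
Variables (Y : 'I_2 -> int -> T -> R) (h : nat) (r : 'I_2 -> 'I_2 -> int -> R).
Hypothesis mY : forall p j, measurable_fun setT (Y p j).
Hypothesis gY : centered_gaussian_process P Y.
Hypothesis Y1 : forall p j B, measurable B -> P (Y p j @^-1` B) = normal_prob 0 1 B.
Hypothesis rY : forall p q j k, (\int[P]_x (Y p j x * Y q (j + k) x)%:E)%E = (r p q k)%:E.

Definition gspan (W : T -> R) : Prop :=
  exists s : seq ('I_2 * int * R), forall x, W x = \sum_(c <- s) c.2 * Y c.1.1 c.1.2 x.

(** At lag 0, [rY] already says that the integral of the square is a finite number. *)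
Let Y_sqr_itg p j : itg (fun x => Y p j x ^+ 2).
Proof.
apply/integrableP; split; first by apply/measurable_EFinP; exact: measurable_funX.
rewrite (eq_integral (fun x => (Y p j x * Y p (j + 0) x)%:E)); first by rewrite rY ltry.
by move=> x _; rewrite /= addr0 ger0_norm ?sqr_ge0.
Qed.

Lemma gspanY p j : gspan (Y p j).
Proof. by exists [:: (p, j, 1)] => x; rewrite big_seq1 mul1r. Qed.

Let gspan_meas W : gspan W -> measurable_fun setT W.
Proof.
move=> [s hs]; rewrite (_ : W = fun x => \sum_(c <- s) c.2 * Y c.1.1 c.1.2 x); last exact/funext.
by apply: measurable_sum => c; exact: measurable_funM.
Qed.

Let gspan_sqr W : gspan W -> itg (fun x => W x ^+ 2).
Proof.
move=> [s hs]; rewrite (_ : W = fun x => \sum_(c <- s) c.2 * Y c.1.1 c.1.2 x); last exact/funext.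
elim: s {W hs} => [|c s ih].
  rewrite (_ : (fun x => _) = fun=> 0); first by have [_] := bmf_cst T (0 : R) => _; apply: bmf_itg; exact: bmf_cst.
  by apply/funext => x; rewrite big_nil expr0n.
pose W x := \sum_(c <- s) c.2 * Y c.1.1 c.1.2 x.
have mW : measurable_fun setT W by apply: gspan_meas; exists s.
rewrite (_ : (fun x => _) = (fun x => (c.2 ^+ 2 * Y c.1.1 c.1.2 x ^+ 2 + 2 * c.2 * (Y c.1.1 c.1.2 x * W x)) + W x ^+ 2)); last first.
  by apply/funext => x; rewrite big_cons -/(W x); ring.
by apply: itgD => //; apply: itgD; apply: itgZ => //; exact: itg_mul.
Qed.

(** The process hypothesis supplies some variance [v]; the second moment identifies it with
    [Q W W]. *)
Let gspan_law W : gspan W -> 0 <= Q W W /\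
  forall B, measurable B -> P (W @^-1` B) = gauss_law (Q W W) B.
Proof.
move=> gW; have [s hs] := gW; have [v [v0 hv]] := gY s.
have {}hv B : measurable B -> P (W @^-1` B) = gauss_law v B.
  by move=> /hv; rewrite (_ : W = fun x => \sum_(c <- s) c.2 * Y c.1.1 c.1.2 x)//; exact/funext.
suff -> : Q W W = v by [].
rewrite -(gauss_law_sqr (gspan_meas gW) v0 hv (gspan_sqr gW)).
by apply: Ex_ext => x; rewrite expr2.
Qed.

Lemma gspan_gaussian : gaussian_space P gspan.
Proof.
split.
- by exists [::] => x; rewrite big_nil.
- by move=> f g [s hs] [t ht]; exists (s ++ t) => x; rewrite big_cat hs ht.
- move=> k f [s hs]; exists [seq (c.1, k * c.2) | c <- s] => x.
  by rewrite hs big_map mulr_sumr; apply: eq_bigr => c _; rewrite mulrA.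
- exact: gspan_meas.
- exact: gspan_sqr.
- move=> f th gf; have [v0 hv] := gspan_law gf.
  exact: (gauss_law_cos (gspan_meas gf) v0 hv).
Qed.
Let gsY := gspan_gaussian.

Lemma gspan_null W : gspan W -> 0 < Q W W -> {ae P, forall x, W x <> 0}.
Proof.
move=> gW vp; have [v0 hv] := gspan_law gW.
exists (W @^-1` [set 0]); split.
- by rewrite -[X in measurable X]setTI; apply: (gspan_meas gW) => //; exact: measurable_set1.
- exact: (gauss_law_eq0 hv vp).
- by move=> x /= /contrapT.
Qed.

Lemma covar_Y p q j k : Q (Y p j) (Y q (j + k)) = r p q k.
Proof. by rewrite /covar /Ex /Rintegral rY. Qed.

Lemma r_opp p q k : r p q (- k) = r q p k.
Proof. by rewrite -(covar_Y p q k) subrr covarC -(covar_Y q p 0) add0r. Qed.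

Lemma r_diag0 p : r p p 0 = 1.
Proof.
have Y1' B : measurable B -> P (Y p 0 @^-1` B) = gauss_law 1 B.
  by move=> mB; rewrite Y1// /gauss_law oner_eq0 sqrtr1.
rewrite -(covar_Y p p 0) addr0 -(gauss_law_sqr (mY p 0) ler01 Y1' (Y_sqr_itg p 0)).
by apply: Ex_ext => x; rewrite expr2.
Qed.

(** The increment [X_(a + m - 1) - X_(a - 1)] of component [p]. *)
Definition block p (a : int) (m : nat) (x : T) : R := \sum_(0 <= l < m) Y p (a + l%:Z) x.

Lemma gspan_block p a m : gspan (block p a m).
Proof. by apply: (gs_sum gsY) => l; exact: gspanY. Qed.

Hypothesis r_lt1 : forall p q (k : int), 1 <= k -> `|r p q k| < 1.

(* If [Y_1 + ... + Y_m] were null, then so would be its shift by one step, hence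
   [Y_(m+1) - Y_1], and the correlation at lag [m] would be [1]. *)
Lemma block_var_gt0 p a m : (0 < m)%N -> 0 < Q (block p a m) (block p a m).
Proof.
move=> m0; rewrite lt_neqAle eq_sym andbC (covar_ge0 P)/=; apply/eqP => v0.
have vE b : Q (block p b m) (block p b m) = Q (block p a m) (block p a m).
  have e c : Q (block p c m) (block p c m) = \sum_(0 <= l < m) \sum_(0 <= l' < m) r p p (l'%:Z - l%:Z).
    rewrite {1}/block (covar_suml gsY); [|exact: gspan_block|by move=> l; exact: gspanY].
    apply: eq_bigr => l _; rewrite /block (covar_sumr gsY); [|exact: gspanY|by move=> l'; exact: gspanY].
    by apply: eq_bigr => l' _; rewrite -(covar_Y _ _ (c + l%:Z)) addrACA subrr addr0.
  by rewrite !e.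
have v1 : Q (block p (a + 1) m) (block p (a + 1) m) = 0 by rewrite vE.
have b0 := gspan_block p a m; have b1 := gspan_block p (a + 1) m.
have c0 : Q (block p (a + 1) m) (block p a m) = 0.
  apply/eqP; rewrite -sqrf_eq0 -normr_le0 ger0_norm ?sqr_ge0//.
  by rewrite (le_trans (covar_CS gsY b1 b0))// v0 mulr0.
have := covar_subsub gsY b1 b0; rewrite v0 v1 c0.
rewrite (_ : (fun x => block p (a + 1) m x - block p a m x) = (fun x => Y p (a + m%:Z) x - Y p a x)); last first.
  apply/funext => x; rewrite /block; case: m m0 {v0 vE v1 b0 b1 c0} => // m _.
  rewrite big_nat_recr//= [X in _ - X]big_nat_recl//= addr0.
  under [X in _ - (_ + X)]eq_bigr do rewrite -[in _.+1%:Z]addn1 PoszD (addrC _ 1%:Z) addrA.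
  rewrite (_ : a + m.+1%:Z = a + 1 + m%:Z); last by rewrite -addn1 PoszD (addrC m%:Z) addrA.
  have e (s y z : R) : s + y - (z + s) = y - z by ring.
  exact: e.
rewrite (covar_subsub gsY); [|exact: gspanY|exact: gspanY].
have yy b : Q (Y p b) (Y p b) = 1 by rewrite -(r_diag0 p) -(covar_Y p p b) addr0.
rewrite !yy covarC covar_Y => e; have := @r_lt1 p p m%:Z m0.
have -> : r p p m%:Z = 1 by lra.
by rewrite normr1 ltxx.
Qed.

Local Notation N := #|{: 'I_2 * 'I_h}|.

(** All [2 h] increments in the window starting at [j], read as one vector, so that the results on
    stationary Gaussian vectors apply. *)
Definition obs (u : 'I_N) (j : int) (x : T) : R :=
  Y (enum_val u).1 (j + (enum_val u).2%:Z) x.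

Definition obs_cov (k : int) : 'M[R]_N :=
  \matrix_(u < N, v < N) r (enum_val u).1 (enum_val v).1 (k + ((enum_val v).2%:Z - (enum_val u).2%:Z)).

Lemma gspan_obs u j : gspan (obs u j).
Proof. exact: gspanY. Qed.

Lemma covar_obs u v j k : Q (obs u j) (obs v (j + k)) = obs_cov k u v.
Proof.
rewrite mxE -(covar_Y _ _ (j + (enum_val u).2%:Z)) /obs; congr (Q _ (Y _ _)).
by rewrite addrACA [X in _ = _ + X]addrC subrK.
Qed.

Hypothesis r_summable : forall p q, exists M, forall n, \sum_(0 <= k < n) r p q k%:Z ^+ 2 <= M.

Lemma obs_cov_summable : exists M, forall n, \sum_(0 <= k < n) gam obs_cov k%:Z ^+ 2 <= M.
Proof.
have ex (w : 'I_N * 'I_N) : exists M, forall n, \sum_(0 <= k < n) obs_cov k%:Z w.1 w.2 ^+ 2 <= M.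
  case: w => u v.
  have [M1 h1] := r_summable (enum_val u).1 (enum_val v).1.
  have [M2 h2] := r_summable (enum_val v).1 (enum_val u).1.
  pose M := `|M1| + `|M2|; have l1 := ler_norm M1; have l2 := ler_norm M2.
  have n1 := normr_ge0 M1; have n2 := normr_ge0 M2.
  exists (M + M) => n; under eq_bigr do rewrite mxE.
  apply: (@sum_int_shift R (fun k => r (enum_val u).1 (enum_val v).1 k ^+ 2)).
  - by move=> z; exact: sqr_ge0.
  - by move=> m; rewrite (le_trans (h1 m))// /M; lra.
  - by move=> m; under eq_bigr do rewrite r_opp; rewrite (le_trans (h2 m))// /M; lra.
have [M hM] := choice ex.
pose c : R := 2 ^+ size (index_enum 'I_N).
have c0 : 0 <= c by rewrite exprn_ge0.
exists (c * (c * \sum_u \sum_v M (u, v))) => n.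
have hg k : gam obs_cov k ^+ 2 <= c * (c * \sum_u \sum_v obs_cov k u v ^+ 2).
  rewrite /gam (le_trans (sqr_sum_le _ _))// ler_wpM2l// mulr_sumr; apply: ler_sum => u _.
  rewrite (le_trans (sqr_sum_le _ _))// ler_wpM2l//; apply: ler_sum => v _.
  by rewrite real_normK ?num_real.
rewrite (le_trans (ler_sum _ (fun k _ => hg k%:Z)))// -mulr_sumr ler_wpM2l// -mulr_sumr ler_wpM2l//.
rewrite exchange_big/=; apply: ler_sum => u _; rewrite exchange_big/=; apply: ler_sum => v _.
exact: (hM (u, v)).
Qed.

(** Coordinates of the increment of component [p] between positions [i] and [k] of the window, as
    [lin_block_form] shows. *)
Definition block_form (p : 'I_2) (i k : nat) : 'rV[R]_N :=
  \sum_(l < h | (i <= l < k)%N) delta_mx 0 (enum_rank (p, l)).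

Let linD (l l' : 'rV[R]_N) (w : int * T) : lin obs (l + l') w.1 w.2 = lin obs l w.1 w.2 + lin obs l' w.1 w.2.
Proof. by rewrite /lin -big_split/=; apply: eq_bigr => u _; rewrite mxE mulrDl. Qed.

Let linZ a (l : 'rV[R]_N) (w : int * T) : lin obs (a *: l) w.1 w.2 = a * lin obs l w.1 w.2.
Proof. by rewrite /lin mulr_sumr; apply: eq_bigr => u _; rewrite mxE mulrA. Qed.

Lemma blockB p j i k x : (i < k)%N -> block p j k x - block p j i x = block p (j + i%:Z) (k - i) x.
Proof.
move=> ik; rewrite /block (@big_cat_nat _ _ _ i _ k)//= ?(ltnW ik)//.
rewrite addrAC subrr add0r -{1}[i]add0n big_addn; apply: eq_bigr => l _.
by rewrite PoszD addrA addrAC.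
Qed.

Lemma lin_block_form p j i k x : (i < k <= h)%N ->
  lin obs (block_form p i k) j x = block p j k x - block p j i x.
Proof.
move=> /andP[ik kh]; rewrite blockB//.
have -> : lin obs (block_form p i k) j x = \sum_(l < h | (i <= l < k)%N) Y p (j + l%:Z) x.
  rewrite /block_form; pose g (l : 'rV[R]_N) := lin obs l j x.
  rewrite -[LHS]/(g _) (big_morph g (fun u v => linD u v (j, x)) (_ : g 0 = 0)); last first.
    by have := linZ 0 0 (j, x); rewrite mul0r scale0r.
  apply: eq_bigr => l _; rewrite /g /lin (bigD1 (enum_rank (p, l)))//= big1 => [|u ul].
    by rewrite mxE !eqxx mul1r addr0 /obs enum_rankK.
  by rewrite mxE eqxx/= (negbTE ul) mul0r.
rewrite -(big_mkord (fun l => (i <= l < k)%N) (fun l => Y p (j + l%:Z) x)).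
transitivity (\sum_(i <= l < k) Y p (j + l%:Z) x).
  rewrite [RHS](big_nat_widen _ _ h)// [RHS](big_nat_widenl _ 0)//.
  by apply: eq_bigl => l; rewrite andbC.
rewrite /block -{1}[i]add0n big_addn; apply: eq_bigr => l _.
by rewrite PoszD addrA addrAC.
Qed.

(** A version of the indicator that is the limit of the trigonometric approximations at every point:
    a tie contributes a factor 1/2, because the sign at 0 is 0. *)
Definition agree (j : int) (x : T) : R :=
  \prod_(i < h.+1) \prod_(k < h.+1 | (i < k)%N)
    (2^-1 + 2^-1 * (Num.sg (lin obs (block_form ord0 i k) j x) * Num.sg (lin obs (block_form ord_max i k) j x))).

Lemma ind_patternE j x : ind_pattern h Y j x =
  \prod_(i < h.+1) \prod_(k < h.+1 | (i < k)%N)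
    ((block ord0 j k x <= block ord0 j i x) == (block ord_max j k x <= block ord_max j i x))%R%:R.
Proof.
rewrite /ind_pattern /same_pattern /tilde_pattern ord_pattern_ind.
have e p (i : nat) : \sum_(1 <= l < i.+1) Y p (j + l%:Z - 1) x = block p j i x.
  by rewrite big_add1; apply: eq_bigr => l _; rewrite -addn1 PoszD addrA addrK.
by apply: eq_bigr => i _; apply: eq_bigr => k _; rewrite !e.
Qed.

Lemma ind_pattern_agree j : {ae P, forall x, ind_pattern h Y j x = agree j x}.
Proof.
(* All comparisons in the window concern countably many blocks, each a nondegenerate Gaussian
   variable. *)
have tie p : {ae P, forall x, forall m n : nat, block p (j + m%:Z) n.+1 x <> 0}.
  apply: ae_foralln => m; apply: ae_foralln => n.
  by apply: gspan_null; [exact: gspan_block|exact: block_var_gt0].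
have := tie ord_max; apply: filterS2 (tie ord0) => x h0 h1.
rewrite ind_patternE; apply: eq_bigr => i _; apply: eq_bigr => k ik.
have kh : (i < k <= h)%N by rewrite ik -ltnS ltn_ord.
rewrite !lin_block_form//.
have nz p : (forall m n : nat, block p (j + m%:Z) n.+1 x <> 0) -> block p j k x - block p j i x != 0.
  by move=> hp; rewrite blockB//; apply/eqP; rewrite -(subnSK ik); exact: hp.
have := nz _ h0; have := nz _ h1.
rewrite -(subr_le0 _ (block ord0 j k x)) -(subr_le0 _ (block ord_max j k x)).
move: (block ord0 j k x - _) (block ord_max j k x - _) => a b.
move=> /lt_total/orP[b0|b0] /lt_total/orP[a0|a0].
- by rewrite !ltW// !ltr0_sg//=; field.
- by rewrite (ltW b0) leNgt a0 (gtr0_sg a0) (ltr0_sg b0)/=; field.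
- by rewrite (ltW a0) leNgt b0 (gtr0_sg b0) (ltr0_sg a0)/=; field.
- by rewrite !leNgt a0 b0 !gtr0_sg//=; field.
Qed.

Lemma bmf_ind_pattern j : bmf (ind_pattern h Y j).
Proof.
have bprod (I : Type) (s : seq I) (pr : pred I) (g : I -> T -> R) :
    (forall i, bmf (g i)) -> bmf (fun x => \prod_(i <- s | pr i) g i x).
  move=> bg; elim: s => [|i s ih].
    by rewrite (_ : (fun x => _) = fun=> 1); [exact: bmf_cst|apply/funext => x; rewrite big_nil].
  case Pi : (pr i).
    rewrite (_ : (fun x => _) = fun x => g i x * \prod_(i <- s | pr i) g i x); first exact: bmfM.
    by apply/funext => x; rewrite big_cons Pi.
  by rewrite (_ : (fun x => _) = fun x => \prod_(i <- s | pr i) g i x)//; apply/funext => x; rewrite big_cons Pi.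
rewrite (funext (ind_patternE j)); apply: (bprod) => i; apply: (bprod) => k.
have bb p : bmf (fun x => (block p j k x <= block p j i x)%R%:R : R).
  rewrite (_ : (fun x => _) = fun x => (block p j k x - block p j i x <= 0)%R%:R).
    apply: bmf_bool; apply: measurable_le_cst; apply: (gs_meas gsY); apply: (gs_sub gsY); exact: gspan_block.
  by apply/funext => x; rewrite subr_le0.
have c1 := bmf_cst T (1 : R).
have b1 := bmfD (bmfM (bb ord0) (bb ord_max)) (bmfM (bmfB c1 (bb ord0)) (bmfB c1 (bb ord_max))).
have be (f g : T -> R) : f =1 g -> bmf f -> bmf g by move=> /funext ->.
apply: be b1 => x.
by do 2 case: (_ <= _); rewrite /= ?(mulr0, mul0r, mulr1, subrr, subr0, addr0, add0r).
Qed.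

(** Approximate signs lie in [[-1, 1]], so each factor lies in [[0, 1]] and products stay bounded.
    Signs of the two components occur in pairs, and a product of two sine sums is a cosine sum. *)
Lemma agree_approx : exists S : nat -> seq (R * 'rV[R]_N),
  (forall m j x, `|evalp obs (S m) j x| <= 1) /\
  (forall j x, (fun m => evalp obs (S m) j x) @ \oo --> agree j x).
Proof.
pose ev (l : 'rV[R]_N) (w : int * T) := lin obs l w.1 w.2.
pose t m i k w := 2^-1 + 2^-1 * (sgn_approx m (ev (block_form ord0 i k) w) * sgn_approx m (ev (block_form ord_max i k) w)).
pose F m w : R := \prod_(i < h.+1) \prod_(k < h.+1 | (i < k)%N) t m i k w.
have FS m : cos_sum ev (F m).
  apply: (cos_sum_prod linD linZ) => i; apply: (cos_sum_prod linD linZ) => k.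
  apply: cos_sumD; first exact: (cos_sum_cst linZ).
  apply: cos_sumZ; apply: (sin_sum_sinM linD linZ).
    exact: (sin_sum_sgn_approx linD linZ).
  exact: (sin_sum_sgn_approx linD linZ).
have [S hS] := choice FS; exists S.
have SE m j x : evalp obs (S m) j x = F m (j, x) by rewrite hS.
have t01 m i k w : 0 <= t m i k w <= 1.
  have : `|sgn_approx m (ev (block_form ord0 i k) w) * sgn_approx m (ev (block_form ord_max i k) w)| <= 1.
    by rewrite normrM -[leRHS]mulr1 ler_pM// sgn_approx_norm.
  by rewrite ler_norml /t; move: (_ * _) => u /andP[u1 u2]; apply/andP; split; lra.
have cvprod (I : Type) (s : seq I) (pr : pred I) (g : I -> nat -> R) (l : I -> R) :
    (forall i, g i @ \oo --> l i) -> (fun m => \prod_(i <- s | pr i) g i m) @ \oo --> \prod_(i <- s | pr i) l i.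
  move=> gl; elim: s => [|i s ih].
    by rewrite big_nil; under eq_fun do rewrite big_nil; exact: cvg_cst.
  rewrite big_cons; under eq_fun do rewrite big_cons.
  by case: (pr i) => //; exact: cvgM.
split=> [m j x|j x].
  rewrite SE /F normr_prod prodr_ile1// => i _; rewrite normr_ge0 normr_prod prodr_ile1// => k _.
  by have /andP[h0 h1] := t01 m i k (j, x); rewrite ger0_norm// h0.
rewrite (_ : (fun m => _) = fun m => F m (j, x)); last by apply/funext => m.
apply: (cvprod) => i; apply: (cvprod) => k.
apply: cvgD; first exact: cvg_cst.
by apply: cvgMl_tmp; apply: cvgM; exact: sgn_approx_cvg.
Qed.

Lemma measurable_agree j : measurable_fun setT (agree j).
Proof.
have [S [S1 Sf]] := agree_approx.
apply: (measurable_fun_cvg (D := setT) (h := fun m => evalp obs (S m) j)) => // m.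
apply: measurable_sum => p; apply: measurable_funM => //.
by case: (@bmf_cos _ _ _ (lin obs p.2 j)) => //; exact: (gs_meas gsY (H_lin gsY gspan_obs _ _)).
Qed.

Lemma pattern_clt : exists sigma2 : R, 0 <= sigma2 /\
  (fun n : nat => \sum_(0 <= i < n.*2.+1)
    fine (\int[P]_x ((ind_pattern h Y 1 x - p_pattern P h Y) *
      (ind_pattern h Y (1 + (i%:Z - n%:Z)) x - p_pattern P h Y))%:E)%E) @ \oo --> sigma2 /\
  cvg_in_law P (fun n x => Num.sqrt n%:R * (phat h Y n x - p_pattern P h Y)) (gauss_law sigma2).
Proof.
have [M gM] := obs_cov_summable; have [S [S1 Sf]] := agree_approx.
have XG := covar_obs; have HX := gspan_obs; have mf := measurable_agree.
have Est := Ex_stationary gsY HX XG mf S1 Sf.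
pose pp := p_pattern P h Y.
have bi := bmf_ind_pattern; have mi j : measurable_fun setT (ind_pattern h Y j) by case: (bi j).
(* [p_pattern] refers to time 1 and the centering of [fbar] to time 0; stationarity of the limit
   identifies the two. *)
have ppE : pp = E (agree 0).
  rewrite -(Est 1) -(Ex_ae (mi 1) (mf 1) (ind_pattern_agree 1)) /pp /p_pattern -Ex_bool.
    by apply: Ex_ext => x; rewrite /ind_pattern; case: same_pattern.
  rewrite (_ : [set _ | _] = [set x | 0 < ind_pattern h Y 1 x]); last first.
    by apply/seteqP; split => x; rewrite /= /ind_pattern; case: same_pattern => //; rewrite ltxx.
  exact: measurable_gt_cst.
pose gb j x := ind_pattern h Y j x - pp.
have bgb j : bmf (gb j) by apply: bmfB => //; exact: bmf_cst.
have mfb j : measurable_fun setT (fbar P agree j) by apply: measurable_funB.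
have gbE j : {ae P, forall x, gb j x = fbar P agree j x}.
  by have := ind_pattern_agree j; apply: filterS => x; rewrite /gb /fbar => ->; rewrite ppE.
have cE k : fine (\int[P]_x (gb 1 x * gb (1 + k) x)%:E)%E = autocov P agree k.
  rewrite -[in RHS](addrK 1 k) (addrC k) -(autocovE gsY HX XG mf S1 Sf) -/(Rintegral P setT _) -/(Ex P _).
  apply: Ex_ae; [by case: (bmfM (bgb 1) (bgb (1 + k)))|exact: measurable_funM|].
  by have := gbE (1 + k); apply: filterS2 (gbE 1) => x -> ->.
exists (sigma2 P agree); split; first exact: (sigma2_ge0 gsY HX XG gM mf S1 Sf).
split.
  rewrite (_ : (fun n : nat => _) = autocov_sum P agree); first exact: (autocov_sum_cvg gsY HX XG gM mf S1 Sf).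
  apply/funext => n; rewrite -[RHS](sum_centered n (autocov_opp gsY HX XG mf S1 Sf)).
  by apply: eq_bigr => i _; rewrite -cE.
have [C0 hC0] := nsum_var_bounded gsY HX XG gM mf S1 Sf.
have C00 : 0 <= C0 by apply: le_trans (hC0 0%N); apply: Ex_ge0 => x; exact: sqr_ge0.
have bns n : bmf (nsum gb n) by exact: bmf_nsum.
have nsE n : {ae P, forall x, nsum gb n x = nsum (fbar P agree) n x}.
  have := ae_foralln (fun j : nat => gbE j.+1%:Z); apply: filterS => x hx.
  by rewrite /nsum; congr (_ * _); apply: eq_bigr => j _; exact: hx.
have mns n : measurable_fun setT (nsum (fbar P agree) n).
  by apply: measurable_funM => //; apply: measurable_sum.
have hC n : E (fun x => nsum gb n x ^+ 2) <= C0.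
  rewrite (le_trans _ (hC0 n))// le_eqVlt; apply/orP; left; apply/eqP; apply: Ex_ae.
  - by apply: measurable_funX; case: (bns n).
  - exact: measurable_funX.
  - by have := nsE n; apply: filterS => x ->.
pose Z n x := Num.sqrt n%:R * (phat h Y n x - pp).
(* With [n = m + h + 1] there are [n - h = m + 1] summands, and [a m = sqrt (n / (n - h))]. *)
pose a m : R := Num.sqrt (1 + h%:R * harmonic m).
have ZE m x : Z (m + h.+1)%N x = a m * nsum gb m.+1 x.
  have m0 : 0 < m.+1%:R :> R by [].
  have sm : Num.sqrt m.+1%:R != 0 :> R by rewrite gt_eqF// sqrtr_gt0.
  have sE : Num.sqrt (m + h.+1)%:R = a m * Num.sqrt m.+1%:R.
    rewrite -sqrtrM ?addr_ge0 ?mulr_ge0//; last by rewrite /harmonic/= invr_ge0.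
    by rewrite mulrDl mul1r /harmonic/= -mulrA mulVf ?gt_eqF// mulr1 -natrD addSnnS.
  rewrite /Z sE -mulrA /nsum; congr (_ * _).
  rewrite /phat addnS -addSn addnK big_add1/= big_mkord sumrB sumr_const card_ord mulrBr mulrBr.
  rewrite -(mulr_natr pp); move: (sqr_sqrtr (ltW m0)) sm; move: (Num.sqrt m.+1%:R) => q <- sm.
  by move: (\sum_(i < m.+1) _) => z; field.
have bZ n : bmf (Z n).
  apply: bmfZ; apply: bmfB; last exact: bmf_cst.
  by apply: bmfZ; apply: bmf_sum.
have a1 : a @ \oo --> (1 : R).
  have h1 : (fun m => 1 + h%:R * harmonic m) @ \oo --> (1 + h%:R * 0 : R).
    by apply: cvgD; [exact: cvg_cst|apply: cvgMl_tmp; exact: cvg_harmonic].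
  rewrite mulr0 addr0 in h1; rewrite -[X in _ --> X]sqrtr1.
  by apply: (cvg_comp (fun m => 1 + h%:R * harmonic m) Num.sqrt); [exact: h1|exact: sqrt_continuous].
(* The summand [h] covers [n <= h], where the inverse of 0 is 0, hence [phat] is 0 and the square is
   at most [n]. For larger [n] the factor [1 + h] bounds [a m ^+ 2]. *)
apply: (@gauss_law_cvg _ _ _ _ _ _ (h%:R + (1 + h%:R) * C0)) => //.
- exact: (sigma2_ge0 gsY HX XG gM mf S1 Sf).
- move=> n; have [nh|hn] := leqP n h.
    have pp1 : `|pp| <= 1.
      rewrite ppE; apply: Ex_norm_le; last by move=> x; apply: (lim_le (cvg_norm (Sf 0 x))) => m; exact: S1.
      by apply: (bmf_bound (mf 0) (K := 1)) => x; apply: (lim_le (cvg_norm (Sf 0 x))) => m; exact: S1.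
    rewrite (@le_trans _ _ h%:R)//; last by rewrite lerDl mulr_ge0// addr_ge0.
    rewrite -(Ex_cst P h%:R); apply: Ex_le; [exact: (bmfX 2 (bZ n))|exact: bmf_cst|] => x.
    move: nh; rewrite -subn_eq0 /phat => /eqP nh0; rewrite nh0 invr0 mul0r sub0r exprMn sqr_sqrtr// sqrrN.
    rewrite -[leRHS]mulr1 ler_pM ?sqr_ge0// ?ler_nat; first by rewrite -subn_eq0 nh0.
    by rewrite -real_normK ?num_real// expr_le1.
  rewrite -(subnK hn) (Ex_ext P (fun x => congr1 (fun z => z ^+ 2) (ZE (n - h.+1)%N x))).
  move: (n - h.+1)%N => m; rewrite (@le_trans _ _ ((1 + h%:R) * C0))//; last by rewrite lerDr.
  have hm0 : 0 <= h%:R * harmonic m :> R by rewrite mulr_ge0// /harmonic/= invr_ge0.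
  rewrite (Ex_ext P (fun x => exprMn 2 (a m) (nsum gb m.+1 x))) ExZ; last exact: bmfX.
  rewrite ler_pM ?sqr_ge0//; first by apply: Ex_ge0 => x; exact: sqr_ge0.
  rewrite sqr_sqrtr ?addr_ge0// lerD2l -[leRHS]mulr1 ler_wpM2l// /harmonic/= invf_le1// ler1n//.
(* Drops the first [h + 1] indices, which leaves the range of [ZE]. *)
move=> tau th t0; rewrite -(cvg_shiftn h.+1).
pose u m := E (fun x => cos (tau * nsum (fbar P agree) m.+1 x + th)).
have base : u @ \oo --> cos th * expR (- (sigma2 P agree * tau ^+ 2 / 2)).
  rewrite (cvg_shiftS (fun m => E (fun x => cos (tau * nsum (fbar P agree) m x + th)))).
  exact: (stationary_clt gsY HX XG gM mf S1 Sf t0).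
have dcv : (fun m => E (fun x => cos (tau * Z (m + h.+1)%N x + th)) - u m) @ \oo --> (0 : R).
  apply: norm_cvg0; apply: (@squeeze_cvgr _ _ _ _ (cst 0) (fun m => tau * `|a m - 1| * Num.sqrt C0)).
  - apply: nearW => m; rewrite normr_ge0/=.
    rewrite (Ex_ext P (fun x => congr1 (fun z => cos (tau * z + th)) (ZE m x))).
    suff -> : u m = E (fun x => cos (tau * nsum gb m.+1 x + th)) by exact: Ex_cos_scale_le.
    apply: Ex_ae.
    + by have [] // := @bmf_cos _ _ _ (fun x => tau * nsum (fbar P agree) m.+1 x + th); apply: measurable_funD => //; exact: measurable_funM.
    + have [mn _] := bns m.+1.
      by have [] // := @bmf_cos _ _ _ (fun x => tau * nsum gb m.+1 x + th); apply: measurable_funD => //; exact: measurable_funM.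
    + by have := nsE m.+1; apply: filterS => x ->.
  - exact: cvg_cst.
  - have h1 : (fun m => tau * `|a m - 1| * Num.sqrt C0) @ \oo --> tau * `|1 - 1 : R| * Num.sqrt C0.
      apply: cvgMr_tmp; apply: cvgMl_tmp; apply: cvg_norm; apply: cvgB => //; exact: cvg_cst.
    by rewrite subrr normr0 mulr0 mul0r in h1.
have fin : (fun m => E (fun x => cos (tau * Z (m + h.+1)%N x + th)) - u m + u m) @ \oo -->
    0 + cos th * expR (- (sigma2 P agree * tau ^+ 2 / 2)) by apply: cvgD.
rewrite add0r in fin; rewrite (_ : (fun n => _) = fun m => E (fun x => cos (tau * Z (m + h.+1)%N x + th)) - u m + u m)//.
by apply/funext => m; rewrite subrK.
Qed.
End bivariate_gaussian.

Theorem theorem5 (R : realType) (dT : measure_display) (T : measurableType dT)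
  (P : probability T R) (Y : 'I_2 -> int -> {RV P >-> R}) (h : nat)
  (r : 'I_2 -> 'I_2 -> int -> R) (dd : 'I_2 -> R)
  (Lf : 'I_2 -> 'I_2 -> nat -> R) (L : 'I_2 -> 'I_2 -> R) :
  (* bivariate centered Gaussian process *)
  centered_gaussian_process P (fun p j => (Y p j : T -> R)) ->
  (* Y_j^(p) ~ N(0,1) *)
  (forall p j B, measurable B ->
     P ((Y p j : T -> R) @^-1` B) = normal_prob 0 1 B) ->
  (* stationarity: cross-correlations r^(p,q)(k) = E(Y_j^(p) Y_{j+k}^(q)) *)
  (forall p q j k,
     (\int[P]_x ((Y p j x) * (Y q (j + k) x))%:E)%E = (r p q k)%:E) ->
  (forall p q (k : int), 1 <= k -> `|r p q k| < 1) ->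
  (* condition (S) *)
  (forall p, dd p < 0 \/ (0 < dd p /\ dd p < 4^-1)) ->
  (forall p q (k : nat), (1 <= k)%N ->
     r p q k%:Z = (k%:R `^ (dd p + dd q - 1)) * Lf p q k) ->
  (forall p q, Lf p q @ \oo --> L p q) ->
  (* conclusion *)
  let Yf := fun p j => (Y p j : T -> R) in
  let pp := p_pattern P h Yf in
  let c := fun k : int =>
    fine (\int[P]_x ((ind_pattern h Yf 1 x - pp)
                    * (ind_pattern h Yf (1 + k) x - pp))%:E)%E in
  exists sigma2 : R,
    0 <= sigma2 /\
    (fun N : nat => \sum_(0 <= i < (N.*2).+1) c (i%:Z - N%:Z)) @ \oo --> sigma2 /\
    cvg_in_law P (fun n x => Num.sqrt n%:R * (phat h Yf n x - pp))
      (gauss_law sigma2).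
Proof.
move=> gY Y1 rY r1 dS rL LL Yf pp c.
have sqd p : dd p < 4^-1 by have [|[]//] := dS p; move=> d0; rewrite (lt_trans d0)// invr_gt0.
apply: (pattern_clt h _ gY Y1 rY r1) => //.
move=> p q; apply: (power_law_summable _ (rL p q) (LL p q)).
(* Both memory parameters are below 1/4, so the exponent [d_p + d_q - 1] is below -1/2. *)
have := sqd p; have := sqd q; lra.
Qed.
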